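(* Let $E\subset\mathbb{R}^d$, $\mu$, $A$, $B$, $(\mathcal{E}^0,D(\mathcal{E}^0))$, $(\overline{L},D(\overline{L}))$ and $(\overline{T}_t)_{t>0}$ be as in the context. If $(\overline{T}_t)_{t>0}$ is recurrent, then there exists a sequence of functions $(\chi_n)_{n\ge1}$ in $D(\overline{L})_b$ with $0\le\chi_n\le1$ and $\lim_{n\to\infty}\chi_n=1$ $\mu$-a.e. satisfying $\lim_{n\to\infty}(-\overline{L}\chi_n,\chi_n)=0$, where $(-\overline{L}\chi_n,\chi_n)=-\int_E\overline{L}\chi_n\,\chi_n\,d\mu$. Furthermore, $\lim_{n\to\infty}-\overline{L}\chi_n=0$ $\mu$-a.e. and in $L^1(E,\mu)$. In particular, the symmetric Dirichlet form $(\widetilde{\mathcal{E}}^0,D(\mathcal{E}^0))$, $\widetilde{\mathcal{E}}^0(f,g):=\frac12(\mathcal{E}^0(f,g)+\mathcal{E}^0(g,f))$, is recurrent.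
   Context: Setting. $E\subset\mathbb{R}^d$ is either open or closed; if $E$ is closed, $dx(\partial E)=0$. $\varphi\in L^1_{loc}(E,dx)$, $\varphi>0$ $dx$-a.e., and $d\mu:=\varphi\,dx$, a $\sigma$-finite measure on $\mathcal{B}(E)$ with full support. $C_0^\infty(E)$ is the set of smooth functions with compact support in $E$ if $E$ is open, and the set of restrictions to $E$ of functions in $C_0^\infty(\mathbb{R}^d)$ if $E$ is closed. $\langle\cdot,\cdot\rangle$ and $|\cdot|$ are the Euclidean inner product and norm. $V\subset\subset E$ means $V$ is relatively open in $E$ with compact closure contained in $E$. $A=(a_{ij})_{1\le i,j\le d}$ with $a_{ij}\in L^1_{loc}(E,\mu)$ is a possibly non-symmetric matrix with symmetric part $\tilde a_{ij}=\frac12(a_{ij}+a_{ji})$, and for each $V\subset\subset E$ there is $\nu_V>0$ with $\nu_V^{-1}|\xi|^2\le\sum_{i,j}\tilde a_{ij}(x)\xi_i\xi_j\le\nu_V|\xi|^2$ for all $\xi\in\mathbb{R}^d$, $x\in V$. The form $\mathcal{E}^0(f,g):=\int_E\langle A\nabla f,\nabla g\rangle\,d\mu$, $f,g\in C_0^\infty(E)$, is assumed closable on $L^2(E,\mu)$ and to satisfy the strong sector condition $|\mathcal{E}^0(f,g)|\le K\mathcal{E}^0(f,f)^{1/2}\mathcal{E}^0(g,g)^{1/2}$ for some $K>0$; its closure is $(\mathcal{E}^0,D(\mathcal{E}^0))$, with generator $(L^0,D(L^0))$. $\nabla$ is the weak gradient, extended to $D(\mathcal{E}^0)$ as $L^2_{loc}(E,\mathbb{R}^d,\mu)$-limit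 along $\mathcal{E}^0_1$-approximating sequences in $C_0^\infty(E)$. For $V\subset\subset E$, $C_0^\infty(V):=\{u\in C_0^\infty(E):\mathrm{supp}(u)\subset V\}$, $(\mathcal{E}^{0,V},D(\mathcal{E}^{0,V}))$ is the closure of $(\mathcal{E}^0,C_0^\infty(V))$ on $L^2(V,\mu)$, and $D(\mathcal{E}^{0,E}):=\bigcup_{V\subset\subset E}D(\mathcal{E}^{0,V})\subset D(\mathcal{E}^0)$. For a function space $W$: $W_b$ is the set of $\mu$-a.e. bounded elements, $W_0$ the set of elements with compact support in $E$ (support of $|u|d\mu$), $W_{0,b}=W_0\cap W_b$. $B=(B_1,\dots,B_d)\in L^2_{loc}(E,\mathbb{R}^d,\mu)$ is $\mu$-divergence free: $\int_E\langle B,\nabla f\rangle\,d\mu=0$ for all $f\in C_0^\infty(E)$. It is assumed that $D(L^0)_{0,b}$ is a dense subset of $L^1(E,\mu)$. The operator $\overline{L}$. For $V\subset\subset E$ let $(L^{0,V},D(L^{0,V}))$ be the generator of $(\mathcal{E}^{0,V},D(\mathcal{E}^{0,V}))$ on $L^2(V,\mu)$. The operator $L^Vu:=L^{0,V}u+\langle B,\nabla u\rangle$, $u\in D(L^{0,V})_b$, is closable on $L^1(V,\mu)$ and its closure $\overline{L}^V$ generates a sub-Markovian $C_0$-resolvent of contractions $(\overline{G}^V_\alpha)_{\alpha>0}$. For open $V_n\subset\subset E$ with $\overline{V}_n\subset V_{n+1}$, $\bigcup_nV_n=E$, and $f\in L^1(E,\mu)$, the limit $\overline{G}_\alpha f:=\lim_{n\to\infty}\overline{G}^{V_n}_\alpha(f1_{V_n})$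 exists $\mu$-a.e., is independent of the choice of $(V_n)$, and $(\overline{G}_\alpha)_{\alpha>0}$ is a sub-Markovian $C_0$-resolvent of contractions on $L^1(E,\mu)$. $(\overline{L},D(\overline{L}))$ is its generator and $(\overline{T}_t)_{t>0}$ the corresponding sub-Markovian $C_0$-semigroup of contractions on $L^1(E,\mu)$. $(\overline L,D(\overline L))$ extends $L^0u+\langle B,\nabla u\rangle$, $u\in D(L^0)_{0,b}$; moreover $D(\overline{L})_b\subset D(\mathcal{E}^0)$, and for $u\in D(\overline{L})_b$, $v\in D(\mathcal{E}^{0,E})_b$, $\mathcal{E}^0(u,v)-\int_E\langle B,\nabla u\rangle v\,d\mu=-\int_E\overline{L}u\,v\,d\mu$ and $\mathcal{E}^0(u,u)\le-\int_E\overline{L}u\,u\,d\mu$. Recurrence. For $f\in L^1(E,\mu)$, $f\ge0$, $Gf:=\lim_{N\to\infty}\int_0^N\overline{T}_tf\,dt\in[0,\infty]$. $(\overline{T}_t)_{t>0}$ is recurrent if for every $f\in L^1(E,\mu)$ with $f\ge0$ $\mu$-a.e. one has $Gf(x)\in\{0,\infty\}$ for $\mu$-a.e. $x$. A Dirichlet form is recurrent if its associated semigroup (considered on $L^1(E,\mu)$) is recurrent in the same sense. *)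

(* Defs.v *)
From HB Require Import structures.
From mathcomp Require Import all_boot all_order all_algebra.
From mathcomp Require Import all_classical all_reals all_analysis.

Set Implicit Arguments.
Unset Strict Implicit.
Unset Printing Implicit Defensive.
Import Order.TTheory GRing.Theory Num.Theory.
Import numFieldNormedType.Exports.
Local Open Scope classical_set_scope.
Local Open Scope ring_scope.

(* the Borel sigma-algebra on matrix spaces, in particular on 'rV[R]_d *)
HB.instance Definition _ (R : realType) (m n : nat) :=
  @isMeasurable.Build (sigma_display (@open 'M[R]_(m, n))) 'M[R]_(m, n)
    <<s @open 'M[R]_(m, n) >> (@sigma_algebra0 _ setT _)
    (@sigma_algebraC _ _) (@sigma_algebra_bigcup _ setT _).

(** * Operators, resolvents, semigroups and forms on L^p(mu)

  Elements of L^p are represented by functions T -> R, equalities between them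
  being mu-a.e.; possibly unbounded operators are represented by their graph,
  and everywhere defined ones by a map on representatives. *)

Section Lp.
Context {dT : measure_display} {T : measurableType dT} {R : realType}.
Variable mu : {measure set T -> \bar R}.
Local Notation "'N_ p [ f ]" := (Lnorm mu p (EFin \o f%R)) : ring_scope.
Local Notation "'N_ p [ f ]" := (Lnorm mu p (EFin \o f%R)) : ereal_scope.
Implicit Types (f g h u v s : T -> R) (us vs hs : nat -> T -> R)
  (C D : set (T -> R)) (F : (T -> R) -> (T -> R) -> R).

(* L^p(V, mu), viewed inside L^p(mu) through extension by 0 *)
Definition Lp_on (p : \bar R) (V : set T) : set (T -> R) :=
  [set f | f \in Lfun mu p /\ {ae mu, forall x, ~ V x -> f x = 0}].

Definition Lp_cvg (p : \bar R) us u : Prop :=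
  'N_p[us n \- u] @[n --> \oo] --> 0%E.

Definition ae_bounded u : Prop := exists M : R, {ae mu, forall x, `|u x| <= M}.

Definition unit_valued u : Prop := {ae mu, forall x, 0 <= u x <= 1}.

Definition Lp_dense (p : \bar R) (S : set (T -> R)) : Prop :=
  (forall u, S u -> u \in Lfun mu p) /\
  (forall f (e : R), f \in Lfun mu p -> 0 < e ->
     exists2 u, S u & ('N_p[f \- u] < e%:E)%E).

(** ** Closure of a form (F, C) on L^2(mu) *)

Definition form_cauchy F us : Prop := forall e : R, 0 < e ->
  exists N, forall m n, (N <= m)%N -> (N <= n)%N ->
    `|F (us m \- us n) (us m \- us n)| < e.

Definition form_closable F C : Prop := forall us,
  (forall n, C (us n)) -> form_cauchy F us -> Lp_cvg 2%:E us (cst 0) ->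
  F (us n) (us n) @[n --> \oo] --> 0.

Definition form_approx F C us u : Prop :=
  [/\ forall n, C (us n), form_cauchy F us & Lp_cvg 2%:E us u].

Definition closure_dom F C : set (T -> R) :=
  [set u | u \in Lfun mu 2%:E /\ exists us, form_approx F C us u].

(* the common limit of F (us n) (vs n) over all approximating sequences *)
Definition closure_form F C u v : R :=
  xget 0 [set r | exists us vs,
    [/\ form_approx F C us u, form_approx F C vs v &
        F (us n) (vs n) @[n --> \oo] --> r]].

Definition strong_sector F C : Prop := exists2 K : R, 0 < K &
  forall f g, C f -> C g ->
    `|F f g| <= K * Num.sqrt (F f f) * Num.sqrt (F g g).

Definition sym_form F : (T -> R) -> (T -> R) -> R :=
  fun f g => 2^-1 * (F f g + F g f).

(* graph of the generator L of (F, D) on L^2(V, mu): F(u, v) = (- L u, v) *)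
Definition form_generator F D (V : set T) u h : Prop :=
  [/\ D u, Lp_on 2%:E V h &
      forall v, D v -> F u v = - \int[mu]_x (h x * v x)].

(** ** Operators on L^1(V, mu) *)

Definition L1_closable (L : (T -> R) -> (T -> R) -> Prop) : Prop :=
  forall us hs h, (forall n, L (us n) (hs n)) ->
    Lp_cvg 1 us (cst 0) -> h \in Lfun mu 1 -> Lp_cvg 1 hs h ->
    {ae mu, forall x, h x = 0}.

Definition L1_closure (V : set T) (L : (T -> R) -> (T -> R) -> Prop) u h : Prop :=
  [/\ Lp_on 1 V u, Lp_on 1 V h &
      exists us hs, [/\ forall n, L (us n) (hs n), Lp_cvg 1 us u & Lp_cvg 1 hs h]].

(* sub-Markovian C_0-resolvent of contractions on L^p(V, mu) *)
Record subMarkov_resolvent (p : \bar R) (V : set T)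
    (G : R -> (T -> R) -> (T -> R)) : Prop := SubMarkovResolvent {
  resolvent_stable : forall (a : R) f, 0 < a -> Lp_on p V f -> Lp_on p V (G a f) ;
  resolvent_linear : forall (a c : R) f g, 0 < a -> Lp_on p V f -> Lp_on p V g ->
    {ae mu, forall x, G a (fun y => c * f y + g y) x = c * G a f x + G a g x} ;
  resolvent_contraction : forall (a : R) f, 0 < a -> Lp_on p V f ->
    ('N_p[(fun x => a * G a f x)] <= 'N_p[f])%E ;
  resolvent_equation : forall (a b : R) f, 0 < a -> 0 < b -> Lp_on p V f ->
    {ae mu, forall x, G a f x - G b f x = (b - a) * G a (G b f) x} ;
  resolvent_continuous : forall f, Lp_on p V f ->
    'N_p[(fun x => a * G a f x - f x)] @[a --> +oo] --> 0%E ;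
  resolvent_subMarkov : forall (a : R) f, 0 < a -> Lp_on p V f ->
    unit_valued f -> unit_valued (fun x => a * G a f x) }.

(* graph of the generator a - G_a^-1 of G (it does not depend on a) *)
Definition resolvent_generator (p : \bar R) (V : set T)
    (G : R -> (T -> R) -> (T -> R)) u h : Prop :=
  [/\ Lp_on p V u, Lp_on p V h &
      forall a : R, 0 < a ->
        {ae mu, forall x, u x = G a (fun y => a * u y - h y) x}].

(* sub-Markovian C_0-semigroup (S_t)_{t > 0} of contractions on L^p(mu) *)
Record subMarkov_semigroup (p : \bar R)
    (S : R -> (T -> R) -> (T -> R)) : Prop := SubMarkovSemigroup {
  semigroup_stable : forall (t : R) f, 0 < t -> f \in Lfun mu p ->
    S t f \in Lfun mu p ;
  semigroup_linear : forall (t c : R) f g, 0 < t ->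
    f \in Lfun mu p -> g \in Lfun mu p ->
    {ae mu, forall x, S t (fun y => c * f y + g y) x = c * S t f x + S t g x} ;
  semigroup_contraction : forall (t : R) f, 0 < t -> f \in Lfun mu p ->
    ('N_p[S t f] <= 'N_p[f])%E ;
  semigroup_law : forall (s t : R) f, 0 < s -> 0 < t -> f \in Lfun mu p ->
    {ae mu, forall x, S (s + t) f x = S s (S t f) x} ;
  semigroup_continuous : forall f, f \in Lfun mu p ->
    'N_p[S t f \- f] @[t --> 0^'+] --> 0%E ;
  semigroup_subMarkov : forall (t : R) f, 0 < t -> f \in Lfun mu p ->
    unit_valued f -> unit_valued (S t f) }.

Definition semigroup_generator (p : \bar R) (S : R -> (T -> R) -> (T -> R))
    u h : Prop :=
  [/\ u \in Lfun mu p, h \in Lfun mu p &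
      'N_p[(fun x => t^-1 * (S t u x - u x) - h x)] @[t --> 0^'+] --> 0%E].

(** ** Recurrence *)

(* The integral over [0, b] of the continuous L^1(mu)-valued map t |-> S_t f, as
   the L^1-limit of its Riemann sums: S_t f is only defined mu-a.e. for each t,
   so integrating t |-> S_t f x for a fixed x would depend on representatives. *)
Definition L1_riemann_sum (S : R -> (T -> R) -> (T -> R)) f (b : R) (n : nat)
    : T -> R :=
  fun x => \sum_(k < n.+1) (b / n.+1%:R) * S (k.+1%:R * b / n.+1%:R) f x.

Definition L1_integral (S : R -> (T -> R) -> (T -> R)) f (b : R) : T -> R :=
  xget (cst 0) [set s | s \in Lfun mu 1 /\ Lp_cvg 1 (L1_riemann_sum S f b) s].

(* The upper bound N runs over the integers, so that the limit is well defined
   mu-a.e.; for f >= 0 the integrals are nondecreasing in N. *)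
Definition potential (S : R -> (T -> R) -> (T -> R)) f : T -> \bar R :=
  fun x => lim ((L1_integral S f N%:R x)%:E @[N --> \oo]).

Definition recurrent (S : R -> (T -> R) -> (T -> R)) : Prop :=
  forall f, f \in Lfun mu 1 -> {ae mu, forall x, 0 <= f x} ->
    {ae mu, forall x, potential S f x = 0%E \/ potential S f x = +oo%E}.

(* S is the semigroup of the Dirichlet form (F, D) considered on L^1(mu): it
   agrees on the intersection of L^1 and L^2 with the L^2-semigroup generated by
   the generator of (F, D). *)
Definition L1_semigroup_of_form F D (S : R -> (T -> R) -> (T -> R)) : Prop :=
  subMarkov_semigroup 1 S /\
  exists P, [/\ subMarkov_semigroup 2%:E P,
    forall u h, form_generator F D setT u h <-> semigroup_generator 2%:E P u h &
    forall (t : R) f, 0 < t -> f \in Lfun mu 1 -> f \in Lfun mu 2%:E ->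
      {ae mu, forall x, S t f x = P t f x}].

(* The semigroup attached to a Dirichlet form exists and is unique up to mu-a.e.
   equality. *)
Definition form_recurrent F D : Prop :=
  forall S, L1_semigroup_of_form F D S -> recurrent S.

End Lp.

(** * The setting in R^d *)

Section Rd.
Context {R : realType} {d : nat}.
Local Notation X := 'rV[R]_d.
Implicit Types (E V K : set X) (f u v k h : X -> R)
  (us : nat -> X -> R).

(* characterizes Lebesgue measure among the Borel measures *)
Definition is_lebesgue_measure (lam : {measure set X -> \bar R}) : Prop :=
  forall a b : X, (forall i, a ord0 i <= b ord0 i) ->
    lam [set x | forall i, a ord0 i < x ord0 i <= b ord0 i] =
    (\prod_(i < d) (b ord0 i - a ord0 i))%:E.

Definition dotp (a b : X) : R := \sum_(i < d) a ord0 i * b ord0 i.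

Definition partial (i : 'I_d) u : X -> R := fun x => 'D_(delta_mx ord0 i) u x.

Definition grad u : X -> X := fun x => \row_i partial i u x.

Definition smooth u : Prop := forall s : seq 'I_d,
  continuous (foldr partial u s) /\
  forall i x, derivable (foldr partial u s) x (delta_mx ord0 i).

(* Elements of C_0^oo(E) are represented by functions on R^d. When E is closed
   these are arbitrary extensions; values and gradients off E play no role since
   mu only charges E and the boundary of E is a null set. *)
Definition test_fun E : set (X -> R) :=
  [set u | [/\ smooth u, compact (closure [set x | u x != 0]) &
               open E -> closure [set x | u x != 0] `<=` E]].

(* the support of u is taken in E *)
Definition test_fun_in E V : set (X -> R) :=
  [set u | test_fun E u /\
           E `&` closure (E `&` [set x | u x != 0]) `<=` V].

(* V is relatively open in E, with compact closure contained in E *)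
Definition rel_compact E V : Prop :=
  [/\ exists2 O : set X, open O & V = O `&` E,
      compact (closure V) & closure V `<=` E].

Definition exhaustion E (V_ : nat -> set X) : Prop :=
  [/\ forall n, rel_compact E (V_ n),
      forall n, closure (V_ n) `<=` V_ n.+1 & \bigcup_n V_ n = E].

Variable mu : {measure set X -> \bar R}.

Definition Lp_loc (p : nat) E u : Prop :=
  measurable_fun E u /\
  forall K, compact K -> K `<=` E ->
    mu.-integrable K (fun x => (`|u x| ^+ p)%:E).

(* mu = 1_E phi dlam is a measure on the whole of R^d carried by E, so that
   L^p(E, mu) is L^p(mu) *)
Definition is_density (lam : {measure set X -> \bar R}) E (phi : X -> R) : Prop :=
  forall S, measurable S -> mu S = (\int[lam]_(x in S `&` E) (phi x)%:E)%E.

Definition full_support E : Prop :=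
  forall O : set X, open O -> O `&` E !=set0 -> (0 < mu (O `&` E))%E.

(* support in E of the measure |u| dmu *)
Definition measure_supp E u : set X :=
  [set x | E x /\ forall O : set X, open O -> O x ->
                   ~ {ae mu, forall y, O y -> u y = 0}].

Definition locally_elliptic E (A : X -> 'M[R]_d) : Prop :=
  forall V, rel_compact E V -> exists2 nu : R, 0 < nu &
    forall x xi, V x ->
      nu^-1 * dotp xi xi <=
        \sum_(i < d) \sum_(j < d)
          (2^-1 * (A x i j + A x j i)) * xi ord0 i * xi ord0 j <=
      nu * dotp xi xi.

Definition preform E (A : X -> 'M[R]_d) u v : R :=
  \int[mu]_(x in E) (\sum_(i < d) \sum_(j < d)
    A x i j * grad u x ord0 j * grad v x ord0 i).

Definition divergence_free E (B : X -> X) : Prop :=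
  forall f, test_fun E f -> \int[mu]_(x in E) dotp (B x) (grad f x) = 0.

Section form.
Variables (E : set X) (A : X -> 'M[R]_d).

Definition dom_E0 : set (X -> R) := closure_dom mu (preform E A) (test_fun E).

Definition E0 : (X -> R) -> (X -> R) -> R :=
  closure_form mu (preform E A) (test_fun E).

Definition dom_E0V V : set (X -> R) :=
  closure_dom mu (preform E A) (test_fun_in E V).

Definition E0V V : (X -> R) -> (X -> R) -> R :=
  closure_form mu (preform E A) (test_fun_in E V).

Definition dom_E0_loc : set (X -> R) :=
  [set u | exists2 V, rel_compact E V & dom_E0V V u].

Definition gen_L0 : (X -> R) -> (X -> R) -> Prop :=
  form_generator mu E0 dom_E0 setT.

Definition gen_L0V V : (X -> R) -> (X -> R) -> Prop :=
  form_generator mu (E0V V) (dom_E0V V) V.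

Definition dom_L0_0b : set (X -> R) :=
  [set u | [/\ exists k, gen_L0 u k, compact (measure_supp E u) &
               ae_bounded mu u]].

(* weak gradient of u in D(E^0): the L^2_loc(E, mu)-limit of the gradients along
   an approximating sequence *)
Definition is_weak_grad u (g : X -> X) : Prop :=
  (forall i, Lp_loc 2 E (fun x => g x ord0 i)) /\
  exists us, form_approx mu (preform E A) (test_fun E) us u /\
    forall K i, compact K -> K `<=` E ->
      (\int[mu]_(x in K) ((grad (us n) x ord0 i - g x ord0 i) ^+ 2)%:E)%E
        @[n --> \oo] --> 0%E.

Definition weak_grad u : X -> X := xget (cst 0) [set g | is_weak_grad u g].

Variable B : X -> X.

(* L^V u = L^{0,V} u + <B, grad u> on D(L^{0,V})_b *)
Definition op_LV V u h : Prop :=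
  [/\ ae_bounded mu u, Lp_on mu 1 V h &
      exists2 k, gen_L0V V u k &
        {ae mu, forall x, h x = k x + dotp (B x) (weak_grad u x)}].

End form.

End Rd.

(* Main.v *)
(** Part 1.  Fix [w] in L^1 with [0 < w <= 1]; for [a > 0], let [chi_a] solve
  [(a - Lbar + w) chi_a = w]; it takes values in [0, 1] and increases as [a]
  decreases to 0, say to [chi_0].  Since [chi_a = G_a (w (1 - chi_a))], the
  function [g := w (1 - chi_0)] satisfies [G_a g <= 1] for all [a > 0].
  Integrating [T_t] along [u = G_a g] yields
  [\int_0^N T_t g dt = u - T_N u + a \int_0^N T_t u dt <= 1 + a N], so the
  potential of [g] is at most 1; by recurrence it vanishes, whence [g = 0] and
  [chi_0 = 1].  Finally [- Lbar chi_a = w (1 - chi_a) - a chi_a], where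
  [a chi_a] has L^1-norm at most that of [w (1 - chi_a)].

  Part 2.  Let [S] be the semigroup of the symmetric form [F], and let [g >= 0]
  be bounded and integrable with potential at most [c] on [{g > 0}].  The
  discounted integral [u = \int_0^N e^(-a t) S_t g dt] satisfies
  [(a - L) u = g - e^(-a N) S_N g] and [F(u, u) + a |u|^2 <= c |g|_1].  Testing
  against [chi_n], by the sector condition,
  [(g, chi_n) <= K (c |g|_1 F(chi_n, chi_n))^(1/2) + o(1)] as [N] tends to
  infinity and then [a] to 0, so [\int g = 0].  Hence [f = 0] wherever the
  potential of [f >= 0] is finite; applied to [S_t f], whose potential is
  smaller, this shows that the potential of [f] vanishes where it is finite. *)

Require Import Defs.
From HB Require Import structures.
From mathcomp Require Import all_boot all_order all_algebra.
From mathcomp Require Import all_classical all_reals all_analysis.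
From mathcomp Require Import measurable_realfun ring lra.
Import Order.TTheory GRing.Theory Num.Theory.
Import numFieldNormedType.Exports.
Local Open Scope classical_set_scope.
Local Open Scope ring_scope.

Set Implicit Arguments.
Unset Strict Implicit.
Unset Printing Implicit Defensive.

(** * The norm of L^p *)

(** Functions are known only mu-a.e., separately for each time and each parameter, so a statement
    valid a.e. may involve only countably many times. This is why orbits are integrated through
    Riemann sums: inequalities are checked on grids and pass to the limit in L^1. In Part 1 the
    weight [w] is integrable so that [g] lies in L^1, and strictly positive so that
    [w (1 - chi_0) = 0] forces [chi_0 = 1]. In Part 2 a bound on the potential over [{g > 0}] is
    enough, because the energy of [u] is at most [(g, u)]. The discount provides the term [a |u|^2],
    which makes [a (u, chi_n)] vanish as [a] tends to 0 with [n] fixed, so no uniform bound on the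
    L^2-norm of [chi_n] is called for. The finite horizon [N] keeps the Riemann sums bounded when
    [g] is, and this upgrades their L^1-convergence to L^2-convergence, where the form lives. The
    two parts meet in [F(chi_n, chi_n) <= (- Lbar chi_n, chi_n)]: symmetrization does not change the
    diagonal. *)

Section Lp_norm.
Context {dT : measure_display} {T : measurableType dT} {R : realType}.
Variable mu : {measure set T -> \bar R}.
Variable p : R.
Hypothesis p1 : 1 <= p.
Implicit Types (f g h u v : T -> R) (us vs : nat -> T -> R).

(** Real-valued, so that estimates reduce to real arithmetic; because of [fine] it is faithful to
    the norm only on L^p, hence the membership conditions throughout. *)
Definition nrm f : R := fine (Lnorm mu p%:E (EFin \o f)).

Local Notation LL := (Lfun mu p%:E).

Let p1E : (1 <= p%:E)%E. Proof. by rewrite lee_fin. Qed.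

Lemma Lfun_measurable (q : \bar R) f : f \in Lfun mu q -> measurable_fun setT f.
Proof. by rewrite inE => /andP[]; rewrite inE. Qed.

Lemma LfunZ (a : R) f : f \in LL -> a *: f \in LL.
Proof.
move=> fL; have [H0 Hlin] := Lfun_submod_closed mu p1E.
by have := Hlin a f 0 fL H0; rewrite addr0.
Qed.

Lemma LfunD f g : f \in LL -> g \in LL -> f + g \in LL.
Proof.
move=> fL gL; have [H0 Hlin] := Lfun_submod_closed mu p1E.
by have := Hlin 1 f g fL gL; rewrite scale1r.
Qed.

Lemma LfunN f : f \in LL -> - f \in LL.
Proof. by move=> fL; rewrite -scaleN1r; apply: LfunZ. Qed.

Lemma LfunB f g : f \in LL -> g \in LL -> f - g \in LL.
Proof. by move=> fL gL; apply: LfunD => //; apply: LfunN. Qed.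

Lemma Lfun_cst0 : (0 : T -> R) \in LL.
Proof. exact: (Lfun_submod_closed mu p1E).1. Qed.

Lemma Lfun_sum n (F : nat -> T -> R) : (forall i, F i \in LL) ->
  \sum_(i < n) F i \in LL.
Proof.
move=> FL; elim/big_ind: _ => //; [exact: Lfun_cst0|exact: LfunD].
Qed.

Lemma nrm_fine f : f \in LL -> Lnorm mu p%:E (EFin \o f) = (nrm f)%:E.
Proof.
move=> fL; rewrite -[f](Lfun_valP p1E fL).
exact/esym/finite_norm_fine.
Qed.

Lemma nrm_ge0 f : 0 <= nrm f.
Proof. by rewrite fine_ge0// Lnorm_ge0. Qed.

Lemma ler_nrmD f g : f \in LL -> g \in LL -> nrm (f + g) <= nrm f + nrm g.
Proof.
move=> fL gL; have := ler_LnormD (Lfun_Sub p1E fL) (Lfun_Sub p1E gL).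
exact.
Qed.

Lemma nrmZ a f : f \in LL -> nrm (a *: f) = `|a| * nrm f.
Proof.
move=> fL; apply: EFin_inj; rewrite -nrm_fine; last exact: LfunZ.
rewrite EFinM -nrm_fine//; exact: (LnormZ (Lfun_Sub p1E fL) a).
Qed.

Lemma nrmN f : f \in LL -> nrm (- f) = nrm f.
Proof. by move=> fL; rewrite -scaleN1r nrmZ// normrN1 mul1r. Qed.

Lemma nrm0 : nrm 0 = 0.
Proof.
by rewrite -(scale0r (0 : T -> R)) nrmZ ?normr0 ?mul0r//; apply: Lfun_cst0.
Qed.

Lemma ler_nrmB f g : f \in LL -> g \in LL -> nrm (f - g) <= nrm f + nrm g.
Proof.
move=> fL gL; rewrite -(nrmN gL); apply: ler_nrmD => //; exact: LfunN.
Qed.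

Lemma nrm_distC f g : f \in LL -> g \in LL -> nrm (f - g) = nrm (g - f).
Proof. by move=> fL gL; rewrite -nrmN ?opprB//; apply: LfunB. Qed.

Lemma ler_nrm_distD g f h : f \in LL -> g \in LL -> h \in LL ->
  nrm (f - h) <= nrm (f - g) + nrm (g - h).
Proof.
move=> fL gL hL; have -> : f - h = (f - g) + (g - h) by rewrite addrA subrK.
by apply: ler_nrmD; apply: LfunB.
Qed.

Lemma ler_nrm_sum n (F : nat -> T -> R) : (forall i, F i \in LL) ->
  nrm (\sum_(i < n) F i) <= \sum_(i < n) nrm (F i).
Proof.
move=> FL; elim: n => [|n IH]; first by rewrite !big_ord0 nrm0.
rewrite !big_ord_recr/=; apply: (le_trans (ler_nrmD _ _)) => //.
  exact: Lfun_sum.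
by rewrite lerD2r.
Qed.

Lemma nrm_ae_eq f g : f \in LL -> g \in LL ->
  {ae mu, forall x, f x = g x} -> nrm f = nrm g.
Proof.
move=> fL gL fg.
have E h : nrm h = fine ((\int[mu]_x `|(EFin \o h) x| `^ p) `^ p^-1)%E.
  by rewrite /nrm Lnorm.unlock.
have /Lfun_measurable mf := fL; have /Lfun_measurable mg := gL.
rewrite !E; suff -> : (\int[mu]_x `|(EFin \o f) x| `^ p =
  \int[mu]_x `|(EFin \o g) x| `^ p)%E by [].
apply: ge0_ae_eq_integral => //.
- apply: (@measurableT_comp _ _ _ _ _ _ (fun x : \bar R => (x `^ p)%E)) => //=.
    exact: measurable_poweR.
  exact/measurable_EFinP/measurableT_comp.
- apply: (@measurableT_comp _ _ _ _ _ _ (fun x : \bar R => (x `^ p)%E)) => //=.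
    exact: measurable_poweR.
  exact/measurable_EFinP/measurableT_comp.
- by move=> x _; apply: poweR_ge0.
- by move=> x _; apply: poweR_ge0.
- by apply: filterS fg => x + _ /= => ->.
Qed.

Lemma nrm_eq0_ae f : f \in LL -> nrm f = 0 -> {ae mu, forall x, f x = 0}.
Proof.
move=> fL nf0; have := @Lnorm_eq0_eq0 _ _ _ mu (EFin \o f) p%:E.
rewrite nrm_fine// nf0 lte_fin => /(_ _ _ erefl) [].
- by apply/measurable_EFinP; apply: Lfun_measurable fL.
- exact: lt_le_trans ltr01 p1.
- move=> N [mN N0 sub]; exists N; split => // x /= nx; apply: sub => /= H.
  by apply: nx; case: (H I).
Qed.

Lemma nrm_ae0 f : f \in LL -> {ae mu, forall x, f x = 0} -> nrm f = 0.
Proof. by move=> fL f0; rewrite (nrm_ae_eq fL Lfun_cst0 f0) nrm0. Qed.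

Lemma Lp_cvgP us u : (forall n, us n \in LL) -> u \in LL ->
  Lp_cvg mu p%:E us u <-> nrm (us n - u) @[n --> \oo] --> 0.
Proof.
move=> usL uL; rewrite /Lp_cvg.
have -> : (fun n => Lnorm mu p%:E (EFin \o (us n \- u)%R)) =
    (fun n => (nrm (us n - u))%:E).
  by apply/funext => n; rewrite -nrm_fine//; apply: LfunB.
split => [/fine_cvgP[]//|H]; apply: cvg_EFin => //; exact: nearW.
Qed.

Lemma cvg0_le (v w : nat -> R) : (forall n, 0 <= v n <= w n) ->
  w n @[n --> \oo] --> 0 -> v n @[n --> \oo] --> 0.
Proof.
move=> vw w0; apply: (@squeeze_cvgr _ _ _ _ (fun=> 0) w) => //.
  by apply: nearW.
exact: cvg_cst.
Qed.

Lemma cvg_eqfun (v w : nat -> R) (l : R) : v =1 w ->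
  v n @[n --> \oo] --> l -> w n @[n --> \oo] --> l.
Proof. by move=> /funext ->. Qed.

Lemma Lp_cvg_unique us u v : (forall n, us n \in LL) -> u \in LL -> v \in LL ->
  Lp_cvg mu p%:E us u -> Lp_cvg mu p%:E us v -> {ae mu, forall x, u x = v x}.
Proof.
move=> usL uL vL /(Lp_cvgP usL uL) cu /(Lp_cvgP usL vL) cv.
have : nrm (u - v) = 0.
  have H : (fun=> nrm (u - v)) @ \oo --> (0 : R).
    apply: (@cvg0_le _ (fun n => nrm (us n - u) + nrm (us n - v))).
      move=> n; rewrite nrm_ge0/= (nrm_distC (usL n) uL).
      by apply: ler_nrm_distD.
    by rewrite -[X in _ --> X]addr0; apply: cvgD.
  exact: (cvg_unique _ (cvg_cst (nrm (u - v))) H).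
move/(nrm_eq0_ae (LfunB uL vL)); apply: filterS => x.
by rewrite /GRing.add/= => /eqP; rewrite subr_eq0 => /eqP.
Qed.

End Lp_norm.

(** * Order and convergence in L^1 *)

Section L1.
Context {dT : measure_display} {T : measurableType dT} {R : realType}.
Variable mu : {measure set T -> \bar R}.
Implicit Types (f g h u v : T -> R) (us vs : nat -> T -> R).
Local Notation L1 := (Lfun mu 1).
Local Notation nrm1 := (nrm mu 1).

Let le11 : (1 : R) <= 1. Proof. by []. Qed.

Lemma L1_integrable f : f \in L1 -> mu.-integrable setT (EFin \o f).
Proof. by move/Lfun1_integrable. Qed.

Lemma nrm1_fine f : f \in L1 -> (\int[mu]_x `|f x|%:E)%E = (nrm1 f)%:E.
Proof. by move=> fL; rewrite -(nrm_fine le11 fL) Lnorm1. Qed.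

Lemma nrm1E f : f \in L1 -> nrm1 f = \int[mu]_x `|f x|.
Proof. by move=> fL; rewrite /Rintegral nrm1_fine. Qed.

Lemma L1_abs_fin f : measurable_fun setT f ->
  (\int[mu]_x `|f x|%:E < +oo)%E -> f \in L1.
Proof.
move=> mf fi; apply/Lfun1_integrable/integrableP; split => //.
exact/measurable_EFinP.
Qed.

Lemma L1_dominated f g : measurable_fun setT f -> g \in L1 ->
  {ae mu, forall x, `|f x| <= `|g x|} -> f \in L1.
Proof.
move=> mf gL fg; apply: L1_abs_fin => //.
apply: (@le_lt_trans _ _ (\int[mu]_x `|g x|%:E)%E); last first.
  by rewrite nrm1_fine// ltry.
apply: ae_ge0_le_integral => //.
- by apply/measurable_EFinP; apply: measurableT_comp.
- apply/measurable_EFinP; apply: measurableT_comp => //.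
  exact: Lfun_measurable gL.
- by apply: filterS fg => x + _; rewrite lee_fin.
Qed.

Lemma nrm1_le f g : f \in L1 -> g \in L1 ->
  {ae mu, forall x, `|f x| <= `|g x|} -> nrm1 f <= nrm1 g.
Proof.
move=> fL gL fg; rewrite -lee_fin -!nrm1_fine//.
apply: ae_ge0_le_integral => //.
- apply/measurable_EFinP; apply: measurableT_comp => //.
  exact: Lfun_measurable fL.
- apply/measurable_EFinP; apply: measurableT_comp => //.
  exact: Lfun_measurable gL.
- by apply: filterS fg => x + _; rewrite lee_fin.
Qed.

(** The positive part of [u - c] is dominated by [|us n - u|], so its norm is 0. Since [c] itself
    need not be integrable, constants are allowed on a space of infinite measure. *)
Lemma L1_cvg_lec us u (c : T -> R) : (forall n, us n \in L1) -> u \in L1 ->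
  measurable_fun setT c -> nrm1 (us n - u) @[n --> \oo] --> 0 ->
  (forall n, {ae mu, forall x, us n x <= c x}) -> {ae mu, forall x, u x <= c x}.
Proof.
move=> usL uL mc cu usc.
pose w x := Num.max (u x - c x) 0.
have mw : measurable_fun setT w.
  apply: measurable_maxr => //; apply: measurable_funB => //.
  exact: Lfun_measurable uL.
have wle n : {ae mu, forall x, `|w x| <= `|(us n - u) x|}.
  apply: filterS (usc n) => x usx; rewrite /w -[(us n - u) x]/(us n x - u x).
  case: (lerP (u x - c x) 0) => H; rewrite ?normr0//.
  rewrite (@ger0_norm _ (u x - c x)) ?(ltW H)//.
  by rewrite distrC ger0_norm; lra.
have wL : w \in L1 by apply: (L1_dominated mw _ (wle 0%N)); apply: LfunB.
have : nrm1 w = 0.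
  have H : (fun=> nrm1 w) @ \oo --> (0 : R).
    apply: (@cvg0_le _ _ (fun n => nrm1 (us n - u))) => // n.
    by rewrite nrm_ge0 nrm1_le//; apply: LfunB.
  exact: (cvg_unique _ (cvg_cst (nrm1 w)) H).
move/(nrm_eq0_ae le11 wL); apply: filterS => x; rewrite /w.
by case: (lerP (u x - c x) 0) => [|H] H2; lra.
Qed.

Lemma L1_cvg_gec us u (c : T -> R) : (forall n, us n \in L1) -> u \in L1 ->
  measurable_fun setT c -> nrm1 (us n - u) @[n --> \oo] --> 0 ->
  (forall n, {ae mu, forall x, c x <= us n x}) -> {ae mu, forall x, c x <= u x}.
Proof.
move=> usL uL mc cu usc.
have : {ae mu, forall x, - u x <= - c x}.
  apply: (@L1_cvg_lec (fun n => - us n) (- u)).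
  - by move=> n; apply: LfunN.
  - exact: LfunN.
  - exact: measurableT_comp.
  - apply: cvg_eqfun cu => n.
    by rewrite -opprD nrmN//; apply: LfunB.
  - by move=> n; apply: filterS (usc n) => x; rewrite lerN2.
by apply: filterS => x; rewrite lerN2.
Qed.

Lemma L1_cvg_le us vs u v : (forall n, us n \in L1) -> u \in L1 ->
  (forall n, vs n \in L1) -> v \in L1 ->
  nrm1 (us n - u) @[n --> \oo] --> 0 -> nrm1 (vs n - v) @[n --> \oo] --> 0 ->
  (forall n, {ae mu, forall x, us n x <= vs n x}) ->
  {ae mu, forall x, u x <= v x}.
Proof.
move=> usL uL vsL vL cu cv uv.
have : {ae mu, forall x, cst 0 x <= (v - u) x}.
  apply: (@L1_cvg_gec (fun n => vs n - us n)) => //.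
  - by move=> n; apply: LfunB.
  - exact: LfunB.
  - apply: (@cvg0_le _ _ (fun n => nrm1 (vs n - v) + nrm1 (us n - u))).
      move=> n; rewrite nrm_ge0/=.
      have -> : vs n - us n - (v - u) = (vs n - v) - (us n - u).
        by rewrite !opprB addrACA [RHS]addrACA; congr (_ + _); rewrite addrC.
      by apply: ler_nrmB => //; apply: LfunB.
    by rewrite -[X in _ --> X]addr0; apply: cvgD.
  - by move=> n; apply: filterS (uv n) => x; rewrite -subr_ge0.
by apply: filterS => x; rewrite -[(v - u) x]/(v x - u x) subr_ge0.
Qed.

Lemma L1_DCT us u g : (forall n, measurable_fun setT (us n)) ->
  measurable_fun setT u -> g \in L1 ->
  {ae mu, forall x, us n x @[n --> \oo] --> u x} ->
  (forall n, {ae mu, forall x, `|us n x| <= g x}) ->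
  [/\ u \in L1, nrm1 (us n - u) @[n --> \oo] --> 0 &
     \int[mu]_x us n x @[n --> \oo] --> \int[mu]_x u x].
Proof.
move=> mus mu_ gL cu ug.
have [] := @dominated_convergence _ _ _ mu setT measurableT
   (fun n => EFin \o us n) (EFin \o u) (EFin \o g).
- by move=> n; apply/measurable_EFinP.
- exact/measurable_EFinP.
- by apply: filterS cu => x H _; apply: cvg_EFin => //; exact: nearW.
- exact: L1_integrable.
- by apply: filterS (ae_foralln ug) => x H n _; rewrite lee_fin.
move=> ui c1 c2.
have uL : u \in L1 by apply/Lfun1_integrable.
have usL n : us n \in L1.
  apply: (L1_dominated (mus n) gL); apply: filterS (ug n) => x.
  by move/le_trans; apply; rewrite ler_norm.
split => //.
  move/fine_cvg: c1; apply: cvg_eqfun => n.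
  by rewrite nrm1E//; apply: LfunB.
have := integrable_fin_num measurableT ui.
move=> H; have := @fine_cvg _ _ _ _ _ (fine (\int[mu]_x (u x)%:E)).
by move=> /(_ nat \oo _ (fun n => \int[mu]_x (us n x)%:E)%E); apply;
  rewrite fineK.
Qed.

Lemma L1_fatou us u (c : R) : (forall n, us n \in L1) ->
  measurable_fun setT u ->
  {ae mu, forall x, us n x @[n --> \oo] --> u x} ->
  (\forall n \near \oo, nrm1 (us n) <= c) -> u \in L1 /\ nrm1 u <= c.
Proof.
move=> usL mu_ cu [N _ usc].
have mus n := Lfun_measurable (usL n).
have H : (\int[mu]_x `|u x|%:E <= c%:E)%E.
  have mus' n : measurable_fun setT (fun x => `|us (n + N)%N x|%:E).
    by apply/measurable_EFinP; apply: measurableT_comp.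
  have F := @fatou _ _ _ mu setT measurableT _ mus' 
    (fun n x _ => normr_ge0 (us (n + N)%N x)).
  apply: (le_trans _ (le_trans F _)).
    rewrite le_eqVlt; apply/orP; left; apply/eqP.
    apply: ae_eq_integral => //.
    - by apply/measurable_EFinP; apply: measurableT_comp.
    - rewrite [X in measurable_fun _ X](_ : _ = fun x =>
          (- limn_esup (fun n => - `|us (n + N)%N x|%:E))%E).
        apply: measurableT_comp => //; apply: measurable_fun_limn_esup => n.
        by apply: measurableT_comp => //; apply: mus'.
      apply/funext => x; rewrite -limn_einfN; congr limn_einf.
      by apply/funext => n /=; rewrite opprK.
    - apply: filterS cu => x cx _.
      apply/esym; apply: (cvg_limn_einf_sup _).1; apply: cvg_EFin;
        first exact: nearW.
      apply: cvg_norm; move: cx; rewrite -(cvg_shiftn N); exact.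
  apply: (le_trans (limn_einf_sup _)); rewrite limn_esup_lim.
  apply: lime_le; first exact: is_cvg_esups.
  apply: nearW => n; apply: ge_ereal_sup => _ [m _ <-].
  by rewrite nrm1_fine// lee_fin; apply: usc; rewrite /= leq_addl.
have uL : u \in L1 by apply: L1_abs_fin => //; rewrite (le_lt_trans H)// ltry.
by split => //; rewrite -lee_fin -nrm1_fine.
Qed.

(** Riesz-Fischer: a subsequence with summable successive distances converges a.e., and Fatou's
    lemma turns the Cauchy bound into a bound on the distance to the limit. *)
Lemma L1_complete us : (forall n, us n \in L1) ->
  (forall e, 0 < e -> exists N, forall m n, (N <= m)%N -> (N <= n)%N ->
     nrm1 (us m - us n) <= e) ->
  exists2 u, u \in L1 & nrm1 (us n - u) @[n --> \oo] --> 0.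
Proof.
move=> usL cau.
have tn_gt0 k : 0 < 1 / (2 ^ k.+1)%:R :> R by rewrite divr_gt0 ?ltr0n ?expn_gt0.
pose N0 k := projT1 (cid (cau _ (tn_gt0 k))).
have N0P k : forall m n, (N0 k <= m)%N -> (N0 k <= n)%N ->
    nrm1 (us m - us n) <= 1 / (2 ^ k.+1)%:R.
  by rewrite /N0; case: cid.
(* [K k] is the running maximum of the thresholds [N0], so that the extracted indices are
   nondecreasing. *)
pose K := fix K k := match k with 0%N => N0 0%N
   | k'.+1 => maxn (N0 k) (K k') end.
have KN k : (N0 k <= K k)%N by case: k => [|k]//=; rewrite leq_maxl.
have KS k : (K k <= K k.+1)%N by rewrite /= leq_maxr.
pose D n := us (K n.+1) - us (K n).
have DL n : D n \in L1 by apply: LfunB.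
have nD n : nrm1 (D n) <= 1 / (2 ^ n.+1)%:R.
  by apply: N0P => //; apply: leq_trans (KS n).
have mD n : measurable_fun setT (fun x => `|D n x|%:E).
  apply/measurable_EFinP; apply: measurableT_comp => //.
  exact: Lfun_measurable (DL n).
pose F x := (\sum_(0 <= n <oo) `|D n x|%:E)%E.
have F0 x : (0 <= F x)%E by apply: nneseries_ge0.
have iF : mu.-integrable setT F.
  apply/integrableP; split; first exact: ge0_emeasurable_sum.
  under eq_integral do rewrite gee0_abs//.
  rewrite integral_nneseries//.
  apply: (@le_lt_trans _ _ 1%E); last by rewrite ltry.
  apply: le_trans (epsilon_trick0 xpredT (@ler01 R)).
  apply: lee_nneseries => [n _ _|n _]; last by rewrite nrm1_fine// lee_fin.
  exact: integral_ge0.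
have cK : {ae mu, forall x, cvgn (fun n => us (K n) x)}.
  apply: filterS (integrable_ae measurableT iF) => x /(_ I) Fx.
  have /normed_cvg cD : cvgn [normed series (D ^~ x)].
    apply: nnseries_is_cvg => [i|]; first exact: normr_ge0.
    by rewrite -[X in (X < _)%E]/(F x) ltey_eq Fx.
  have -> : (fun n => us (K n) x) =
      (fun n => us (K 0%N) x + series (D ^~ x) n).
    by apply/funext => n; rewrite (eq_sum_telescope (fun n => us (K n) x) n).
  by apply: is_cvgD => //; apply: is_cvg_cst.
(* The upper limit is defined everywhere and measurable, and it is the limit wherever the
   subsequence converges. *)
pose u x := fine (limn_esup (fun n => (us (K n) x)%:E)).
have mu_ : measurable_fun setT u.
  apply: measurableT_comp => //; apply: measurable_fun_limn_esup => n.
  by apply/measurable_EFinP; apply: Lfun_measurable (usL _).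
have cu : {ae mu, forall x, us (K n) x @[n --> \oo] --> u x}.
  apply: filterS cK => x cx; rewrite /u.
  have -> : limn_esup (fun n => (us (K n) x)%:E) =
      (limn (fun n => us (K n) x))%:E.
    by apply: (cvg_limn_einf_sup _).2; apply: cvg_EFin => //; exact: nearW.
  exact: cx.
(* Fatou's lemma for [us m - us (K n)] with [m] fixed and [n] tending to infinity. *)
have H m k : (K k <= m)%N ->
    us m - u \in L1 /\ nrm1 (us m - u) <= 1 / (2 ^ k.+1)%:R.
  move=> km; apply: (@L1_fatou (fun n => us m - us (K n))).
  - by move=> n; apply: LfunB.
  - by apply: measurable_funB => //; apply: Lfun_measurable (usL _).
  - by apply: filterS cu => x cx; apply: cvgB => //; exact: cvg_cst.
  - exists k => // n /= kn; apply: N0P; first exact: leq_trans km.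
    apply: (leq_trans (KN k)); elim: n kn => [|n IH].
      by rewrite leqn0 => /eqP ->.
    by rewrite leq_eqVlt => /predU1P[<-//|/IH/leq_trans]; apply; apply: KS.
exists u.
  have [H1 _] := H (K 0%N) 0%N (leqnn _).
  have -> : u = us (K 0%N) - (us (K 0%N) - u) by rewrite subKr.
  exact: LfunB.
apply/cvgrPdist_le => e e0.
have [k ke] : exists k, 1 / (2 ^ k.+1)%:R <= e.
  have [k _ /(_ k.+1 (leqnSn _))/= hk] :=
    near_infty_natSinv_expn_lt (PosNum e0).
  by exists k; rewrite natrX ltW.
exists (K k) => // m /= km.
by rewrite sub0r normrN ger0_norm ?nrm_ge0// (le_trans (H m k km).2).
Qed.

End L1.

(** * Riemann sums of semigroups on L^p *)

Section semigroup.
Context {dT : measure_display} {T : measurableType dT} {R : realType}.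
Variable mu : {measure set T -> \bar R}.
Variable p : R.
Hypothesis p1 : 1 <= p.
Variable S : R -> (T -> R) -> (T -> R).
Hypothesis SG : subMarkov_semigroup mu p%:E S.
Implicit Types (f g h u v : T -> R) (us vs : nat -> T -> R) (b t s d e : R).
Local Notation L := (Lfun mu p%:E).
Local Notation nr := (nrm mu p).

Lemma semigroupL t f : 0 < t -> f \in L -> S t f \in L.
Proof. exact: (semigroup_stable SG). Qed.

Lemma semigroup_contract t f : 0 < t -> f \in L -> nr (S t f) <= nr f.
Proof.
move=> t0 fL; rewrite -lee_fin -!nrm_fine//; last exact: semigroupL.
exact: (semigroup_contraction SG).
Qed.

Lemma semigroup_lin t a f g : 0 < t -> f \in L -> g \in L ->
  {ae mu, forall x, S t (a *: f + g) x = (a *: S t f + S t g) x}.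
Proof. by move=> t0 fL gL; apply: (semigroup_linear SG). Qed.

Lemma semigroup_distB t f g : 0 < t -> f \in L -> g \in L ->
  nr (S t f - S t g) <= nr (f - g).
Proof.
move=> t0 fL gL; apply: le_trans (semigroup_contract t0 (LfunB p1 fL gL)).
rewrite le_eqVlt; apply/orP; left; apply/eqP; apply: nrm_ae_eq.
- by rewrite LfunB ?semigroupL.
- by rewrite semigroupL ?LfunB.
have := semigroup_lin (-1) t0 gL fL; apply: filterS => x.
by rewrite !scaleN1r (addrC (- g)) => ->; rewrite addrC.
Qed.

Lemma semigroup_nrm_law s t f : 0 < s -> 0 < t -> f \in L ->
  nr (S (s + t) f - S s (S t f)) = 0.
Proof.
move=> s0 t0 fL; apply: (nrm_ae0 p1).
  by rewrite LfunB ?semigroupL ?addr_gt0.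
apply: filterS (semigroup_law SG s0 t0 fL) => x H.
by rewrite -[LHS]/(S (s + t) f x - S s (S t f) x) H subrr.
Qed.

Lemma semigroup_modulus f e : f \in L -> 0 < e ->
  exists2 d, 0 < d & forall t, 0 < t -> t <= d -> nr (S t f - f) <= e.
Proof.
move=> fL e0; have := semigroup_continuous SG fL.
move=> /fine_cvgP[_ /cvgrPdist_le /(_ _ e0)].
case=> d /= d0 H; exists (d / 2); first by rewrite divr_gt0.
move=> t t0 td; have := H t; rewrite /= sub0r normrN gtr0_norm// => /(_ _ t0).
rewrite sub0r normrN ger0_norm; last by rewrite fine_ge0// Lnorm_ge0.
apply; apply: (le_lt_trans td); lra.
Qed.

(** [S_t f - S_s f = S_s (S_(t-s) f - f)] and [S_s] is a contraction, so the modulus of continuity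
    at 0 serves at every positive time. *)
Lemma semigroup_dist s t f e d : f \in L -> 0 < s -> s <= t ->
  (forall r, 0 < r -> r <= d -> nr (S r f - f) <= e) -> 0 <= e ->
  t - s <= d -> nr (S t f - S s f) <= e.
Proof.
move=> fL s0; rewrite le_eqVlt => /predU1P[-> _ e0 _|st H e0 tsd].
  by rewrite subrr nrm0.
have ts0 : 0 < t - s by rewrite subr_gt0.
have tE : t = s + (t - s) by rewrite addrC subrK.
rewrite [in S t f]tE.
apply: (le_trans (ler_nrm_distD p1 _ (_ : S s (S (t - s) f) \in L) _)).
- by rewrite semigroupL// addr_gt0.
- by rewrite !semigroupL.
- by rewrite !semigroupL.
rewrite semigroup_nrm_law// add0r.
by apply: (le_trans (semigroup_distB _ _ _)) => //; rewrite ?semigroupL// H.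
Qed.

(** Right end points, since [S] is only specified at positive times. The step [d] and the number of
    steps [n] are independent arguments, so that integrals over different intervals can be compared
    on one grid. *)
Definition rsum f d n : T -> R := \sum_(k < n) d *: S (k.+1%:R * d) f.

Lemma rsumL f d n : 0 < d -> f \in L -> rsum f d n \in L.
Proof.
move=> d0 fL; apply: (@Lfun_sum _ _ _ mu p p1 _ (fun k => d *: S (k.+1%:R * d)
  f)) => k.
by rewrite LfunZ ?semigroupL ?mulr_gt0.
Qed.

Lemma L1_riemann_sumE f b n :
  L1_riemann_sum S f b n = rsum f (b / n.+1%:R) n.+1.
Proof.
apply/funext => x; rewrite /rsum fct_sumE; apply: eq_bigr => k _.
by rewrite mulrA.
Qed.

(** Each term of step [d] is compared with the [m.+1] finer terms of the same cell, at times less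
    than [d <= D] apart. The error is [e] per unit of time, over a total time [n d]. *)
Lemma rsum_refine f d n m e D : 0 < d -> f \in L -> 0 <= e ->
  (forall r, 0 < r -> r <= D -> nr (S r f - f) <= e) -> d <= D ->
  nr (rsum f d n - rsum f (d / m.+1%:R) (n * m.+1)) <= n%:R * d * e.
Proof.
move=> d0 fL e0 H dD.
elim: n => [|n IH].
  by rewrite /rsum mul0n !big_ord0 subrr nrm0 ?mul0r.
set h := d / m.+1%:R; have h0 : 0 < h by rewrite divr_gt0.
have mh : m.+1%:R * h = d by rewrite /h mulrC divfK.
have -> : rsum f d n.+1 = rsum f d n + d *: S (n.+1%:R * d) f.
  by rewrite /rsum big_ord_recr.
have -> : rsum f h (n.+1 * m.+1) = rsum f h (n * m.+1) +
   \sum_(j < m.+1) h *: S ((n * m.+1 + j).+1%:R * h) f.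
  rewrite /rsum mulSn addnC -(big_mkord xpredT (fun k => h *: S (k.+1%:R * h)
    f)).
  rewrite (big_cat_nat (n := n * m.+1)) ?leq_addr//= !big_mkord; congr (_ + _).
  rewrite -{1}[(n * m.+1)%N]add0n big_addn addKn big_mkord.
  by apply: eq_bigr => j _; rewrite addnC.
have -> : d *: S (n.+1%:R * d) f = \sum_(j < m.+1) h *: S (n.+1%:R * d) f.
  by rewrite sumr_const card_ord scalerMnl -[h *+ _]mulr_natl mh.
rewrite opprD addrACA -sumrB.
have tp k : 0 < k.+1%:R * h by rewrite mulr_gt0.
have n1 : 0 < n.+1%:R * d by rewrite mulr_gt0.
apply: (le_trans (ler_nrmD p1 _ _)).
- by rewrite LfunB ?rsumL.
- apply: (@Lfun_sum _ _ _ mu p p1 _ (fun j => h *: S (n.+1%:R * d) f -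
     h *: S ((n * m.+1 + j).+1%:R * h) f)) => j.
  by rewrite LfunB ?LfunZ ?semigroupL.
rewrite -[in leRHS](addn1 n) natrD !mulrDl mul1r; apply: lerD => //.
apply: (le_trans (ler_nrm_sum p1 (F := fun j : nat => h *: S (n.+1%:R * d) f -
     h *: S ((n * m.+1 + j).+1%:R * h) f) _ _)).
  by move=> j; rewrite LfunB ?LfunZ ?semigroupL.
have -> : d * e = \sum_(j < m.+1) h * e.
  by rewrite sumr_const card_ord -mulr_natl mulrA mh.
apply: ler_sum => j _; rewrite -scalerBr nrmZ// ?LfunB ?semigroupL//.
rewrite (gtr0_norm h0) ler_pM2l//.
have E1 : n.+1%:R * d = (n.+1 * m.+1)%:R * h by rewrite natrM -mulrA mh.
apply: (semigroup_dist (d := D)) => //.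
  rewrite E1 ler_pM2r// ler_nat mulSn [leqRHS]addnC -addnS leq_add2l.
  exact: ltn_ord.
rewrite E1 -mulrBl; apply: le_trans dD; rewrite -[leRHS]mh ler_pM2r//.
by rewrite lerBlDr -natrD ler_nat mulSn leq_add2l leqW// leq_addr.
Qed.

(** The subdivisions into [m.+1] and [n.+1] cells are both compared with their common refinement
    into [m.+1 * n.+1] cells; the modulus [e / (2 b)] over length [b] costs [e / 2] each time. *)
Lemma rsum_cauchy f b : 0 < b -> f \in L -> forall e, 0 < e ->
  exists N, forall m n, (N <= m)%N -> (N <= n)%N ->
    nr (rsum f (b / m.+1%:R) m.+1 - rsum f (b / n.+1%:R) n.+1) <= e.
Proof.
move=> b0 fL e e0.
have eb0 : 0 < e / (2 * b) by rewrite divr_gt0// mulr_gt0.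
have [D D0 HD] := semigroup_modulus fL eb0.
have [N _ HN] : \forall n \near \oo, b / n.+1%:R <= D.
  have Db0 : 0 < D / b by rewrite divr_gt0.
  have := near_infty_natSinv_lt (PosNum Db0); apply: filterS => n /= /ltW.
  by rewrite ler_pdivlMr// mulrC.
have H m n : (N <= m)%N ->
    nr (rsum f (b / m.+1%:R) m.+1 -
        rsum f (b / (m.+1%:R * n.+1%:R)) (m.+1 * n.+1)) <= e / 2.
  move=> Nm; have h0 : 0 < b / m.+1%:R by rewrite divr_gt0.
  have := @rsum_refine f (b / m.+1%:R) m.+1 n (e / (2 * b)) D h0 fL.
  rewrite -[b / _ / _]mulrA -invfM => /(_ (ltW eb0) HD (HN _ Nm)).
  move/le_trans; apply; rewrite [m.+1%:R * _]mulrC divfK//.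
  by rewrite le_eqVlt; apply/orP; left; apply/eqP; field; rewrite gt_eqF.
exists N => m n Nm Nn.
apply: (le_trans (ler_nrm_distD p1 _
   (_ : rsum f (b / (m.+1%:R * n.+1%:R)) (m.+1 * n.+1) \in L) _)).
1-3: by rewrite rsumL ?divr_gt0 ?mulr_gt0.
rewrite [leRHS]splitr; apply: lerD; first exact: H.
rewrite nrm_distC//; last 2 first.
1-2: by rewrite rsumL ?divr_gt0 ?mulr_gt0.
by rewrite [m.+1%:R * _]mulrC [(m.+1 * _)%N]mulnC; apply: H.
Qed.

Lemma semigroup0 t : 0 < t -> {ae mu, forall x, S t 0 x = 0}.
Proof.
move=> t0; have L0 : (0 : T -> R) \in L by apply: Lfun_cst0.
apply: (nrm_eq0_ae p1 (semigroupL t0 L0)).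
apply/eqP; rewrite eq_le nrm_ge0 andbT -(nrm0 mu p1).
exact: semigroup_contract.
Qed.

Lemma semigroupZ t a f : 0 < t -> f \in L ->
  {ae mu, forall x, S t (a *: f) x = a * S t f x}.
Proof.
move=> t0 fL; have L0 : (0 : T -> R) \in L by apply: Lfun_cst0.
have := semigroup_lin a t0 fL L0; rewrite addr0.
move: (semigroup0 t0); apply: filterS2 => x S0 ->.
by rewrite -[LHS]/(a * S t f x + S t 0 x) S0 addr0.
Qed.

Lemma semigroupB t f g : 0 < t -> f \in L -> g \in L ->
  {ae mu, forall x, S t (f - g) x = S t f x - S t g x}.
Proof.
move=> t0 fL gL; have := semigroup_lin (-1) t0 gL fL.
by rewrite !scaleN1r (addrC (- g)); apply: filterS => x ->; rewrite addrC.
Qed.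

Lemma rsumE f d n x : rsum f d n x = \sum_(k < n) d * S (k.+1%:R * d) f x.
Proof. by rewrite /rsum fct_sumE; apply: eq_bigr. Qed.

Lemma rsum_lin a f g d n : 0 < d -> f \in L -> g \in L ->
  {ae mu, forall x, rsum (a *: f + g) d n x = a * rsum f d n x + rsum g d n x}.
Proof.
move=> d0 fL gL.
have H : {ae mu, forall x, forall k : nat,
    S (k.+1%:R * d) (a *: f + g) x = a * S (k.+1%:R * d) f x + S (k.+1%:R * d)
      g x}.
  apply/ae_foralln => k; have k0 : 0 < k.+1%:R * d by rewrite mulr_gt0.
  exact: filterS (semigroup_lin a k0 fL gL).
apply: filterS H => x H; rewrite !rsumE mulr_sumr -big_split/=.
by apply: eq_bigr => k _; rewrite H mulrDr mulrCA.
Qed.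

Lemma rsum_dist f g d n : 0 < d -> f \in L -> g \in L ->
  nr (rsum f d n - rsum g d n) <= n%:R * d * nr (f - g).
Proof.
move=> d0 fL gL; have k0 (k : nat) : 0 < k.+1%:R * d by rewrite mulr_gt0.
rewrite /rsum -sumrB.
apply: (le_trans (ler_nrm_sum p1 (F := fun k : nat => d *: S (k.+1%:R * d) f -
  d *: S (k.+1%:R * d) g) _ _)).
  by move=> j; rewrite LfunB ?LfunZ ?semigroupL.
apply: (@le_trans _ _ (\sum_(k < n) d * nr (f - g))); last first.
  by rewrite sumr_const card_ord -[leLHS]mulr_natl mulrA.
apply: ler_sum => k _; rewrite -scalerBr nrmZ// ?LfunB ?semigroupL//.
by rewrite gtr0_norm// ler_pM2l// semigroup_distB.
Qed.

Lemma rsum_near k d n e D : 0 < d -> k \in L ->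
  (forall r, 0 < r -> r <= D -> nr (S r k - k) <= e) -> n%:R * d <= D ->
  nr (rsum k d n - n%:R * d *: k) <= n%:R * d * e.
Proof.
move=> d0 kL H nD; have -> : n%:R * d *: k = \sum_(i < n) d *: k.
  by rewrite sumr_const card_ord scalerMnl mulr_natl.
have i0 (i : nat) : 0 < i.+1%:R * d by rewrite mulr_gt0.
rewrite /rsum -sumrB.
apply: (le_trans (ler_nrm_sum p1 (F := fun i : nat =>
    d *: S (i.+1%:R * d) k - d *: k) _ _)).
  by move=> i; rewrite LfunB ?LfunZ ?semigroupL.
apply: (@le_trans _ _ (\sum_(i < n) d * e)); last first.
  by rewrite sumr_const card_ord -[leLHS]mulr_natl mulrA.
apply: ler_sum => i _; rewrite -scalerBr nrmZ// ?LfunB ?semigroupL//.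
rewrite gtr0_norm// ler_pM2l//; apply: H => //; apply: le_trans nD.
by rewrite ler_pM2r// ler_nat ltn_ord.
Qed.

(** With the step of the grid equal to that of the difference quotient, each term is the increment
    of the orbit over one cell. Right end points shift the range from [[0, n d]] to
    [[d, (n+1) d]]. *)
Lemma rsum_telescope u d n : 0 < d -> u \in L ->
  {ae mu, forall x, rsum (d^-1 *: (S d u - u)) d n x =
     S (n.+1%:R * d) u x - S d u x}.
Proof.
move=> d0 uL.
have H : {ae mu, forall x, forall k : nat,
    d * S (k.+1%:R * d) (d^-1 *: (S d u - u)) x =
    S (k.+2%:R * d) u x - S (k.+1%:R * d) u x}.
  apply/ae_foralln => k; have k0 : 0 < k.+1%:R * d by rewrite mulr_gt0.
  have dL : S d u - u \in L by rewrite LfunB ?semigroupL.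
  have := semigroup_law SG k0 d0 uL.
  have := semigroupB k0 (semigroupL d0 uL) uL.
  have := semigroupZ d^-1 k0 dL.
  apply: filterS3 => x -> -> E.
  by rewrite mulVKf ?gt_eqF// -E -(natr1 k.+1) mulrDl mul1r.
apply: filterS H => x H; rewrite rsumE.
elim: n => [|n IH]; first by rewrite big_ord0 mul1r subrr.
by rewrite big_ord_recr/= IH H addrC addrA subrK.
Qed.

(** The fundamental theorem of calculus for the orbit: [h] is replaced by the difference quotient of
    [u] with the step of the grid, whose Riemann sum telescopes. *)
Lemma semigroup_generator_rsum u h b : 0 < b ->
  semigroup_generator mu p%:E S u h ->
  nr (rsum h (b / n.+1%:R) n.+1 - (S b u - u)) @[n --> \oo] --> 0.
Proof.
move=> b0 [uL hL /fine_cvgP[_ gen]].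
have dlt (d : R) : 0 < d -> \forall n \near \oo, b / n.+1%:R < d.
  move=> d0; have Db0 : 0 < d / b by rewrite divr_gt0.
  have := near_infty_natSinv_lt (PosNum Db0); apply: filterS => n /=.
  by rewrite ltr_pdivlMr// mulrC.
have dn0 (n : nat) : 0 < b / n.+1%:R by rewrite divr_gt0.
pose q (d : R) := d^-1 *: (S d u - u).
have qL d : 0 < d -> q d \in L by move=> d0; rewrite LfunZ ?LfunB ?semigroupL.
apply/cvgrPdist_le => e e0.
(* Summing over [[0, b]] multiplies the error on the difference quotient by [b]. *)
have e'0 : 0 < e / (4 * b) by rewrite divr_gt0 ?mulr_gt0.
have e''0 : 0 < e / 4 by rewrite divr_gt0.
have [D D0 HD] := semigroup_modulus uL e''0.
move/cvgrPdist_le : gen => /(_ _ e'0)[D2 /= D20 HD2].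
near=> n; rewrite sub0r normrN ger0_norm ?nrm_ge0//.
have dD : b / n.+1%:R <= D by apply: ltW; near: n; exact: dlt.
have dD2 : b / n.+1%:R < D2 by near: n; exact: dlt.
have d0 := dn0 n; set d := b / n.+1%:R in dD dD2 d0 *.
have nd : n.+1%:R * d = b by rewrite /d mulrC divfK.
have hq : nr (h - q d) <= e / (4 * b).
  have := HD2 d; rewrite /= !sub0r !normrN (gtr0_norm d0) => /(_ dD2 d0).
  rewrite ger0_norm ?fine_ge0 ?Lnorm_ge0//; apply: le_trans.
  by rewrite nrm_distC// qL.
have bd0 : 0 < b + d by rewrite addr_gt0.
have bdL : S (b + d) u \in L by rewrite semigroupL.
have bL : S b u \in L by rewrite semigroupL.
have dL : S d u \in L by rewrite semigroupL.
have rhL : rsum h d n.+1 \in L by rewrite rsumL.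
have rqL : rsum (q d) d n.+1 \in L by rewrite rsumL// qL.
have E : nr (rsum (q d) d n.+1 - (S (b + d) u - S d u)) = 0.
  apply: (nrm_ae0 p1); first by rewrite !LfunB.
  apply: filterS (rsum_telescope n.+1 d0 uL) => x.
  rewrite -(natr1 n.+1) mulrDl mul1r nd => Ex.
  by rewrite -[LHS]/(_ x - (S (b + d) u x - S d u x)) Ex subrr.
(* The three parts are the error of the difference quotient, the telescoping identity, which
   contributes 0, and the shift by one cell at both ends. *)
have -> : rsum h d n.+1 - (S b u - u) = (rsum h d n.+1 - rsum (q d) d n.+1) +
   (rsum (q d) d n.+1 - (S (b + d) u - S d u)) +
   ((S (b + d) u - S b u) - (S d u - u)).
  by apply/funext => x; rewrite /GRing.add /GRing.opp/=; ring.
apply: (le_trans (ler_nrmD p1 _ _)); rewrite ?(LfunB, LfunD)//.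
apply: (le_trans (lerD (ler_nrmD p1 _ _) (ler_nrmB p1 _ _))); rewrite ?LfunB//.
rewrite E addr0; have -> : e = e / 4 + (e / 4 + e / 4) + e / 4 by field.
rewrite -addrA; apply: lerD.
  apply: le_trans (rsum_dist n.+1 d0 hL (qL d d0)) _.
  rewrite nd; apply: le_trans (ler_wpM2l (ltW b0) hq) _.
  by rewrite le_eqVlt; apply/orP; left; apply/eqP; field; rewrite gt_eqF.
apply: (@le_trans _ _ (e / 4 + e / 4)); last by lra.
apply: lerD; last exact: HD.
apply: (semigroup_dist (d := D)) => //; first by rewrite lerDl ltW.
  exact: ltW.
by rewrite addrC addKr.
Unshelve. all: by end_near.
Qed.

End semigroup.

(** * Semigroups on L^1 and their potentials *)

Section L1_semigroup.
Context {dT : measure_display} {T : measurableType dT} {R : realType}.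
Variable mu : {measure set T -> \bar R}.
Variable S : R -> (T -> R) -> (T -> R).
Hypothesis SG : subMarkov_semigroup mu 1 S.
Implicit Types (f g h u v : T -> R) (us vs : nat -> T -> R) (b t s d e : R).
Local Notation L1 := (Lfun mu 1).
Local Notation nr := (nrm mu 1).

Let le11 : (1 : R) <= 1. Proof. by []. Qed.

(** The truncations [min (f, n+1)], divided by [n+1], are unit valued, and they converge to [f] in
    L^1. The operator is abstract so that the result covers both [S t] and [a *: G a]. *)
Lemma L1_unit_ge0 (A : (T -> R) -> (T -> R)) f :
  (forall g, g \in L1 -> A g \in L1) ->
  (forall g h, g \in L1 -> h \in L1 -> nr (A g - A h) <= nr (g - h)) ->
  (forall a g, g \in L1 -> {ae mu, forall x, A (a *: g) x = a * A g x}) ->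
  (forall g, g \in L1 -> unit_valued mu g -> {ae mu, forall x, 0 <= A g x}) ->
  f \in L1 -> {ae mu, forall x, 0 <= f x} -> {ae mu, forall x, 0 <= A f x}.
Proof.
move=> AL Ad AZ Au fL f0; have mf := Lfun_measurable fL.
pose c n : R := n.+1%:R.
have c0 n : 0 < c n by [].
pose fn n x := Num.min (f x) (c n).
have mfn n : measurable_fun setT (fn n) by apply: measurable_minr.
have fnf n : {ae mu, forall x, `|fn n x| <= f x}.
  apply: filterS f0 => x f0; rewrite /fn ger0_norm ?ge_min ?lexx//.
  by rewrite le_min f0/= ltW.
have fnL n : fn n \in L1.
  apply: (L1_dominated (mfn n) fL); apply: filterS (fnf n) => x.
  by move/le_trans; apply; apply: ler_norm.
have fncv : {ae mu, forall x, fn n x @[n --> \oo] --> f x}.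
  apply: filterE => x; apply/cvgrPdist_le => e e0.
  exists (Num.trunc (f x)) => // n /= fxn;
    rewrite /fn min_l ?subrr ?normr0 ?ltW//.
  by rewrite (lt_le_trans (truncnS_gt (f x)))// ler_nat ltnS.
have [_ cfn _] := L1_DCT mfn mf fL fncv fnf.
have Afn n : {ae mu, forall x, cst 0 x <= A (fn n) x}.
  have iL : (c n)^-1 *: fn n \in L1 by rewrite LfunZ.
  have iu : unit_valued mu ((c n)^-1 *: fn n).
    apply: filterS f0 => x f0; rewrite -[(_ *: _) x]/((c n)^-1 * fn n x).
    rewrite mulr_ge0 ?invr_ge0 ?(ltW (c0 n))//=; last first.
      by rewrite le_min f0 ltW.
    by rewrite mulrC ler_pdivrMr// mul1r ge_min lexx orbT.
  have := AZ (c n)^-1 _ (fnL n); have := Au _ iL iu.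
  by apply: filterS2 => x + E; rewrite E pmulr_rge0 ?invr_gt0.
apply: (@L1_cvg_gec _ _ _ mu (fun n => A (fn n)) (A f) (cst 0)) => //.
- by move=> n; apply: AL.
- exact: AL.
- by apply: cvg0_le cfn => n; rewrite nrm_ge0 Ad.
Qed.

Lemma semigroup_ge0 t f : 0 < t -> f \in L1 ->
  {ae mu, forall x, 0 <= f x} -> {ae mu, forall x, 0 <= S t f x}.
Proof.
move=> t0; apply: L1_unit_ge0.
- by move=> g; apply: (semigroupL SG).
- by move=> g h gL hL; apply: (semigroup_distB le11 SG).
- by move=> a g gL; apply: (semigroupZ le11 SG).
- move=> g gL gu; have := semigroup_subMarkov SG t0 gL gu.
  by apply: filterS => x /andP[].
Qed.

Lemma semigroup_le t f g : 0 < t -> f \in L1 -> g \in L1 ->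
  {ae mu, forall x, f x <= g x} -> {ae mu, forall x, S t f x <= S t g x}.
Proof.
move=> t0 fL gL fg.
have gfL : g - f \in L1 by rewrite LfunB.
have : {ae mu, forall x, 0 <= S t (g - f) x}.
  apply: semigroup_ge0 => //; apply: filterS fg => x.
  by rewrite -[(g - f) x]/(g x - f x) subr_ge0.
have := semigroupB SG t0 gL fL.
by apply: filterS2 => x ->; rewrite subr_ge0.
Qed.

Lemma semigroup_ge0_nat f d : 0 < d -> f \in L1 ->
  {ae mu, forall x, 0 <= f x} ->
  {ae mu, forall x, forall k : nat, 0 <= S (k.+1%:R * d) f x}.
Proof.
move=> d0 fL f0; apply/ae_foralln => k; apply: semigroup_ge0 => //.
by rewrite mulr_gt0.
Qed.

Lemma rsum_ge0 f d n : 0 < d -> f \in L1 -> {ae mu, forall x, 0 <= f x} ->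
  {ae mu, forall x, 0 <= rsum S f d n x}.
Proof.
move=> d0 fL f0; apply: filterS (semigroup_ge0_nat d0 fL f0) => x H.
by rewrite rsumE; apply: sumr_ge0 => k _; rewrite mulr_ge0 ?H// ltW.
Qed.

Lemma rsum_le_widen f d n m : 0 < d -> f \in L1 ->
  {ae mu, forall x, 0 <= f x} -> (n <= m)%N ->
  {ae mu, forall x, rsum S f d n x <= rsum S f d m x}.
Proof.
move=> d0 fL f0 nm; apply: filterS (semigroup_ge0_nat d0 fL f0) => x H.
rewrite !rsumE -(subnKC nm) big_split_ord/= lerDl.
by apply: sumr_ge0 => k _; rewrite mulr_ge0 ?H// ltW.
Qed.

Lemma rsum_le f g d n : 0 < d -> f \in L1 -> g \in L1 ->
  {ae mu, forall x, f x <= g x} ->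
  {ae mu, forall x, rsum S f d n x <= rsum S g d n x}.
Proof.
move=> d0 fL gL fg.
have H : {ae mu, forall x, forall k : nat,
    S (k.+1%:R * d) f x <= S (k.+1%:R * d) g x}.
  by apply/ae_foralln => k; apply: semigroup_le => //; rewrite mulr_gt0.
apply: filterS H => x H; rewrite !rsumE; apply: ler_sum => k _.
by rewrite ler_pM2l.
Qed.

Lemma rsum_unit f d n : 0 < d -> f \in L1 -> unit_valued mu f ->
  {ae mu, forall x, rsum S f d n x <= n%:R * d}.
Proof.
move=> d0 fL fu.
have H : {ae mu, forall x, forall k : nat, S (k.+1%:R * d) f x <= 1}.
  apply/ae_foralln => k; have k0 : 0 < k.+1%:R * d by rewrite mulr_gt0.
  by have := semigroup_subMarkov SG k0 fL fu; apply: filterS => x /andP[].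
apply: filterS H => x H; rewrite rsumE.
apply: (@le_trans _ _ (\sum_(k < n) d)).
  by apply: ler_sum => k _; rewrite ler_piMr// ltW.
by rewrite sumr_const card_ord mulr_natl.
Qed.

(** Completeness provides a limit of the Riemann sums, so the [xget] in [L1_integral] selects a true
    limit and not its default value. *)
Lemma L1_integralP f b : 0 < b -> f \in L1 ->
  L1_integral mu S f b \in L1 /\
  nr (rsum S f (b / n.+1%:R) n.+1 - L1_integral mu S f b) @[n --> \oo] --> 0.
Proof.
move=> b0 fL.
have rL n : rsum S f (b / n.+1%:R) n.+1 \in L1.
  by rewrite (rsumL le11 SG)// divr_gt0.
have RL n : L1_riemann_sum S f b n \in L1 by rewrite L1_riemann_sumE.
have [s sL cs] := L1_complete rL (rsum_cauchy le11 SG b0 fL).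
have [] : (L1_integral mu S f b \in L1 /\
    Lp_cvg mu 1 (L1_riemann_sum S f b) (L1_integral mu S f b)).
  apply: (@xgetPex _ (cst 0) [set s | s \in L1 /\
    Lp_cvg mu 1 (L1_riemann_sum S f b) s]).
  exists s; split => //; apply/(Lp_cvgP le11 RL sL).
  by apply: cvg_eqfun cs => n; rewrite L1_riemann_sumE.
move=> IL /(Lp_cvgP le11 RL IL) H; split => //.
by apply: cvg_eqfun H => n; rewrite L1_riemann_sumE.
Qed.

Lemma L1_integralL f b : 0 < b -> f \in L1 -> L1_integral mu S f b \in L1.
Proof. by move=> b0 fL; have [] := L1_integralP b0 fL. Qed.

Lemma nrm_cvg_unique us u v : (forall n, us n \in L1) -> u \in L1 -> v \in L1 ->
  nr (us n - u) @[n --> \oo] --> 0 -> nr (us n - v) @[n --> \oo] --> 0 ->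
  {ae mu, forall x, u x = v x}.
Proof.
move=> usL uL vL cu cv; apply: (Lp_cvg_unique le11 usL uL vL).
  exact/(Lp_cvgP le11 usL uL).
exact/(Lp_cvgP le11 usL vL).
Qed.

Lemma L1_integral_generator u h b : 0 < b -> semigroup_generator mu 1 S u h ->
  {ae mu, forall x, L1_integral mu S h b x = S b u x - u x}.
Proof.
move=> b0 gen; have [uL hL _] := gen.
have [IL cI] := L1_integralP b0 hL.
have := semigroup_generator_rsum le11 SG b0 gen.
apply: nrm_cvg_unique cI => //; last by rewrite LfunB ?(semigroupL SG).
by move=> n; rewrite (rsumL le11 SG)// divr_gt0.
Qed.

Lemma L1_integral_lin a f g b : 0 < b -> f \in L1 -> g \in L1 ->
  {ae mu, forall x, L1_integral mu S (a *: f + g) b x =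
     a * L1_integral mu S f b x + L1_integral mu S g b x}.
Proof.
move=> b0 fL gL; have fgL : a *: f + g \in L1 by rewrite LfunD ?LfunZ.
have [If cf] := L1_integralP b0 fL; have [Ig cg] := L1_integralP b0 gL.
have [Ifg cfg] := L1_integralP b0 fgL.
have bn (n : nat) : 0 < b / n.+1%:R by rewrite divr_gt0.
have rL h n : h \in L1 -> rsum S h (b / n.+1%:R) n.+1 \in L1.
  by move=> hL; rewrite (rsumL le11 SG).
apply: (nrm_cvg_unique _ Ifg _ cfg
  (v := a *: L1_integral mu S f b + L1_integral mu S g b)).
- by move=> n; apply: rL.
- by rewrite LfunD ?LfunZ.
apply: (@cvg0_le _ _ (fun n =>
  `|a| * nr (rsum S f (b / n.+1%:R) n.+1 - L1_integral mu S f b) +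
  nr (rsum S g (b / n.+1%:R) n.+1 - L1_integral mu S g b))); last first.
  by rewrite -[X in _ --> X]addr0 -[X in X + _](mulr0 `|a|); apply: cvgD => //;
    apply: cvgM => //; apply: cvg_cst.
move=> n; rewrite nrm_ge0/= -nrmZ ?LfunB ?rL//.
apply: le_trans (ler_nrmD le11 _ _); rewrite ?(LfunZ, LfunB) ?rL//.
rewrite le_eqVlt; apply/orP; left; apply/eqP; apply: nrm_ae_eq.
- by rewrite ?(LfunB, LfunD, LfunZ) ?rL.
- by rewrite LfunD ?LfunZ ?LfunB ?rL.
apply: filterS (rsum_lin SG a n.+1 (bn n) fL gL) => x E.
rewrite -[LHS]/(_ x - (a * L1_integral mu S f b x + L1_integral mu S g b x)) E.
rewrite -[RHS]/(a * (_ x - _ x) + (_ x - _ x)); ring.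
Qed.

Lemma L1_integralZ a f b : 0 < b -> f \in L1 ->
  {ae mu, forall x, L1_integral mu S (a *: f) b x = a * L1_integral mu S f b x}.
Proof.
move=> b0 fL; have L0 : (0 : T -> R) \in L1 by apply: Lfun_cst0.
have := L1_integral_lin 1 b0 L0 L0; have := L1_integral_lin a b0 fL L0.
rewrite scale1r !addr0; apply: filterS2 => x -> E.
(* Linearity at [f = g = 0] with coefficient 1 reads [I = I + I], so the integral of 0 vanishes. *)
suff -> : L1_integral mu S 0 b x = 0 by rewrite addr0.
by apply: (@addrI _ (L1_integral mu S 0 b x)); rewrite addr0 {3}E mul1r.
Qed.

Lemma L1_integral_unit f b : 0 < b -> f \in L1 -> unit_valued mu f ->
  {ae mu, forall x, L1_integral mu S f b x <= b}.
Proof.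
move=> b0 fL fu; have [If cf] := L1_integralP b0 fL.
have bn (n : nat) : 0 < b / n.+1%:R by rewrite divr_gt0.
apply: (L1_cvg_lec _ If (c := cst b) _ cf) => //.
  by move=> n; rewrite (rsumL le11 SG).
move=> n; apply: filterS (rsum_unit n.+1 (bn n) fL fu) => x.
by rewrite [_ * (b / _)]mulrC divfK.
Qed.

Lemma L1_integral_le f g b : 0 < b -> f \in L1 -> g \in L1 ->
  {ae mu, forall x, f x <= g x} ->
  {ae mu, forall x, L1_integral mu S f b x <= L1_integral mu S g b x}.
Proof.
move=> b0 fL gL fg; have [If cf] := L1_integralP b0 fL.
have [Ig cg] := L1_integralP b0 gL.
have bn (n : nat) : 0 < b / n.+1%:R by rewrite divr_gt0.
have rL h n : h \in L1 -> rsum S h (b / n.+1%:R) n.+1 \in L1.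
  by move=> hL; rewrite (rsumL le11 SG).
apply: (L1_cvg_le _ If _ Ig cf cg) => n; [exact: rL|exact: rL|].
exact: rsum_le.
Qed.

Lemma L1_integral_ge0 f b : 0 < b -> f \in L1 ->
  {ae mu, forall x, 0 <= f x} -> {ae mu, forall x, 0 <= L1_integral mu S f b x}.
Proof.
move=> b0 fL f0; have [If cf] := L1_integralP b0 fL.
have bn (n : nat) : 0 < b / n.+1%:R by rewrite divr_gt0.
apply: (L1_cvg_gec _ If (c := cst 0) _ cf) => //.
  by move=> n; rewrite (rsumL le11 SG).
by move=> n; apply: rsum_ge0.
Qed.

Lemma cvg_subseq (w : nat -> R) (l : R) (k : nat -> nat) :
  (forall n, (n <= k n)%N) -> w n @[n --> \oo] --> l ->
  w (k n) @[n --> \oo] --> l.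
Proof.
move=> kn; apply: cvg_comp; move=> A [N _ NA]; exists N => // n /= Nn.
by apply: NA => /=; apply: leq_trans (kn n).
Qed.

(* Along the subsequence n + 1 = N q (j + 1) the mesh is 1 / (q (j + 1)), which
   does not depend on N. *)
Lemma L1_integral_mesh f (N q : nat) : (0 < N)%N -> (0 < q)%N -> f \in L1 ->
  nr (rsum S f (q * j.+1)%:R^-1 (N * (q * j.+1)) - L1_integral mu S f N%:R)
    @[j --> \oo] --> 0.
Proof.
move=> N0 q0 fL; have [] := @L1_integralP f N%:R _ fL; first by rewrite ltr0n.
move=> IL /(cvg_subseq (k := fun j => (N * (q * j.+1)).-1)) H.
have {}H := H _; apply: cvg_eqfun (H _) => [j|n]; last first.
  rewrite -ltnS prednK ?muln_gt0 ?N0 ?q0//.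
  by rewrite (leq_trans _ (leq_pmull _ N0))// leq_pmull.
rewrite prednK ?muln_gt0 ?N0 ?q0// natrM invfM mulVKf//.
by rewrite pnatr_eq0 -lt0n.
Qed.

(** On the common mesh [1 / (j+1)] the Riemann sum up to [M] is the one up to [N] plus nonnegative
    terms. *)
Lemma L1_integral_nondecreasing f (N M : nat) : (0 < N)%N -> (N <= M)%N ->
  f \in L1 -> {ae mu, forall x, 0 <= f x} ->
  {ae mu, forall x, L1_integral mu S f N%:R x <= L1_integral mu S f M%:R x}.
Proof.
move=> N0 NM fL f0; have M0 := leq_trans N0 NM.
have h0 (j : nat) : 0 < (1 * j.+1)%:R^-1 :> R by rewrite invr_gt0 ltr0n mul1n.
apply: (L1_cvg_le _ _ _ _ (L1_integral_mesh N0 (ltn0Sn 0) fL)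
   (L1_integral_mesh M0 (ltn0Sn 0) fL)).
- by move=> n; rewrite (rsumL le11 SG).
- by rewrite L1_integralL// ltr0n.
- by move=> n; rewrite (rsumL le11 SG).
- by rewrite L1_integralL// ltr0n.
- by move=> n; apply: rsum_le_widen => //; rewrite leq_mul2r NM orbT.
Qed.

(** On the mesh [1 / (q (j+1))] the rational time [i / q] is exactly [i (j+1)] cells, so the Riemann
    sum of the shifted function is a block of consecutive terms of that of [f]. The horizon [N + i]
    is an integer beyond [N + i / q]. *)
Lemma L1_integral_shift f (N q i : nat) : (0 < N)%N -> (0 < q)%N -> (0 < i)%N ->
  f \in L1 -> {ae mu, forall x, 0 <= f x} ->
  {ae mu, forall x, L1_integral mu S (S (i%:R / q%:R) f) N%:R x <=
     L1_integral mu S f (N + i)%:R x}.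
Proof.
move=> N0 q0 i0 fL f0.
have r0 : 0 < i%:R / q%:R :> R by rewrite divr_gt0 ?ltr0n.
have h0 (j : nat) : 0 < (q * j.+1)%:R^-1 :> R by rewrite invr_gt0 ltr0n
  muln_gt0 q0.
have SL := semigroupL SG r0 fL.
have Ni0 : (0 < N + i)%N by rewrite addn_gt0 N0.
apply: (L1_cvg_le _ _ _ _ (L1_integral_mesh N0 q0 SL)
   (L1_integral_mesh Ni0 q0 fL)).
- by move=> n; rewrite (rsumL le11 SG).
- by rewrite L1_integralL// ltr0n.
- by move=> n; rewrite (rsumL le11 SG).
- by rewrite L1_integralL// ltr0n.
move=> j; set m := (q * j.+1)%N; set h := m%:R^-1.
have law : {ae mu, forall x, forall k : nat,
    S (k.+1%:R * h) (S (i%:R / q%:R) f) x = S ((i * j.+1 + k).+1%:R * h) f x}.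
  apply/ae_foralln => k; have k0 : 0 < k.+1%:R * h by rewrite mulr_gt0 ?h0.
  have := semigroup_law SG k0 r0 fL; apply: filterS => x <-; congr (S _ f x).
  rewrite -addnS natrD addrC mulrDl; congr (_ + _).
  by rewrite /h /m !natrM invfM mulrACA mulfV ?mulr1// pnatr_eq0.
have := semigroup_ge0_nat (h0 j) fL f0; apply: filterS2 law => x law pos.
rewrite !rsumE.
apply: (@le_trans _ _ (\sum_(k < i * j.+1 + N * m) h * S (k.+1%:R * h) f x)).
  rewrite big_split_ord/= -[leLHS]add0r; apply: lerD.
    by apply: sumr_ge0 => k _; rewrite mulr_ge0 ?pos// ltW// h0.
  by apply: ler_sum => k _; rewrite law.
(* The shift uses [i * j.+1] cells out of the [i * m] available in the [i] extra units of time. *)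
have le : (i * j.+1 + N * m <= (N + i) * m)%N.
  by rewrite mulnDl addnC leq_add2l /m leq_mul2l leq_pmull ?orbT.
rewrite -(subnKC le) [leRHS]big_split_ord/= lerDl.
by apply: sumr_ge0 => k _; rewrite mulr_ge0 ?pos// ltW// h0.
Qed.

(** By continuity at 0, [S_t f] stays within [e] of [f] during a short time [1 / (q+1)]; the part of
    the integral over that time alone has norm at least [(|f| - e) / (q+1)], whence [|f| <= e]. *)
Lemma L1_integral_eq0 f : f \in L1 -> {ae mu, forall x, 0 <= f x} ->
  {ae mu, forall x, L1_integral mu S f 1 x = 0} -> {ae mu, forall x, f x = 0}.
Proof.
move=> fL f0 I0; apply: (nrm_eq0_ae le11 fL).
apply/eqP; rewrite eq_le nrm_ge0 andbT; apply/ler_addgt0Pl => e e0;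
  rewrite addr0.
have [d d0 Hd] := semigroup_modulus SG fL e0.
have [q _ /(_ q (leqnn _))/= /ltW qd] := near_infty_natSinv_lt (PosNum d0).
have IL : L1_integral mu S f 1 \in L1 by rewrite L1_integralL.
have H := @L1_integral_mesh f 1 q.+1 (ltn0Sn 0) (ltn0Sn q) fL.
have h0 (j : nat) : 0 < (q.+1 * j.+1)%:R^-1 :> R by rewrite invr_gt0 ltr0n.
have rL n j : rsum S f (q.+1 * j.+1)%:R^-1 n \in L1 by rewrite (rsumL le11 SG).
(* The left side does not depend on [j], while the right side tends to 0. *)
suff K j : q.+1%:R^-1 * (nr f - e) <=
    nr (rsum S f (q.+1 * j.+1)%:R^-1 (1 * (q.+1 * j.+1)) - L1_integral mu S f
      1).
  have : q.+1%:R^-1 * (nr f - e) <= 0.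
    apply: (@ler_cvg_to _ _ _ _ (fun=> q.+1%:R^-1 * (nr f - e)) _ _ _ _ H).
      exact: cvg_cst.
    exact: nearW.
  by rewrite pmulr_rle0 ?invr_gt0// subr_le0.
set h := (q.+1 * j.+1)%:R^-1.
have jh : j.+1%:R * h = q.+1%:R^-1.
  by rewrite /h natrM invfM mulrCA mulfV ?mulr1// pnatr_eq0.
apply: (@le_trans _ _ (nr (rsum S f h j.+1))); last first.
  apply: nrm1_le => [||]; [exact: (rL _ j)|by rewrite LfunB// (rL _ j)|].
  have le : (j.+1 <= 1 * (q.+1 * j.+1))%N by rewrite mul1n leq_pmull.
  have := rsum_ge0 j.+1 (h0 j) fL f0.
  have := rsum_le_widen (h0 j) fL f0 le.
  apply: filterS3 I0 => x I0 le1 ge0.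
  rewrite -[X in _ <= `|X|]/(_ x - L1_integral mu S f 1 x) I0 subr0.
  by rewrite !ger0_norm// (le_trans ge0).
have : nr (rsum S f h j.+1 - j.+1%:R * h *: f) <= j.+1%:R * h * e.
  by apply: (rsum_near le11 SG _ fL Hd) => //; rewrite ?h0// jh.
rewrite nrm_distC ?LfunZ//; last exact: (rL _ j).
rewrite jh => H1; rewrite mulrBr lerBlDr.
have rhL : rsum S f h j.+1 \in L1 := rL _ j.
have -> : q.+1%:R^-1 * nr f = nr (q.+1%:R^-1 *: f).
  by rewrite nrmZ// ger0_norm// invr_ge0.
rewrite -[X in nr X <= _](subrK (rsum S f h j.+1)) addrC.
apply: (le_trans (ler_nrmD le11 _ _)); rewrite ?LfunB ?LfunZ//.
by rewrite lerD2l.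
Qed.

(** Monotonicity in [N] makes the limit a supremum, characterized here through its order properties.
    The index starts at 1, since the lemmas on [L1_integral] require a positive length. *)
Lemma potentialP f : f \in L1 -> {ae mu, forall x, 0 <= f x} ->
  {ae mu, forall x, [/\ (0 <= potential mu S f x)%E,
    forall N, (0 < N)%N -> ((L1_integral mu S f N%:R x)%:E <= potential mu S f
      x)%E &
    forall c : \bar R, (forall N, (0 < N)%N ->
       ((L1_integral mu S f N%:R x)%:E <= c)%E) -> (potential mu S f x <=
         c)%E]}.
Proof.
move=> fL f0.
have mono : {ae mu, forall x, forall N : nat,
    L1_integral mu S f N.+1%:R x <= L1_integral mu S f N.+2%:R x}.
  by apply/ae_foralln => N; apply: L1_integral_nondecreasing.
have pos : {ae mu, forall x, forall N : nat,
    0 <= L1_integral mu S f N.+1%:R x}.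
  by apply/ae_foralln => N; apply: L1_integral_ge0.
apply: filterS2 mono pos => x mono pos.
pose J N := (L1_integral mu S f N.+1%:R x)%:E.
have ndJ : nondecreasing_seq J.
  by apply/nondecreasing_seqP => N; rewrite lee_fin.
have cJ : J N @[N --> \oo] --> ereal_sup (range J).
  exact: ereal_nondecreasing_cvgn.
have -> : potential mu S f x = ereal_sup (range J).
  by apply/cvg_lim => //; rewrite -(cvg_shiftS _); exact: cJ.
split.
- apply: (@le_trans _ _ (J 0%N)); first by rewrite lee_fin.
  by apply: ereal_sup_ubound; exists 0%N.
- by case=> // N _; apply: ereal_sup_ubound; exists N.
- by move=> c H; apply: ge_ereal_sup => _ [N _ <-]; apply: H.
Qed.

End L1_semigroup.

(** * Resolvents on L^1 and their perturbations *)

Section L1_resolvent.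
Context {dT : measure_display} {T : measurableType dT} {R : realType}.
Variable mu : {measure set T -> \bar R}.
Variable G : R -> (T -> R) -> (T -> R).
Hypothesis GR : subMarkov_resolvent mu 1 setT G.
Implicit Types (f g h u v w : T -> R) (us vs : nat -> T -> R) (a b t s d e : R).
Local Notation L1 := (Lfun mu 1).
Local Notation nr := (nrm mu 1).

Let le11 : (1 : R) <= 1. Proof. by []. Qed.

Lemma Lp_on_setT (p : \bar R) f : Lp_on mu p setT f <-> f \in Lfun mu p.
Proof. by split => [[]//|fL]; split => //; apply: filterE => x /(_ I). Qed.

Lemma resolventL a f : 0 < a -> f \in L1 -> G a f \in L1.
Proof.
by move=> a0 /Lp_on_setT fL; apply/Lp_on_setT; apply: (resolvent_stable GR).
Qed.

Lemma resolvent_lin a c f g : 0 < a -> f \in L1 -> g \in L1 ->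
  {ae mu, forall x, G a (c *: f + g) x = c * G a f x + G a g x}.
Proof.
by move=> a0 /Lp_on_setT fL /Lp_on_setT gL; apply: (resolvent_linear GR).
Qed.

Lemma resolvent_contract a f : 0 < a -> f \in L1 -> a * nr (G a f) <= nr f.
Proof.
move=> a0 fL; have GL := resolventL a0 fL.
rewrite -[X in X * _]gtr0_norm// -nrmZ// -lee_fin -!nrm_fine ?LfunZ//.
by apply: (resolvent_contraction GR) => //; apply/Lp_on_setT.
Qed.

Lemma resolvent0 a : 0 < a -> {ae mu, forall x, G a 0 x = 0}.
Proof.
move=> a0; have L0 : (0 : T -> R) \in L1 by apply: Lfun_cst0.
apply: (nrm_eq0_ae le11 (resolventL a0 L0)).
apply/eqP; rewrite eq_le nrm_ge0 andbT -(pmulr_rle0 _ a0).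
by have := resolvent_contract a0 L0; rewrite (nrm0 mu le11).
Qed.

Lemma resolventZ a c f : 0 < a -> f \in L1 ->
  {ae mu, forall x, G a (c *: f) x = c * G a f x}.
Proof.
move=> a0 fL; have L0 : (0 : T -> R) \in L1 by apply: Lfun_cst0.
have := resolvent_lin c a0 fL L0; rewrite addr0.
by move: (resolvent0 a0); apply: filterS2 => x -> ->; rewrite addr0.
Qed.

Lemma resolventB a f g : 0 < a -> f \in L1 -> g \in L1 ->
  {ae mu, forall x, G a (f - g) x = G a f x - G a g x}.
Proof.
move=> a0 fL gL; have := resolvent_lin (-1) a0 gL fL.
by rewrite scaleN1r addrC; apply: filterS => x ->; rewrite mulN1r addrC.
Qed.

Lemma resolvent_distB a f g : 0 < a -> f \in L1 -> g \in L1 ->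
  a * nr (G a f - G a g) <= nr (f - g).
Proof.
move=> a0 fL gL; apply: le_trans (resolvent_contract a0 (LfunB le11 fL gL)).
rewrite ler_pM2l// le_eqVlt; apply/orP; left; apply/eqP.
apply: nrm_ae_eq; rewrite ?(LfunB, resolventL)//.
by apply: filterS (resolventB a0 fL gL) => x ->.
Qed.

Lemma resolvent_ae_eq a f g : 0 < a -> f \in L1 -> g \in L1 ->
  {ae mu, forall x, f x = g x} -> {ae mu, forall x, G a f x = G a g x}.
Proof.
move=> a0 fL gL fg.
have : nr (G a f - G a g) = 0.
  apply/eqP; rewrite eq_le nrm_ge0 andbT -(pmulr_rle0 _ a0).
  apply: (le_trans (resolvent_distB a0 fL gL)).
  rewrite le_eqVlt; apply/orP; left; apply/eqP; apply: (nrm_ae0 le11).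
    exact: LfunB.
  by apply: filterS fg => x; rewrite -[(f - g) x]/(f x - g x) => ->;
    rewrite subrr.
move/nrm_eq0_ae => /(_ le11); rewrite LfunB ?resolventL// => /(_ isT).
by apply: filterS => x /eqP;
  rewrite -[(_ - _) x]/(G a f x - G a g x) subr_eq0 => /eqP.
Qed.

Lemma resolvent_ge0 a f : 0 < a -> f \in L1 -> {ae mu, forall x, 0 <= f x} ->
  {ae mu, forall x, 0 <= G a f x}.
Proof.
move=> a0 fL f0.
have : {ae mu, forall x, 0 <= (a *: G a f) x}.
  apply: (@L1_unit_ge0 _ _ _ mu (fun f => a *: G a f)) => //.
  - by move=> g gL; rewrite LfunZ ?resolventL.
  - move=> g h gL hL; rewrite -scalerBr nrmZ ?LfunB ?resolventL// gtr0_norm//.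
    exact: resolvent_distB.
  - move=> c g gL; have := resolventZ c a0 gL; apply: filterS => x E.
    by rewrite -[LHS]/(a * G a (c *: g) x) E mulrCA.
  - move=> g /Lp_on_setT gL gu; have := resolvent_subMarkov GR a0 gL gu.
    by apply: filterS => x /andP[].
by apply: filterS => x; rewrite -[(_ *: _) x]/(a * G a f x) pmulr_rge0.
Qed.

Lemma resolvent_le a f g : 0 < a -> f \in L1 -> g \in L1 ->
  {ae mu, forall x, f x <= g x} -> {ae mu, forall x, G a f x <= G a g x}.
Proof.
move=> a0 fL gL fg.
have gfL : g - f \in L1 by rewrite LfunB.
have : {ae mu, forall x, 0 <= G a (g - f) x}.
  apply: resolvent_ge0 => //; apply: filterS fg => x.
  by rewrite -[(g - f) x]/(g x - f x) subr_ge0.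
have := resolventB a0 gL fL.
by apply: filterS2 => x ->; rewrite subr_ge0.
Qed.

(** The resolvent equation gives [G_b f - G_a f = (a - b) G_b (G_a f)], a product of nonnegative
    factors. *)
Lemma resolvent_antitone a b f : 0 < b -> b <= a -> f \in L1 ->
  {ae mu, forall x, 0 <= f x} -> {ae mu, forall x, G a f x <= G b f x}.
Proof.
move=> b0 ba fL f0; have a0 := lt_le_trans b0 ba.
have GaL := resolventL a0 fL.
have := resolvent_ge0 b0 GaL (resolvent_ge0 a0 fL f0).
have := resolvent_equation GR b0 a0 ((Lp_on_setT _ _).2 fL).
by apply: filterS2 => x E H; rewrite -subr_ge0 E mulr_ge0 ?subr_ge0.
Qed.

(** The graph of the generator asks for an identity at every parameter [b]; the resolvent equation
    carries it over from the single parameter [a]. *)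
Lemma resolvent_generator_ae a f u : 0 < a -> f \in L1 -> u \in L1 ->
  {ae mu, forall x, u x = G a f x} ->
  resolvent_generator mu 1 setT G u (a *: u - f).
Proof.
move=> a0 fL uL uE; split; [exact/Lp_on_setT|apply/Lp_on_setT|move=> b b0].
  by rewrite LfunB ?LfunZ.
have -> : (fun y => b * u y - (a *: u - f) y) = (b - a) *: u + f.
  apply/funext => y; rewrite -[RHS]/((b - a) * u y + f y).
  rewrite -[(_ - _) y]/(a * u y - f y); ring.
have GaL := resolventL a0 fL.
have H1 := resolvent_equation GR b0 a0 ((Lp_on_setT _ _).2 fL).
have H2 := resolvent_ae_eq b0 uL GaL uE.
apply: filterS3 (resolvent_lin (b - a) b0 uL fL) H2 (filterI uE H1).
move=> x -> -> [-> /eqP]; rewrite subr_eq => /eqP ->; ring.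
Qed.

(** * The perturbed equation [(a - L + w) chi = w] by Picard iteration *)

Section perturbation.
Variable w : T -> R.
Hypothesis wL : w \in L1.
Hypothesis w01 : unit_valued mu w.

(** Adding [(1 - w) chi] to both sides of [(a - L + w) chi = w] gives
    [(a + 1 - L) chi = perturb chi]. For [0 <= w <= 1] this is a convex combination of [f] and 1,
    hence monotone, 1-Lipschitz in L^1 and stable on unit-valued functions; the spare 1 in [a + 1]
    makes the iteration contract strictly. *)
Definition perturb f : T -> R := fun x => (1 - w x) * f x + w x.

Lemma perturbL f : f \in L1 -> perturb f \in L1.
Proof.
move=> fL; have mw := Lfun_measurable wL; have mf := Lfun_measurable fL.
pose q := (fun x => `|f x|) + (fun x => `|w x|).
have qL : q \in L1 by rewrite LfunD ?Lfun_norm.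
apply: (L1_dominated _ qL).
  apply: measurable_funD => //; apply: measurable_funM => //.
  exact: measurable_funB.
apply: filterS w01 => x /andP[w0 w1].
rewrite -[q x]/(`|f x| + `|w x|) [leRHS]ger0_norm ?addr_ge0//.
apply: (le_trans (ler_normD _ _)); rewrite lerD2r normrM ger0_norm ?subr_ge0//.
by rewrite ler_piMl// gerBl.
Qed.

Lemma perturb_dist f g : f \in L1 -> g \in L1 ->
  nr (perturb f - perturb g) <= nr (f - g).
Proof.
move=> fL gL; apply: nrm1_le; rewrite ?LfunB ?perturbL//.
apply: filterS w01 => x /andP[w0 w1].
rewrite -[(f - g) x]/(f x - g x) -[(_ - _) x]/(perturb f x - perturb g x).
have -> : perturb f x - perturb g x = (1 - w x) * (f x - g x).
  by rewrite /perturb; ring.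
by rewrite normrM ger0_norm ?subr_ge0// ler_piMl// gerBl.
Qed.

Lemma perturb_unit f : unit_valued mu f -> unit_valued mu (perturb f).
Proof.
move=> fu; apply: filterS2 w01 fu => x /andP[w0 w1] /andP[f0 f1].
rewrite /perturb addr_ge0 ?mulr_ge0 ?subr_ge0//=.
by rewrite -lerBrDr ler_piMr// subr_ge0.
Qed.

Fixpoint pert_iter a n : T -> R :=
  if n is n'.+1 then G (a + 1) (perturb (pert_iter a n')) else 0.

Lemma pert_iterL a n : 0 < a -> pert_iter a n \in L1.
Proof.
move=> a0; elim: n => [|n IH]; first exact: Lfun_cst0.
by rewrite resolventL ?perturbL// addr_gt0.
Qed.

Lemma pert_iter_unit a n : 0 < a -> unit_valued mu (pert_iter a n).
Proof.
move=> a0; elim: n => [|n IH]; first by apply: filterE => x; rewrite lexx ler01.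
have a10 : 0 < a + 1 by rewrite addr_gt0.
have pL := (Lp_on_setT _ _).2 (perturbL (pert_iterL n a0)).
have := resolvent_subMarkov GR a10 pL (perturb_unit IH).
apply: filterS => x /andP[H0 H1] /=.
have G0 : 0 <= G (a + 1) (perturb (pert_iter a n)) x.
  by move: H0; rewrite pmulr_rge0.
rewrite G0/=; apply: le_trans H1; rewrite mulrDl mul1r lerDr.
by rewrite mulr_ge0// ltW.
Qed.

(** [nr w / a] is the fixed point of the recursion [r = (r + nr w) / (a + 1)] that the contraction
    property imposes on the norms. *)
Lemma pert_iter_nrm a n : 0 < a -> nr (pert_iter a n) <= nr w / a.
Proof.
move=> a0; have a10 : 0 < a + 1 by rewrite addr_gt0.
elim: n => [|n IH]; first by rewrite nrm0// divr_ge0 ?nrm_ge0// ltW.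
have XL := pert_iterL n a0.
rewrite /= -(ler_pM2l a10); apply: (le_trans (resolvent_contract _ _)) => //.
  exact: perturbL.
have -> : perturb (pert_iter a n) = (perturb (pert_iter a n) - perturb 0) + w.
  apply/funext => x; rewrite /GRing.add /GRing.opp/= /perturb.
  rewrite -[(0 : T -> R) x]/(0 : R); ring.
have L0 : (0 : T -> R) \in L1 by apply: Lfun_cst0.
apply: (le_trans (ler_nrmD le11 _ _)); rewrite ?LfunB ?perturbL//.
rewrite mulrDl mul1r mulrC divfK ?gt_eqF// addrC lerD2l.
by apply: le_trans (perturb_dist XL L0) _; rewrite subr0.
Qed.

Lemma pert_iter_dist a n k : 0 < a ->
  nr (pert_iter a (n + k) - pert_iter a n) <= (a + 1)^-1 ^+ n * (nr w / a).
Proof.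
move=> a0; have a10 : 0 < a + 1 by rewrite addr_gt0.
elim: n => [|n IH]; first by rewrite add0n expr0 mul1r subr0 pert_iter_nrm.
rewrite addSn exprS -mulrA ler_pdivlMl//=.
apply: (le_trans (resolvent_distB _ _ _)); rewrite ?perturbL ?pert_iterL//.
by apply: le_trans IH; apply: perturb_dist; rewrite pert_iterL.
Qed.

(** Monotonicity propagates through the iteration: [perturb] is increasing, [G] preserves order, and
    [G] is antitone in its parameter on nonnegative functions. *)
Lemma pert_iter_le a b n : 0 < b -> b <= a ->
  {ae mu, forall x, pert_iter a n x <= pert_iter b n x}.
Proof.
move=> b0 ba; have a0 := lt_le_trans b0 ba.
have a10 : 0 < a + 1 by rewrite addr_gt0.
have b10 : 0 < b + 1 by rewrite addr_gt0.
elim: n => [|n IH]; first exact: filterE.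
have pa := perturbL (pert_iterL n a0); have pb := perturbL (pert_iterL n b0).
have H1 : {ae mu, forall x, G (b + 1) (perturb (pert_iter a n)) x <=
    G (b + 1) (perturb (pert_iter b n)) x}.
  apply: resolvent_le => //; apply: filterS2 w01 IH => x /andP[w0 w1] le.
  by rewrite /perturb lerD2r ler_wpM2l// subr_ge0.
have p0 : {ae mu, forall x, 0 <= perturb (pert_iter a n) x}.
  by apply: filterS (perturb_unit (pert_iter_unit n a0)) => x /andP[].
have := resolvent_antitone b10 (_ : b + 1 <= a + 1) pa p0.
rewrite lerD2r => /(_ ba); apply: filterS2 H1 => x H1 H2.
exact: le_trans H2 H1.
Qed.

(* [chi a] solves [(a - L + w) chi = w]: it is the fixed point of the
   contraction [f |-> G (a + 1) ((1 - w) f + w)]. *)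
Lemma perturbed_resolvent : exists chi : R -> T -> R,
  [/\ forall a, 0 < a -> resolvent_generator mu 1 setT G (chi a)
        (fun x => a * chi a x - w x * (1 - chi a x)),
      forall a, 0 < a -> unit_valued mu (chi a) &
      forall a b, 0 < b -> b <= a -> {ae mu, forall x, chi a x <= chi b x}].
Proof.
have ex a : exists u, 0 < a ->
    u \in L1 /\ nr (pert_iter a n - u) @[n --> \oo] --> 0.
  have [a0|_] := ltP 0 a; last by exists 0.
  have XL n := pert_iterL n a0.
  have [|u uL cu] := L1_complete XL; last by exists u.
  move=> e e0; have a10 : 0 < a + 1 by rewrite addr_gt0.
  have r1 : `|(a + 1)^-1| < 1.
    by rewrite gtr0_norm ?invr_gt0// invf_lt1// ltrDr.
  have M0 : 0 <= nr w / a by rewrite divr_ge0 ?nrm_ge0// ltW.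
  (* The added 1 keeps the denominator positive when [w] has norm 0. *)
  have e'0 : 0 < e / (2 * (nr w / a + 1)).
    by rewrite divr_gt0// mulr_gt0// ltr_wpDl.
  have /cvgrPdist_le/(_ _ e'0) [N _ HN] := cvg_expr r1.
  exists N => m n Nm Nn.
  have {HN} := HN N (leqnn N).
  rewrite /= sub0r normrN ger0_norm ?exprn_ge0 ?invr_ge0 ?(ltW a10)// => HN.
  have K k : (N <= k)%N -> nr (pert_iter a k - pert_iter a N) <= e / 2.
    move=> Nk; rewrite -(subnKC Nk).
    apply: (le_trans (pert_iter_dist _ _ a0)).
    apply: (le_trans (ler_wpM2r M0 HN)).
    set M := nr w / a in M0 *.
    rewrite mulrAC ler_pdivrMr ?mulr_gt0 ?ltr_wpDl//.
    have -> : e / 2 * (2 * (M + 1)) = e * M + e by field.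
    by rewrite lerDl ltW.
  apply: (le_trans (ler_nrm_distD le11 (XL m) (XL N) (XL n))).
  rewrite [leRHS]splitr; apply: lerD; first exact: K.
  by rewrite nrm_distC//; apply: K.
have [chi chiP] := choice ex.
exists chi.
have XL n a (a0 : 0 < a) := pert_iterL n a0.
have cL a (a0 : 0 < a) : chi a \in L1 := (chiP a a0).1.
split.
- move=> a a0; have [_ ca] := chiP a a0;
    have a10 : 0 < a + 1 by rewrite addr_gt0.
  have -> : (fun x => a * chi a x - w x * (1 - chi a x)) =
     (a + 1) *: chi a - perturb (chi a).
    apply/funext => x; rewrite -[RHS]/((a + 1) * chi a x - perturb (chi a) x).
    by rewrite /perturb; ring.
  apply: (resolvent_generator_ae a10 (perturbL (cL a a0)) (cL a a0)).
  apply: (nrm_cvg_unique (fun n => XL n.+1 a a0) (cL a a0)).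
  + by rewrite resolventL ?perturbL ?cL.
  + by move: ca; rewrite -(cvg_shiftS (fun n => nr (pert_iter a n - chi a))).
  apply: (@cvg0_le _ _ (fun n => (a + 1)^-1 * nr (pert_iter a n - chi a))).
    move=> n; rewrite nrm_ge0/= -(ler_pM2l a10) mulVKf ?gt_eqF//.
    apply: (le_trans (resolvent_distB _ _ _)); rewrite ?perturbL ?XL ?cL//.
    by apply: perturb_dist; rewrite ?XL ?cL.
  by rewrite -[X in _ --> X](mulr0 (a + 1)^-1); apply: cvgM => //;
    apply: cvg_cst.
- move=> a a0; have [_ ca] := chiP a a0.
  have H1 : {ae mu, forall x, chi a x <= cst 1 x}.
    apply: (L1_cvg_lec (fun n => XL n a a0) (cL a a0) _ ca) => // n.
    by apply: filterS (pert_iter_unit n a0) => x /andP[].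
  have H0 : {ae mu, forall x, cst 0 x <= chi a x}.
    apply: (L1_cvg_gec (fun n => XL n a a0) (cL a a0) _ ca) => // n.
    by apply: filterS (pert_iter_unit n a0) => x /andP[].
  by apply: filterS2 H0 H1 => x -> ->.
- move=> a b b0 ba; have a0 := lt_le_trans b0 ba.
  have [_ ca] := chiP a a0; have [_ cb] := chiP b b0.
  apply: (L1_cvg_le (fun n => XL n a a0) (cL a a0) (fun n => XL n b b0)
    (cL b b0) ca cb) => n.
  exact: pert_iter_le.
Qed.

End perturbation.

End L1_resolvent.

(** * Approximating functions of a recurrent semigroup *)

Section recurrent_approximation.
Context {dT : measure_display} {T : measurableType dT} {R : realType}.
Variable mu : {measure set T -> \bar R}.
Variables G S : R -> (T -> R) -> (T -> R).
Hypothesis GR : subMarkov_resolvent mu 1 setT G.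
Hypothesis SG : subMarkov_semigroup mu 1 S.
Hypothesis gen : forall u h,
  resolvent_generator mu 1 setT G u h -> semigroup_generator mu 1 S u h.
Implicit Types (f g h u v w : T -> R).
Local Notation L1 := (Lfun mu 1).
Local Notation nr := (nrm mu 1).

Let le11 : (1 : R) <= 1. Proof. by []. Qed.

Lemma L1_integral_bounded_resolvent a g (N : nat) : 0 < a -> (0 < N)%N ->
  g \in L1 -> unit_valued mu (G a g) ->
  {ae mu, forall x, L1_integral mu S g N%:R x <= 1 + a * N%:R}.
Proof.
move=> a0 N0 gL Gu; have uL := resolventL GR a0 gL.
have N0' : 0 < N%:R :> R by rewrite ltr0n.
set u := G a g in Gu uL *; set h := a *: u - g.
have hL : h \in L1 by rewrite LfunB ?LfunZ.
have gE : g = a *: u + -1 *: h.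
  apply/funext => x; rewrite -[RHS]/(a * u x + -1 * (a * u x - g x)); ring.
have rg : resolvent_generator mu 1 setT G u h.
  by apply: (resolvent_generator_ae GR a0 gL uL); apply: filterE.
have E1 := L1_integral_generator SG N0' (gen rg).
have E2 := L1_integralZ SG (-1) N0' hL.
have E3 := L1_integral_lin SG a N0' uL (LfunZ le11 (-1) hL).
have Iu := L1_integral_unit SG N0' uL Gu.
have Tu := semigroup_subMarkov SG N0' uL Gu.
rewrite -gE in E3.
apply: filterS3 (filterI E1 E2) (filterI E3 Iu) (filterI Gu Tu).
move=> x [e1 e2] [-> Iu'] [/andP[_ u1] /andP[T0 _]]; rewrite e2 e1.
have : a * L1_integral mu S u N%:R x <= a * N%:R by rewrite ler_pM2l.
lra.
Qed.

Lemma recurrent_approximation w : recurrent mu S -> w \in L1 ->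
  {ae mu, forall x, 0 < w x} -> {ae mu, forall x, w x <= 1} ->
  exists chi Lchi : nat -> T -> R,
    [/\ forall n, resolvent_generator mu 1 setT G (chi n) (Lchi n),
        forall n, unit_valued mu (chi n),
        {ae mu, forall x, chi n x @[n --> \oo] --> (1 : R)},
        {ae mu, forall x, - Lchi n x @[n --> \oo] --> (0 : R)} &
        nr (Lchi n) @[n --> \oo] --> 0].
Proof.
move=> rec wL w0 w1.
have w01 : unit_valued mu w by apply: filterS2 w0 w1 => x /ltW -> ->.
have [chi [chi_gen chi_unit chi_mono]] := perturbed_resolvent GR wL w01.
pose a (n : nat) : R := n.+1%:R^-1.
have a0 n : 0 < a n by rewrite invr_gt0.
have aS n : a n.+1 <= a n by rewrite lef_pV2 ?posrE// ler_nat.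
pose c n := chi (a n).
pose h n x := a n * c n x - w x * (1 - c n x).
have cgen n : resolvent_generator mu 1 setT G (c n) (h n) by exact: chi_gen.
have cL n : c n \in L1 by case: (cgen n) => /Lp_on_setT.
have mw := Lfun_measurable wL; have mc n := Lfun_measurable (cL n).
have cu : {ae mu, forall x, forall n, 0 <= c n x <= 1}.
  by apply/ae_foralln => n; apply: chi_unit.
have cm : {ae mu, forall x, forall n, c n x <= c n.+1 x}.
  by apply/ae_foralln => n; apply: chi_mono.
(* This is [chi_0]; the upper limit makes it measurable and defined everywhere. *)
pose coo x := fine (limn_esup (fun n => (c n x)%:E)).
have mcoo : measurable_fun setT coo.
  apply: measurableT_comp => //; apply: measurable_fun_limn_esup => n.
  exact/measurable_EFinP.
have ccvg : {ae mu, forall x, c n x @[n --> \oo] --> coo x}.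
  apply: filterS2 cu cm => x cu cm.
  have cx : cvgn (fun n => c n x).
    apply: nondecreasing_is_cvgn; first exact/nondecreasing_seqP.
    by exists 1 => _ [n _ <-]; have /andP[] := cu n.
  have -> : coo x = limn (fun n => c n x); last exact: cx.
  rewrite /coo; have -> // : limn_esup (fun n => (c n x)%:E) =
      (limn (fun n => c n x))%:E.
  by apply: (cvg_limn_einf_sup _).2; apply: cvg_EFin => //; exact: nearW.
have cooP : {ae mu, forall x, 0 <= coo x <= 1 /\ forall n, c n x <= coo x}.
  apply: filterS3 cu cm ccvg => x cu cm ccvg.
  have cle n : c n x <= coo x.
    have nd : nondecreasing_seq (fun n => c n x) by exact/nondecreasing_seqP.
    have cx : cvgn (fun n => c n x) by apply/cvg_ex; exists (coo x).
    by have := nondecreasing_cvgn_le nd cx n; rewrite (cvg_lim _ ccvg).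
  split => //; apply/andP; split.
    by apply: le_trans (cle 0%N); have /andP[] := cu 0%N.
  apply: (@ler_cvg_to _ _ _ _ (fun n => c n x) (fun=> 1) _ _ ccvg).
    exact: cvg_cst.
  by apply: nearW => n; have /andP[] := cu n.
pose g x := w x * (1 - coo x).
pose gn n x := w x * (1 - c n x).
have mg : measurable_fun setT g.
  by apply: measurable_funM => //; apply: measurable_funB.
have mgn n : measurable_fun setT (gn n).
  by apply: measurable_funM => //; apply: measurable_funB.
have gnw n : {ae mu, forall x, `|gn n x| <= w x}.
  apply: filterS2 w01 cu => x /andP[w0' _] /(_ n)/andP[c0 c1].
  rewrite /gn normrM !ger0_norm ?subr_ge0// ler_piMr// gerBl//.
have gnL n : gn n \in L1.
  apply: (L1_dominated (mgn n) wL); apply: filterS (gnw n) => x.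
  by move/le_trans; apply; apply: ler_norm.
have g0 : {ae mu, forall x, 0 <= g x}.
  apply: filterS2 w01 cooP => x /andP[w0' _] [/andP[_ c1] _].
  by rewrite mulr_ge0// subr_ge0.
have gle n : {ae mu, forall x, g x <= gn n x}.
  apply: filterS2 w01 cooP => x /andP[w0' _] [_ cle].
  by rewrite /g /gn ler_wpM2l// lerB.
have gL : g \in L1.
  apply: (L1_dominated mg (gnL 0%N)); apply: filterS2 g0 (gle 0%N) => x gx gl.
  by rewrite !ger0_norm// (le_trans gx).
(* The generator identity read at the parameter [a n] itself, where the terms in [a n * c n]
   cancel. *)
have cE n : {ae mu, forall x, c n x = G (a n) (gn n) x}.
  case: (cgen n) => _ _ /(_ _ (a0 n)); apply: filterS => x ->.
  by congr (G _ _ x); apply/funext => y; rewrite /h /gn; ring.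
(* Since [c n <= coo], one has [g <= gn n], hence [G (a n) g <= G (a n) (gn n) = c n <= 1]. *)
have Gg n : unit_valued mu (G (a n) g).
  have H0 := resolvent_ge0 GR (a0 n) gL g0.
  have H1 := resolvent_le GR (a0 n) gL (gnL n) (gle n).
  apply: filterS3 (filterI (cE n) cu) H1 H0 => x [cEx cux] le ->.
  by rewrite (le_trans le)// -cEx; have /andP[] := cux n.
have I1 N : (0 < N)%N -> {ae mu, forall x, L1_integral mu S g N%:R x <= 1}.
  move=> N0.
  have H : {ae mu, forall x, forall n, L1_integral mu S g N%:R x <= 1 + a n *
    N%:R}.
    by apply/ae_foralln => n; apply: L1_integral_bounded_resolvent.
  apply: filterS H => x H.
  have cv : (1 + a n * N%:R) @[n --> \oo] --> (1 : R).
    rewrite -[X in _ --> X]addr0 -[X in _ + X](mul0r N%:R).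
    apply: cvgD; first exact: cvg_cst.
    by apply: cvgM; [exact: cvg_harmonic|exact: cvg_cst].
  by apply: (ler_cvg_to (cvg_cst (L1_integral mu S g N%:R x)) cv); apply: nearW.
have I1' : {ae mu, forall x, forall N, (0 < N)%N -> L1_integral mu S g N%:R x
  <= 1}.
  apply/ae_foralln => N; have [N0|N0] := boolP (0 < N)%N; last exact: filterE.
  by apply: filterS (I1 N N0) => x + _.
(* A potential at most 1 cannot be infinite, so it is 0. Only its consequence for the integral over
   [[0, 1]] is kept, which already forces [g = 0]. *)
have pot0 : {ae mu, forall x, L1_integral mu S g 1 x = 0}.
  have D := rec g gL g0; have P := potentialP SG gL g0.
  have I0 := L1_integral_ge0 SG (@ltr01 R) gL g0.
  apply: filterS3 (filterI D P) I1' I0 => x [Dx [P0 P1 P2]] I1x I0x.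
  have pot1 : (potential mu S g x <= 1)%E.
    by apply: P2 => N N0; rewrite lee_fin I1x.
  case: Dx => [pE|pE]; last by move: pot1; rewrite pE.
  have := P1 1%N isT; rewrite pE lee_fin => I1le.
  by apply/eqP; rewrite eq_le I0x andbT.
have gE := L1_integral_eq0 SG gL g0 pot0.
have coo1 : {ae mu, forall x, coo x = 1}.
  apply: filterS2 w0 gE => x w0x /eqP; rewrite mulf_eq0 gt_eqF//= subr_eq0.
  by move/eqP.
have c1 : {ae mu, forall x, c n x @[n --> \oo] --> (1 : R)}.
  by apply: filterS2 ccvg coo1 => x + <-.
have gn0 : {ae mu, forall x, gn n x @[n --> \oo] --> (0 : R)}.
  apply: filterS c1 => x c1;
    rewrite -[X in _ --> X](mulr0 (w x)) -(subrr (1 : R)).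
  by apply: cvgM; [exact: cvg_cst|apply: cvgB => //; exact: cvg_cst].
have [_ ngn _] := L1_DCT (u := (0 : T -> R)) mgn (measurable_cst (0 : R)) wL
  gn0 gnw.
have hE n : h n = a n *: c n - gn n by [].
exists c, h; split => //.
- by move=> n; apply: chi_unit.
- apply: filterS2 c1 gn0 => x c1 g0x.
  rewrite -[X in _ --> X]oppr0; apply: cvgN.
  rewrite -[X in _ --> X]subr0; apply: cvgB => //.
  rewrite -[X in _ --> X](mul0r 1); apply: cvgM => //; exact: cvg_harmonic.
- apply: (@cvg0_le _ _ (fun n => nr (gn n - 0) + nr (gn n - 0))); last first.
    by rewrite -[X in _ --> X]addr0; apply: cvgD.
  move=> n; rewrite nrm_ge0/= subr0 hE.
  apply: (le_trans (ler_nrmB le11 _ _)); rewrite ?LfunZ//.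
  rewrite lerD2r nrmZ// gtr0_norm//.
  rewrite (nrm_ae_eq (cL n) (resolventL GR (a0 n) (gnL n)) (cE n)).
  exact: (resolvent_contract GR).
Qed.

End recurrent_approximation.

(** * Generators and discounted semigroups *)

Section semigroup_generators.
Context {dT : measure_display} {T : measurableType dT} {R : realType}.
Variable mu : {measure set T -> \bar R}.
Variable p : R.
Hypothesis p1 : 1 <= p.
Implicit Types (f g h u v w k : T -> R) (b t s d e : R).
Implicit Type S : R -> (T -> R) -> (T -> R).
Local Notation L := (Lfun mu p%:E).
Local Notation nr := (nrm mu p).

Lemma semigroup_generatorP S u h : subMarkov_semigroup mu p%:E S ->
  u \in L -> h \in L ->
  semigroup_generator mu p%:E S u h <->
  forall e, 0 < e -> exists2 d, 0 < d &
    forall t, 0 < t -> t < d -> nr (t^-1 *: (S t u - u) - h) <= e.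
Proof.
move=> SG uL hL.
have qL t : 0 < t -> t^-1 *: (S t u - u) - h \in L.
  by move=> t0; rewrite LfunB ?LfunZ ?LfunB ?(semigroupL SG).
split.
  move=> [_ _ /fine_cvgP[_ /cvgrPdist_le H]] e /H[d /= d0 {}H].
  exists d => // t t0 td; have := H t; rewrite /= !sub0r !normrN gtr0_norm//.
  by move=> /(_ td t0); rewrite ger0_norm// fine_ge0// Lnorm_ge0.
move=> H; split => //; apply/fine_cvgP; split.
  near=> t; rewrite -[X in Lnorm _ _ X]/(EFin \o (t^-1 *: (S t u - u) - h)).
  rewrite (nrm_fine p1)// qL//.
apply/cvgrPdist_le => e /H[d d0 {}H].
near=> t; rewrite sub0r normrN ger0_norm; last by rewrite fine_ge0 ?Lnorm_ge0.
apply: H => //.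
Unshelve. all: by end_near.
Qed.

Section fixed_semigroup.
Variable S : R -> (T -> R) -> (T -> R).
Hypothesis SG : subMarkov_semigroup mu p%:E S.

Lemma semigroup_rsum_shift g d (m n : nat) : 0 < d -> (0 < m)%N -> g \in L ->
  {ae mu, forall x, S (m%:R * d) (rsum S g d n) x =
     \sum_(j < n) d * S ((m + j).+1%:R * d) g x}.
Proof.
move=> d0 m0 gL; have md0 : 0 < m%:R * d by rewrite mulr_gt0// ltr0n.
elim: n => [|n IH].
  rewrite /rsum big_ord0; apply: filterS (semigroup0 p1 SG md0) => x ->.
  by rewrite big_ord0.
have n0 : 0 < n.+1%:R * d by rewrite mulr_gt0.
have SnL := semigroupL SG n0 gL.
have -> : rsum S g d n.+1 = d *: S (n.+1%:R * d) g + rsum S g d n.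
  by rewrite /rsum big_ord_recr addrC.
have H1 := semigroup_lin SG d md0 SnL (rsumL p1 SG n d0 gL).
have H2 := semigroup_law SG md0 n0 gL.
apply: filterS3 IH H1 H2 => x IH -> H2; rewrite big_ord_recr/= -IH addrC.
by rewrite -[LHS]/(d * S _ (S _ g) x + _) -H2 -mulrDl -natrD addnS.
Qed.

(** Discrete form of the exchange between moving an integral of length [b] by a time [h] and
    integrating [S_b g - g] over [[0, h]]: both sides are differences of blocks of the same [n + m]
    terms. *)
Lemma semigroup_rsumB g b d (m n : nat) : 0 < d -> (0 < m)%N -> g \in L ->
  0 < b -> n%:R * d = b ->
  {ae mu, forall x, S (m%:R * d) (rsum S g d n) x - rsum S g d n x =
    rsum S (S b g - g) d m x}.
Proof.
move=> d0 m0 gL b0 nd.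
have H : {ae mu, forall x, forall j : nat, S (j.+1%:R * d) (S b g - g) x =
    S ((n + j).+1%:R * d) g x - S (j.+1%:R * d) g x}.
  apply/ae_foralln => j; have j0 : 0 < j.+1%:R * d by rewrite mulr_gt0.
  have := semigroupB SG j0 (semigroupL SG b0 gL) gL.
  have := semigroup_law SG j0 b0 gL; apply: filterS2 => x E ->.
  by rewrite -E -nd -mulrDl -natrD addnC addnS.
apply: filterS2 H (semigroup_rsum_shift n d0 m0 gL) => x H ->.
rewrite !rsumE.
under [RHS]eq_bigr => j _ do rewrite H mulrBr.
rewrite sumrB; apply/eqP.
rewrite subr_eq addrAC eq_sym subr_eq; apply/eqP.
pose a j := d * S (j.+1%:R * d) g x.
transitivity (\sum_(i < n + m) a i); first by rewrite big_split_ord/= addrC.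
by rewrite addnC big_split_ord/= addrC.
Qed.

(** This is the classical fact that [w], the integral of [S_s g] over [[0, b]], belongs to the
    domain of the generator. The discrete exchange identity expresses [S_h w - w] through
    [rsum S k d m], which is close to [h k] for small [h]. *)
Lemma rsum_limit_generator g w b : 0 < b -> g \in L -> w \in L ->
  nr (rsum S g (b / n.+1%:R) n.+1 - w) @[n --> \oo] --> 0 ->
  semigroup_generator mu p%:E S w (S b g - g).
Proof.
move=> b0 gL wL cw; set k := S b g - g.
have SbL := semigroupL SG b0 gL.
have kL : k \in L by rewrite LfunB.
apply/(semigroup_generatorP SG) => // e e0.
have [D D0 HD] := semigroup_modulus SG kL e0.
exists D => // h h0 hD.
have ShL := semigroupL SG h0 wL.
have -> : h^-1 *: (S h w - w) - k = h^-1 *: (S h w - w - h *: k).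
  by rewrite [RHS]scalerBr scalerA mulVf ?gt_eqF// scale1r.
rewrite nrmZ ?LfunB ?LfunZ// gtr0_norm ?invr_gt0//.
(* With [h] and [e] fixed, the arbitrary slack [y] absorbs all errors due to the grid. *)
rewrite ler_pdivrMl//; apply/ler_addgt0Pl => y y0.
have y40 : 0 < y / 4 by rewrite divr_gt0.
have [Dw Dw0 HDw] := semigroup_modulus SG wL y40.
have dlt (d : R) : 0 < d -> \forall n \near \oo, b / n.+1%:R < d.
  move=> d0; have Db0 : 0 < d / b by rewrite divr_gt0.
  have := near_infty_natSinv_lt (PosNum Db0); apply: filterS => n /=.
  by rewrite ltr_pdivlMr// mulrC.
(* The added 1 guards against [k] of norm 0. *)
have yk0 : 0 < y / 4 / (nr k + 1) by rewrite divr_gt0// ltr_wpDl ?nrm_ge0.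
move/cvgrPdist_le : cw => /(_ _ y40) cw.
have [n [dDw dh dk Rw]] : exists n, [/\ b / n.+1%:R <= Dw, b / n.+1%:R <= h,
    b / n.+1%:R <= y / 4 / (nr k + 1) &
    nr (rsum S g (b / n.+1%:R) n.+1 - w) <= y / 4].
  near \oo => n; exists n; split.
  - by apply: ltW; near: n; exact: dlt.
  - by apply: ltW; near: n; exact: dlt.
  - by apply: ltW; near: n; exact: dlt.
  - have : `|0 - nr (rsum S g (b / n.+1%:R) n.+1 - w)| <= y / 4 by near: n.
    by rewrite sub0r normrN ger0_norm ?nrm_ge0.
have d0 : 0 < b / n.+1%:R by rewrite divr_gt0.
have nd : n.+1%:R * (b / n.+1%:R) = b by rewrite mulrC divfK.
set d := b / n.+1%:R in dDw dh dk Rw d0 nd.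
set Rn := rsum S g d n.+1 in Rw.
have RL : Rn \in L by rewrite (rsumL p1 SG).
(* [h] need not be a multiple of the step [d]; [m d] is the largest multiple below it, and [d <= h]
   ensures [m > 0]. *)
pose m := Num.trunc (h / d).
have /andP[mh hm] : m%:R <= h / d < m.+1%:R by rewrite truncn_itv// divr_ge0
  ?ltW.
have m0 : (0 < m)%N.
  by rewrite -(ltr_nat R) -(ltrD2r 1) add0r natr1 (le_lt_trans _ hm)//
    ler_pdivlMr// mul1r.
have {}mh : m%:R * d <= h by rewrite -ler_pdivlMr.
have {}hm : h - m%:R * d <= d.
  by move: hm; rewrite ltr_pdivrMr// -natr1 mulrDl mul1r lerBlDl => /ltW.
have md0 : 0 < m%:R * d by rewrite mulr_gt0// ltr0n.
have SmwL := semigroupL SG md0 wL; have SmRL := semigroupL SG md0 RL.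
have rkL : rsum S k d m \in L by rewrite (rsumL p1 SG).
have E0 : nr (S (m%:R * d) Rn - Rn - rsum S k d m) = 0.
  apply: (nrm_ae0 p1); first by rewrite !LfunB.
  apply: filterS (semigroup_rsumB d0 m0 gL b0 nd) => x E.
  by rewrite -[LHS]/(S (m%:R * d) Rn x - Rn x - rsum S k d m x) E subrr.
(* In order: rounding [h] down to the grid, replacing [w] by its Riemann sum, the discrete identity
   (equal to 0), the closeness of [S_t k] to [k] for small [t], returning from the Riemann sum to
   [w], and rounding in the factor of [k]. Only the fourth costs [h e]; the others cost at most
   [y / 4] each. *)
have -> : S h w - w - h *: k = (S h w - S (m%:R * d) w) +
   (S (m%:R * d) w - S (m%:R * d) Rn) + (S (m%:R * d) Rn - Rn - rsum S k d m) +
   (rsum S k d m - m%:R * d *: k) + (Rn - w) - (h - m%:R * d) *: k.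
  apply/funext => x.
  rewrite -[LHS]/(S h w x - w x - h * k x).
  rewrite -[RHS]/((S h w x - S (m%:R * d) w x) +
    (S (m%:R * d) w x - S (m%:R * d) Rn x) +
    (S (m%:R * d) Rn x - Rn x - rsum S k d m x) +
    (rsum S k d m x - m%:R * d * k x) + (Rn x - w x) - (h - m%:R * d) * k x).
  ring.
have nk1 : 0 < nr k + 1 by rewrite ltr_wpDl ?nrm_ge0.
apply: (le_trans (ler_nrmB p1 _ _)); rewrite ?(LfunB, LfunZ, LfunD)//.
have -> : y + h * e = (y / 4 + y / 4 + 0 + h * e + y / 4) + y / 4 by field.
apply: lerD; last first.
  rewrite nrmZ// ger0_norm ?subr_ge0//.
  apply: (@le_trans _ _ (d * (nr k + 1))); last by rewrite -ler_pdivlMr.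
  by apply: ler_pM; rewrite ?subr_ge0 ?nrm_ge0// lerDl.
apply: (le_trans (ler_nrmD p1 _ _)); rewrite ?(LfunB, LfunZ, LfunD)//.
apply: lerD => //.
apply: (le_trans (ler_nrmD p1 _ _)); rewrite ?(LfunB, LfunZ, LfunD)//.
apply: lerD; last first.
  apply: (le_trans (rsum_near p1 SG d0 kL HD _));
    first by apply: le_trans mh (ltW hD).
  by rewrite ler_pM2r.
apply: (le_trans (ler_nrmD p1 _ _)); rewrite ?(LfunB, LfunZ, LfunD)//.
rewrite E0 lerD2r.
apply: (le_trans (ler_nrmD p1 _ _)); rewrite ?(LfunB, LfunZ, LfunD)//.
apply: lerD.
  apply: (semigroup_dist p1 SG (d := Dw)) => //; first exact: ltW.
  exact: le_trans hm dDw.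
apply: le_trans (semigroup_distB p1 SG md0 wL RL) _.
by rewrite nrm_distC.
Unshelve. all: by end_near.
Qed.

(** * Exponential discounting of a semigroup *)

Variable al : R.
Hypothesis al0 : 0 < al.

Definition discount t f : T -> R := expR (- (al * t)) *: S t f.

Let disc_le1 t : 0 < t -> expR (- (al * t)) <= 1.
Proof. by move=> t0; rewrite -expR0 ler_expR oppr_le0 mulr_ge0 ?ltW. Qed.

Lemma discount_semigroup : subMarkov_semigroup mu p%:E discount.
Proof.
have dL t f : 0 < t -> f \in L -> discount t f \in L.
  by move=> t0 fL; rewrite LfunZ ?(semigroupL SG).
split => //.
- move=> t c f g t0 fL gL.
  apply: filterS (semigroup_lin SG c t0 fL gL) => x E.
  rewrite -[LHS]/(_ * S t (c *: f + g) x) E.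
  rewrite -[(_ + _) x]/(c * S t f x + S t g x) mulrDr mulrCA//.
- move=> t f t0 fL; rewrite !(nrm_fine p1) ?dL// lee_fin nrmZ ?(semigroupL
    SG)//.
  rewrite ger0_norm ?expR_ge0// -[leRHS]mul1r; apply: ler_pM.
  + exact: expR_ge0.
  + exact: nrm_ge0.
  + exact: disc_le1.
  + exact: (semigroup_contract p1 SG).
- move=> s t f s0 t0 fL; have StL := semigroupL SG t0 fL.
  have := semigroup_law SG s0 t0 fL.
  have := semigroupZ p1 SG (expR (- (al * t))) s0 StL.
  apply: filterS2 => x E1 E2.
  rewrite -[LHS]/(_ * S (s + t) f x) -[RHS]/(_ * S s (_ *: S t f) x) E1 E2.
  by rewrite mulrA -expRD mulrDr opprD.
- move=> f fL; apply/fine_cvgP; split.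
    near=> t; rewrite -[X in Lnorm _ _ X]/(EFin \o (discount t f - f)).
    by rewrite (nrm_fine p1)// LfunB// dL.
  apply/cvgrPdist_le => e e0.
  have e20 : 0 < e / 2 by rewrite divr_gt0.
  have [D D0 HD] := semigroup_modulus SG fL e20.
  have nf0 : 0 < nr f + 1 by rewrite ltr_wpDl ?nrm_ge0.
  have y0 : 0 < e / 2 / (al * (nr f + 1)) by rewrite divr_gt0 ?mulr_gt0.
  near=> t; rewrite sub0r normrN ger0_norm; last by rewrite fine_ge0 ?Lnorm_ge0.
  have t0 : 0 < t by [].
  have StL := semigroupL SG t0 fL.
  rewrite -[X in X <= _]/(nr (discount t f - f)).
  have -> : discount t f - f = expR (- (al * t)) *: (S t f - f) -
      (1 - expR (- (al * t))) *: f.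
    by rewrite scalerBr scalerBl scale1r opprB addrA subrK.
  apply: (le_trans (ler_nrmB p1 _ _)); rewrite ?(LfunZ, LfunB)//.
  rewrite [leRHS]splitr; apply: lerD.
    rewrite nrmZ ?LfunB// ger0_norm ?expR_ge0//.
    apply: (@le_trans _ _ (nr (S t f - f))).
      by rewrite ler_piMl ?nrm_ge0// disc_le1.
    apply: HD => //; near: t; exact: nbhs_right_le.
  rewrite nrmZ// ger0_norm ?subr_ge0 ?disc_le1//.
  apply: (@le_trans _ _ (al * t * (nr f + 1))).
    apply: ler_pM; rewrite ?subr_ge0 ?disc_le1 ?nrm_ge0 ?lerDl//.
    rewrite lerBlDr addrC -lerBlDr; exact: expR_ge1Dx.
  rewrite mulrAC -ler_pdivlMl ?mulr_gt0// mulrC; near: t; exact: nbhs_right_le.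
- move=> t f t0 fL fu; have := semigroup_subMarkov SG t0 fL fu.
  apply: filterS => x /andP[S0 S1]; rewrite -[discount t f x]/(_ * S t f x).
  by rewrite mulr_ge0 ?expR_ge0//= mulr_ile1 ?expR_ge0 ?disc_le1.
Unshelve. all: by end_near.
Qed.

(** Discounting subtracts [al] from the generator; the proof undoes the factor by multiplying the
    difference quotient by [exp (al t)], expanded to first order with a quadratic remainder. *)
Lemma discount_generator w k : semigroup_generator mu p%:E discount w k ->
  semigroup_generator mu p%:E S w (al *: w + k).
Proof.
move=> gen; have [wL kL _] := gen.
move/(semigroup_generatorP discount_semigroup wL kL): gen => gen.
have akL : al *: w + k \in L by rewrite LfunD ?LfunZ.
apply/(semigroup_generatorP SG wL akL) => e e0.
pose M := nr k + nr w + 1.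
have M0 : 0 < M by rewrite ltr_wpDl// addr_ge0 ?nrm_ge0.
have e40 : 0 < e / 4 by rewrite divr_gt0.
have [d d0 Hd] := gen _ e40.
(* [t < 1 / (2 al)] yields [exp (al t) <= 2], so the main term costs [e / 2]; the last bound makes
   [2 al t M] and [2 al^2 t M], which dominate the two remaining terms, at most [e / 4] each. *)
exists (Num.min d (Num.min (1 / (2 * al)) (e / (8 * al * (al + 1) * M)))).
  by rewrite !lt_min d0 !divr_gt0// ?mulr_gt0// addr_gt0.
move=> t t0; rewrite !lt_min => /and3P[td t2 te].
have StL := semigroupL SG t0 wL.
set E := expR (al * t).
have at0 : 0 < al * t by rewrite mulr_gt0.
have E1 : 1 + al * t <= E by apply: expR_ge1Dx.
have at2 : al * t < 1 / 2.
  by move: t2; rewrite ltr_pdivlMr ?mulr_gt0// ltr_pdivlMr// => H; lra.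
(* [e^x <= 1 / (1 - x)] gives [e^x - 1 - x <= 2 x^2] for [x <= 1/2]. *)
have E2 : E <= 1 + al * t + 2 * (al * t) ^+ 2.
  have : 1 - al * t <= E^-1 by rewrite -expRN; apply: expR_ge1Dx.
  have E0 : 0 < E by apply: expR_gt0.
  rewrite -(ler_pM2r E0) mulVf ?gt_eqF// => H; rewrite expr2; nra.
have -> : t^-1 *: (S t w - w) - (al *: w + k) =
    E *: (t^-1 *: (discount t w - w) - k) + (E - 1) *: k +
    ((E - 1) / t - al) *: w.
  apply/funext => x.
  rewrite -[LHS]/(t^-1 * (S t w x - w x) - (al * w x + k x)).
  rewrite -[RHS]/(E * (t^-1 * (expR (- (al * t)) * S t w x - w x) - k x) +
    (E - 1) * k x + ((E - 1) / t - al) * w x).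
  have : E * expR (- (al * t)) = 1 by rewrite -expRD subrr expR0.
  move: (expR _) => F EF; have t_neq0 : t != 0 by rewrite gt_eqF.
  have -> : E * (t^-1 * (F * S t w x - w x) - k x) =
    t^-1 * ((E * F) * S t w x - E * w x) - E * k x by ring.
  by rewrite EF; field.
have dL : discount t w \in L by rewrite LfunZ.
apply: (le_trans (ler_nrmD p1 _ _)); rewrite ?(LfunB, LfunZ, LfunD)//.
have -> : e = e / 4 * 2 + e / 4 + e / 4 by field.
have E10 : 0 <= E - 1 by lra.
have tM : t * (8 * al * (al + 1) * M) < e.
  by rewrite -ltr_pdivlMr// !mulr_gt0// addr_gt0.
have atM : 0 <= al * t * M by rewrite !mulr_ge0// ltW.
have aatM : 0 <= al * al * t * M by rewrite !mulr_ge0// ltW.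
have [nk0 nw0] := (nrm_ge0 mu p k, nrm_ge0 mu p w).
apply: lerD.
  apply: (le_trans (ler_nrmD p1 _ _)); rewrite ?(LfunB, LfunZ, LfunD)//.
  apply: lerD.
    rewrite nrmZ ?(LfunB, LfunZ)// ger0_norm ?expR_ge0// mulrC.
    apply: ler_pM; rewrite ?nrm_ge0 ?expR_ge0//; first exact: Hd.
    nra.
  rewrite nrmZ// ger0_norm//.
  apply: (@le_trans _ _ (2 * (al * t) * M)); last by lra.
  apply: ler_pM => //; first by nra.
  by rewrite /M; lra.
rewrite nrmZ//.
have X0 : 0 <= (E - 1) / t - al.
  by rewrite subr_ge0 ler_pdivlMr//; lra.
rewrite ger0_norm//.
apply: (@le_trans _ _ (2 * al ^+ 2 * t * M)); last by rewrite expr2; lra.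
apply: ler_pM => //; last by rewrite /M; lra.
rewrite lerBlDr ler_pdivrMr//; nra.
Qed.

End fixed_semigroup.

End semigroup_generators.

(** * Recurrence of the semigroup of a form *)

Section L2.
Context {dT : measure_display} {T : measurableType dT} {R : realType}.
Variable mu : {measure set T -> \bar R}.
Implicit Types (f g h u v w k : T -> R).
Local Notation L1 := (Lfun mu 1).
Local Notation L2 := (Lfun mu 2%:E).
Local Notation nr1 := (nrm mu 1).
Local Notation nr2 := (nrm mu 2).

Let le11 : (1 : R) <= 1. Proof. by []. Qed.
Let le12 : (1 : R) <= 2. Proof. by rewrite ler1n. Qed.

Lemma L2_mul f g : f \in L2 -> g \in L2 ->
  mu.-integrable setT (EFin \o (fun x => f x * g x)).
Proof. by move=> fL gL; apply/Lfun1_integrable; apply: Lfun2_mul_Lfun1. Qed.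

Lemma L2_cauchy_schwarz f g : f \in L2 -> g \in L2 ->
  `|\int[mu]_x (f x * g x)| <= nr2 f * nr2 g.
Proof.
move=> fL gL; have fgL : f \* g \in L1 by apply: Lfun2_mul_Lfun1.
apply: (le_trans (le_normr_Rintegral measurableT (L2_mul fL gL))).
rewrite -[X in X <= _]/(\int[mu]_x `|(f \* g) x|) -nrm1E// -lee_fin EFinM.
rewrite -!nrm_fine//; apply: (@hoelder _ _ _ mu f g 2 2) => //.
- exact: Lfun_measurable fL.
- exact: Lfun_measurable gL.
- by rewrite [RHS]splitr !div1r.
Qed.

Lemma nrm2_sqr f : f \in L2 -> nr2 f ^+ 2 = \int[mu]_x (f x * f x).
Proof.
move=> fL; suff E : ((nr2 f ^+ 2)%:E = \int[mu]_x (f x * f x)%:E)%E.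
  by rewrite /Rintegral -E.
rewrite -powR_mulrn ?nrm_ge0// -poweR_EFin -(nrm_fine le12 fL).
rewrite powR_Lnorm ?pnatr_eq0//; apply: eq_integral => x _ /=.
by rewrite powR_mulrn// -normrX ger0_norm ?sqr_ge0// expr2.
Qed.

(** Interpolation [|f|^2 <= M |f|]. The quantitative form turns L^1-convergence of uniformly bounded
    functions into L^2-convergence. *)
Lemma L1_bounded_L2 f (M : R) : 0 <= M -> f \in L1 ->
  {ae mu, forall x, `|f x| <= M} -> f \in L2 /\ nr2 f ^+ 2 <= M * nr1 f.
Proof.
move=> M0 fL fM; have mf := Lfun_measurable fL.
have mnf : measurable_fun setT (fun x => `|f x|) by apply: measurableT_comp.
have le : (\int[mu]_x (`|f x| ^+ 2)%:E <= (M * nr1 f)%:E)%E.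
  have -> : ((M * nr1 f)%:E = \int[mu]_x (M * `|f x|)%:E)%E.
    under eq_integral do rewrite EFinM.
    rewrite integralZl// ?nrm1_fine ?EFinM//.
    by apply/Lfun1_integrable; apply: Lfun_norm.
  apply: ae_ge0_le_integral => //.
  - by apply/measurable_EFinP; apply: measurable_funX.
  - by move=> x _; rewrite lee_fin mulr_ge0.
  - by apply/measurable_EFinP; apply: measurable_funM.
  - by apply: filterS fM => x fx _; rewrite lee_fin expr2 ler_wpM2r.
have E : (Lnorm mu 2%:E (EFin \o f) `^ 2 = \int[mu]_x (`|f x| ^+ 2)%:E)%E.
  rewrite powR_Lnorm ?pnatr_eq0//; apply: eq_integral => x _ /=.
  by rewrite powR_mulrn.
have fL2 : f \in L2.
  rewrite inE; apply/andP; split; rewrite inE//=.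
  apply: (@lty_poweRy _ _ 2); rewrite ?pnatr_eq0// E.
  by apply: le_lt_trans le _; rewrite ltry.
split => //; rewrite -lee_fin; apply: le_trans le.
by rewrite -E (nrm_fine le12 fL2) poweR_EFin powR_mulrn// nrm_ge0.
Qed.

Lemma L1_ge0_Rintegral f : f \in L1 -> {ae mu, forall x, 0 <= f x} ->
  \int[mu]_x f x = nr1 f.
Proof.
move=> fL f0; rewrite nrm1E//; congr fine; apply: ae_eq_integral => //.
- by apply/measurable_EFinP; apply: Lfun_measurable fL.
- apply/measurable_EFinP; apply: measurableT_comp => //.
  exact: Lfun_measurable fL.
- by apply: filterS f0 => x fx _; rewrite ger0_norm.
Qed.

Lemma ae_le_Rintegral f g : f \in L1 -> g \in L1 ->
  {ae mu, forall x, f x <= g x} -> \int[mu]_x f x <= \int[mu]_x g x.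
Proof.
move=> fL gL fg; rewrite -subr_ge0 -RintegralB//; try exact: L1_integrable.
rewrite -[X in 0 <= X]/(\int[mu]_x (g - f) x) L1_ge0_Rintegral ?nrm_ge0//.
  exact: LfunB.
by apply: filterS fg => x; rewrite -[(g - f) x]/(g x - f x) subr_ge0.
Qed.

Lemma measurable_sublevel f (a : R) : measurable_fun setT f ->
  measurable [set x | f x <= a].
Proof.
move=> mf; rewrite -[X in measurable X]setTI.
have := measurable_fun_ler mf (measurable_cst a) measurableT.
by move=> /(_ [set true]); apply.
Qed.

End L2.

(** * Recurrence from functions of vanishing energy that tend to 1 *)

Section form_recurrence.
Context {dT : measure_display} {T : measurableType dT} {R : realType}.
Variable mu : {measure set T -> \bar R}.
Implicit Types (f g h u v w k : T -> R).
Local Notation L1 := (Lfun mu 1).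
Local Notation L2 := (Lfun mu 2%:E).
Local Notation nr1 := (nrm mu 1).
Local Notation nr2 := (nrm mu 2).

Let le11 : (1 : R) <= 1. Proof. by []. Qed.
Let le12 : (1 : R) <= 2. Proof. by rewrite ler1n. Qed.

Variables S P : R -> (T -> R) -> (T -> R).
Hypothesis SS : subMarkov_semigroup mu 1 S.
Hypothesis SP : subMarkov_semigroup mu 2%:E P.
Hypothesis SPE : forall (t : R) f, 0 < t -> f \in L1 -> f \in L2 ->
  {ae mu, forall x, S t f x = P t f x}.
Variables (F : (T -> R) -> (T -> R) -> R) (D : set (T -> R)) (K : R).
Hypothesis F_gen : forall u h, semigroup_generator mu 2%:E P u h ->
  form_generator mu F D setT u h.
Hypothesis F_ge0 : forall u, D u -> 0 <= F u u.
Hypothesis K0 : 0 <= K.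
Hypothesis F_sector : forall u v, D u -> D v ->
  `|F u v| <= K * Num.sqrt (F u u) * Num.sqrt (F v v).
Variable chi : nat -> T -> R.
Hypothesis chiD : forall n, D (chi n).
Hypothesis chiL : forall n, chi n \in L2.
Hypothesis chi_unit : forall n, unit_valued mu (chi n).
Hypothesis chi_cvg : {ae mu, forall x, chi n x @[n --> \oo] --> (1 : R)}.
Hypothesis F_chi : F (chi n) (chi n) @[n --> \oo] --> 0.

Section bounded_potential.
Variables (g : T -> R) (M c : R).
Hypothesis gL : g \in L1.
Hypothesis g0 : {ae mu, forall x, 0 <= g x}.
Hypothesis M0 : 0 < M.
Hypothesis gM : {ae mu, forall x, g x <= M}.
Hypothesis c0 : 0 <= c.
(** The factor [g] on both sides confines the bound by [c] to [{g > 0}]. *)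
Hypothesis gc : forall N : nat, (0 < N)%N ->
  {ae mu, forall x, g x * L1_integral mu S g N%:R x <= c * g x}.

Let gL2 : g \in L2.
Proof.
apply: (L1_bounded_L2 (ltW M0) gL _).1; apply: filterS2 g0 gM => x g0x gMx.
by rewrite ger0_norm.
Qed.

(** Testing the equation of the discounted integral [w] against [chi n] leaves three terms: the
    form, bounded by the sector condition, [al (w, chi n)], bounded through [al |w|^2 <= c |g|_1],
    and the remainder at the horizon [N]. *)
Let resolvent_estimate (al : R) (N n : nat) : 0 < al -> (0 < N)%N ->
  \int[mu]_x (g x * chi n x) <=
    K * Num.sqrt (c * nr1 g) * Num.sqrt (F (chi n) (chi n)) +
    Num.sqrt (al * (c * nr1 g)) * nr2 (chi n) +
    expR (- (al * N%:R)) * nr2 g * nr2 (chi n).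
Proof.
move=> al0 N0; have N0' : 0 < N%:R :> R by rewrite ltr0n.
(* The same discount on L^1 and on L^2: order and potentials are handled with [Q], generator and
   form with [Q2], and the two agree on [g]. *)
pose Q := discount S al; pose Q2 := discount P al.
have SQ : subMarkov_semigroup mu 1 Q by apply: discount_semigroup.
have SQ2 : subMarkov_semigroup mu 2%:E Q2 by apply: discount_semigroup.
have QQ2 t : 0 < t -> {ae mu, forall x, Q t g x = Q2 t g x}.
  move=> t0; apply: filterS (SPE t0 gL gL2) => x E.
  by rewrite -[LHS]/(_ * S t g x) E.
have Nn (m : nat) : 0 < N%:R / m.+1%:R :> R by rewrite divr_gt0.
have [wL cw] := L1_integralP SQ N0' gL.
set w := L1_integral mu Q g N%:R in wL cw.
have [IL cI] := L1_integralP SS N0' gL.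
have w0 : {ae mu, forall x, 0 <= w x} by apply: L1_integral_ge0.
have Q_le_S t : 0 < t -> {ae mu, forall x, Q t g x <= S t g x}.
  move=> t0; apply: filterS (semigroup_ge0 SS t0 gL g0) => x Sx.
  rewrite -[X in X <= _]/(expR (- (al * t)) * S t g x) ler_piMl//.
  by rewrite -expR0 ler_expR oppr_le0 mulr_ge0 ?ltW.
(* Discounting only decreases the terms of the Riemann sums, so [w] inherits the bound on the
   potential of [g]. *)
have wI : {ae mu, forall x, w x <= L1_integral mu S g N%:R x}.
  apply: (L1_cvg_le _ wL _ IL cw cI) => m.
  - by rewrite (rsumL le11 SQ).
  - by rewrite (rsumL le11 SS).
  have H : {ae mu, forall x, forall k : nat,
      Q (k.+1%:R * (N%:R / m.+1%:R)) g x <= S (k.+1%:R * (N%:R / m.+1%:R)) g x}.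
    by apply/ae_foralln => k; apply: Q_le_S; rewrite mulr_gt0.
  apply: filterS H => x H; rewrite !rsumE; apply: ler_sum => k _.
  by rewrite ler_pM2l.
have IM : {ae mu, forall x, L1_integral mu S g N%:R x <= M * N%:R}.
  have gML : M^-1 *: g \in L1 by rewrite LfunZ.
  have gMu : unit_valued mu (M^-1 *: g).
    apply: filterS2 g0 gM => x g0x gMx; rewrite -[(_ *: _) x]/(M^-1 * g x).
    by rewrite mulr_ge0 ?invr_ge0 ?(ltW M0)//= ler_pdivrMl// mulr1.
  have := L1_integral_unit SS N0' gML gMu.
  have := L1_integralZ SS M^-1 N0' gL.
  by apply: filterS2 => x ->; rewrite ler_pdivrMl.
have MN0 : 0 < M * N%:R by rewrite mulr_gt0.
have wM : {ae mu, forall x, `|w x| <= M * N%:R}.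
  apply: filterS3 w0 wI IM => x w0x wIx IMx.
  by rewrite ger0_norm// (le_trans wIx).
have [wL2 _] := L1_bounded_L2 (ltW MN0) wL wM.
have QM t : 0 < t -> {ae mu, forall x, 0 <= Q t g x <= M}.
  move=> t0; have gML : M^-1 *: g \in L1 by rewrite LfunZ.
  have gMu : unit_valued mu (M^-1 *: g).
    apply: filterS2 g0 gM => x g0x gMx; rewrite -[(_ *: _) x]/(M^-1 * g x).
    by rewrite mulr_ge0 ?invr_ge0 ?(ltW M0)//= ler_pdivrMl// mulr1.
  have H := semigroup_subMarkov SQ t0 gML gMu.
  apply: filterS2 (semigroupZ le11 SQ M^-1 t0 gL) H => x -> /andP[H0 H1].
  by rewrite -(pmulr_rge0 _ (_ : 0 < M^-1)) ?invr_gt0// H0 -[M]mulr1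
    -ler_pdivrMl.
have rQL (m : nat) : rsum Q g (N%:R / m.+1%:R) m.+1 \in L1.
  by rewrite (rsumL le11 SQ).
have rQM (m : nat) : {ae mu, forall x,
    `|(rsum Q g (N%:R / m.+1%:R) m.+1 - w) x| <= M * N%:R}.
  have H : {ae mu, forall x, forall k : nat,
      0 <= Q (k.+1%:R * (N%:R / m.+1%:R)) g x <= M}.
    by apply/ae_foralln => k; apply: QM; rewrite mulr_gt0.
  apply: filterS3 H w0 wM => x H w0x; rewrite ger0_norm// => wMx.
  rewrite -[(_ - _) x]/(rsum Q g (N%:R / m.+1%:R) m.+1 x - w x) rsumE.
  set r := \sum_(k < _) _.
  have r0 : 0 <= r.
    apply: sumr_ge0 => k _; have /andP[Qx _] := H k.
    by rewrite mulr_ge0// ltW.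
  have rM : r <= M * N%:R.
    apply: (@le_trans _ _ (\sum_(k < m.+1) N%:R / m.+1%:R * M)).
      by apply: ler_sum => k _; have /andP[_ Qx] := H k; rewrite ler_pM2l.
    rewrite sumr_const card_ord -[leLHS]mulr_natl mulrA [m.+1%:R * _]mulrC.
    by rewrite divfK// mulrC.
  by rewrite ler_norml; apply/andP; split; lra.
(* The Riemann sums and [w] take values in [[0, M N]], so interpolation lifts the convergence from
   L^1 to L^2. *)
have cw2 : nr2 (rsum Q2 g (N%:R / m.+1%:R) m.+1 - w) @[m --> \oo] --> 0.
  apply: (@cvg0_le _ _ (fun m : nat => Num.sqrt (M * N%:R *
      nr1 (rsum Q g (N%:R / m.+1%:R) m.+1 - w)))).
    move=> m; rewrite nrm_ge0/=.
    have [rwL le] := L1_bounded_L2 (ltW MN0) (LfunB le11 (rQL m) wL) (rQM m).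
    have rQ2L : rsum Q2 g (N%:R / m.+1%:R) m.+1 \in L2.
      by rewrite (rsumL le12 SQ2).
    rewrite (_ : nr2 _ = nr2 (rsum Q g (N%:R / m.+1%:R) m.+1 - w)).
      by rewrite -[leLHS]ger0_norm ?nrm_ge0// -sqrtr_sqr; apply: ler_wsqrtr.
    apply: nrm_ae_eq => //; first by rewrite LfunB.
    have H : {ae mu, forall x, forall k : nat,
        Q (k.+1%:R * (N%:R / m.+1%:R)) g x = Q2 (k.+1%:R * (N%:R / m.+1%:R)) g
          x}.
      by apply/ae_foralln => k; apply: QQ2; rewrite mulr_gt0.
    apply: filterS H => x H.
    rewrite -[LHS]/(rsum Q2 g (N%:R / m.+1%:R) m.+1 x - w x).
    rewrite -[RHS]/(rsum Q g (N%:R / m.+1%:R) m.+1 x - w x) !rsumE.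
    by congr (_ - _); apply: eq_bigr => k _; rewrite H.
  rewrite -[X in _ --> X](sqrtr0 R) -[X in Num.sqrt X](mulr0 (M * N%:R)).
  apply: continuous_cvg; first exact: sqrt_continuous.
  by apply: cvgM => //; apply: cvg_cst.
have gen : semigroup_generator mu 2%:E P w (al *: w + (Q2 N%:R g - g)).
  apply: (discount_generator le12 SP al0).
  exact: (rsum_limit_generator le12 SQ2 N0' gL2 wL2 cw2).
have [Dw _ Fw] := F_gen gen.
have Q2L : Q2 N%:R g \in L2 by rewrite (semigroupL SQ2).
have Q20 : {ae mu, forall x, 0 <= Q2 N%:R g x}.
  apply: filterS2 (QQ2 _ N0') (semigroup_ge0 SQ N0' gL g0) => x -> //.
have Fw' v : v \in L2 -> D v -> F w v = \int[mu]_x (g x * v x) -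
    al * \int[mu]_x (w x * v x) - \int[mu]_x (Q2 N%:R g x * v x).
  move=> vL Dv; rewrite Fw//.
  have -> : \int[mu]_x ((al *: w + (Q2 N%:R g - g)) x * v x) =
      \int[mu]_x (al * (w x * v x) + (Q2 N%:R g x * v x - g x * v x)).
    apply: eq_Rintegral => x _.
    by rewrite -[(_ + _) x]/(al * w x + (Q2 N%:R g x - g x)); ring.
  have iw := L2_mul wL2 vL; have ig := L2_mul gL2 vL; have iQ := L2_mul Q2L vL.
  rewrite RintegralD// ?RintegralB// ?RintegralZl//; first by ring.
  - apply: L1_integrable; apply: (@LfunZ _ _ _ mu 1 le11 al (fun x => w x * v
      x)).
    exact: Lfun2_mul_Lfun1.
  - apply: L1_integrable; apply: (@LfunB _ _ _ mu 1 le11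
      (fun x => Q2 N%:R g x * v x) (fun x => g x * v x)).
      exact: Lfun2_mul_Lfun1.
    exact: Lfun2_mul_Lfun1.
set C := c * nr1 g; have C0 : 0 <= C by rewrite mulr_ge0 ?nrm_ge0.
have mulL u v : u \in L2 -> v \in L2 -> (fun x => u x * v x) \in L1.
  by move=> uL vL; apply: Lfun2_mul_Lfun1.
have gw : \int[mu]_x (g x * w x) <= C.
  rewrite /C -(L1_ge0_Rintegral gL g0) -RintegralZl//;
    last exact: L1_integrable.
  apply: ae_le_Rintegral; [exact: mulL|exact: (LfunZ le11 c gL)|].
  apply: filterS3 g0 wI (gc N0) => x g0x wIx; apply: le_trans.
  by rewrite ler_wpM2l.
(* The boundary term at [N] has a favourable sign when the equation is tested against [w], and is
   dropped from the energy estimate. *)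
have Q2w : 0 <= \int[mu]_x (Q2 N%:R g x * w x).
  rewrite L1_ge0_Rintegral ?nrm_ge0//; first exact: mulL.
  by apply: filterS2 Q20 w0 => x Qx wx; rewrite mulr_ge0.
have Fww : F w w + al * nr2 w ^+ 2 <= C.
  by rewrite (Fw' w)// nrm2_sqr//; lra.
have Fw0 := F_ge0 Dw; have Fchi0 := F_ge0 (chiD n).
have nw0 : 0 <= al * nr2 w ^+ 2 by rewrite mulr_ge0 ?sqr_ge0// ltW.
have FwC : F w w <= C by lra.
have nwC : al * nr2 w <= Num.sqrt (al * C).
  rewrite -(@ler_pXn2r _ 2)// ?nnegrE ?sqrtr_ge0 ?mulr_ge0 ?nrm_ge0 ?(ltW
    al0)//.
  rewrite sqr_sqrtr; last exact: mulr_ge0 (ltW al0) C0.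
  by rewrite exprMn expr2 -mulrA ler_pM2l//; lra.
have nQ2 : nr2 (Q2 N%:R g) <= expR (- (al * N%:R)) * nr2 g.
  rewrite nrmZ ?(semigroupL SP)// ger0_norm ?expR_ge0// ler_wpM2l ?expR_ge0//.
  exact: (semigroup_contract le12 SP).
have -> : \int[mu]_x (g x * chi n x) = F w (chi n) +
    al * \int[mu]_x (w x * chi n x) + \int[mu]_x (Q2 N%:R g x * chi n x).
  by rewrite Fw'//; ring.
have nchi0 := nrm_ge0 mu 2 (chi n).
apply: lerD; first apply: lerD.
- apply: (le_trans (ler_norm _)); apply: (le_trans (F_sector Dw (chiD n))).
  rewrite ler_wpM2r ?sqrtr_ge0// ler_wpM2l//; exact: ler_wsqrtr.
- apply: (@le_trans _ _ (al * (nr2 w * nr2 (chi n)))).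
    rewrite ler_pM2l//; apply: (le_trans (ler_norm _)).
    exact: L2_cauchy_schwarz.
  by rewrite mulrA ler_wpM2r.
- apply: (le_trans (ler_norm _));
    apply: (le_trans (L2_cauchy_schwarz _ _)) => //.
  by rewrite ler_wpM2r.
Qed.

Lemma bounded_potential_eq0 : {ae mu, forall x, g x = 0}.
Proof.
set C := c * nr1 g; have C0 : 0 <= C by rewrite mulr_ge0 ?nrm_ge0.
have est n : \int[mu]_x (g x * chi n x) <=
    K * Num.sqrt C * Num.sqrt (F (chi n) (chi n)).
  (* The choice [al = 1 / (m+1)] and [N = (m+1)^2] sends [al] to 0 while [al N = m+1] tends to
     infinity. *)
  have cv : (K * Num.sqrt C * Num.sqrt (F (chi n) (chi n)) +
      Num.sqrt (m.+1%:R^-1 * C) * nr2 (chi n) +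
      expR (- (m.+1%:R^-1 * (m.+1 * m.+1)%:R)) * nr2 g * nr2 (chi n))
      @[m --> \oo] --> K * Num.sqrt C * Num.sqrt (F (chi n) (chi n)).
    rewrite -[X in _ --> X]addr0 -[X in X + _]addr0.
    apply: cvgD; first (apply: cvgD; first exact: cvg_cst).
      rewrite -[X in _ --> X](mul0r (nr2 (chi n))); apply: cvgM;
        last exact: cvg_cst.
      rewrite -[X in _ --> X](sqrtr0 R) -[X in Num.sqrt X](mul0r C).
      apply: continuous_cvg; first exact: sqrt_continuous.
      by apply: cvgM; [exact: cvg_harmonic|exact: cvg_cst].
    rewrite -[X in _ --> X](mul0r (nr2 (chi n))); apply: cvgM;
      last exact: cvg_cst.
    rewrite -[X in _ --> X](mul0r (nr2 g)); apply: cvgM; last exact: cvg_cst.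
    apply: (@cvg0_le _ _ (fun m : nat => m.+1%:R^-1)); last exact: cvg_harmonic.
    move=> m; rewrite expR_ge0/= natrM mulKf// expRN lef_pV2 ?posrE ?expR_gt0//.
    by apply: le_trans (expR_ge1Dx _); rewrite lerDr.
  apply: (ler_cvg_to (cvg_cst (\int[mu]_x (g x * chi n x))) cv).
  by apply: nearW => m; apply: resolvent_estimate.
have mg := Lfun_measurable gL.
have mgchi n : measurable_fun setT (fun x => g x * chi n x).
  by apply: measurable_funM => //; apply: Lfun_measurable (chiL n).
have cgchi : {ae mu, forall x, g x * chi n x @[n --> \oo] --> g x}.
  apply: filterS chi_cvg => x cx; rewrite -[X in _ --> X]mulr1.
  by apply: cvgM => //; exact: cvg_cst.
have gchi_le n : {ae mu, forall x, `|g x * chi n x| <= g x}.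
  apply: filterS2 g0 (chi_unit n) => x g0x /andP[c0x c1x].
  by rewrite ger0_norm ?mulr_ge0// ler_piMr.
have [_ _ cv] := L1_DCT mgchi mg gL cgchi gchi_le.
have rhs : (K * Num.sqrt C * Num.sqrt (F (chi n) (chi n))) @[n --> \oo] --> (0
  : R).
  have sq : Num.sqrt (F (chi n) (chi n)) @[n --> \oo] --> (0 : R).
    rewrite -[X in _ --> X](sqrtr0 R).
    by apply: continuous_cvg => //; exact: sqrt_continuous.
  rewrite -[X in _ --> X](mulr0 (K * Num.sqrt C)).
  by apply: cvgM => //; exact: cvg_cst.
apply: (nrm_eq0_ae le11 gL); apply/eqP; rewrite eq_le nrm_ge0 andbT.
rewrite -(L1_ge0_Rintegral gL g0).
by apply: (ler_cvg_to cv rhs); apply: nearW.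
Qed.

End bounded_potential.

(** On [Z] the function [u] coincides up to sign with [us n - u], so [u] restricted to [Z] has norm
    0. *)
Lemma L1_cvg_eq0_on (us : nat -> T -> R) u (Z : set T) : measurable Z ->
  (forall n, us n \in L1) -> u \in L1 -> nr1 (us n - u) @[n --> \oo] --> 0 ->
  (forall n, {ae mu, forall x, Z x -> us n x = 0}) ->
  {ae mu, forall x, Z x -> u x = 0}.
Proof.
move=> mZ usL uL cu us0; have mu_ := Lfun_measurable uL.
pose uZ x := u x * \1_Z x.
have uZL : uZ \in L1.
  apply: (L1_dominated _ uL).
    by apply: measurable_funM => //; apply: measurable_indic.
  apply: filterE => x; rewrite normrM ler_piMr// indicE.
  by case: (x \in Z); rewrite ?normr1 ?normr0.
have : nr1 uZ = 0.
  have H : (fun=> nr1 uZ) @ \oo --> (0 : R).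
    apply: (@cvg0_le _ _ (fun n => nr1 (us n - u))) => // n.
    rewrite nrm_ge0 nrm1_le ?LfunB//; apply: filterS (us0 n) => x usx.
    rewrite -[(us n - u) x]/(us n x - u x) /uZ indicE.
    have [/set_mem Zx|_] := boolP (x \in Z).
      by rewrite usx// sub0r normrN mulr1.
    by rewrite mulr0 normr0.
  exact: (cvg_unique _ (cvg_cst (nr1 uZ)) H).
move/(nrm_eq0_ae le11 uZL); apply: filterS => x + Zx.
by rewrite /uZ indicE mem_set// mulr1.
Qed.

(** On [A c] both [f] and all its integrals are at most [c+1]. The restriction of [f] to [A c] is
    thus bounded, and its integrals, dominated by those of [f], are at most [c+1] wherever it is
    positive; hence it vanishes. The sets [A c] cover a.e. the points of finite potential. *)
Lemma finite_potential_eq0 f : f \in L1 -> {ae mu, forall x, 0 <= f x} ->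
  {ae mu, forall x, (potential mu S f x < +oo)%E -> f x = 0}.
Proof.
move=> fL f0; have mf := Lfun_measurable fL.
pose A (c : nat) : set T := [set x | f x <= c.+1%:R] `&`
  \bigcap_(N in setT) [set x | L1_integral mu S f N.+1%:R x <= c.+1%:R].
have mA c : measurable (A c).
  apply: measurableI; first exact: measurable_sublevel.
  apply: bigcapT_measurable => N; apply: measurable_sublevel.
  by apply: Lfun_measurable (L1_integralL SS _ fL).
pose g c x := f x * \1_(A c) x.
have gf c x : 0 <= f x -> 0 <= g c x <= f x.
  move=> fx; rewrite /g indicE; case: (x \in A c);
    rewrite ?mulr1 ?mulr0 ?fx ?lexx//.
have gL c : g c \in L1.
  apply: (L1_dominated _ fL).
    by apply: measurable_funM => //; apply: measurable_indic.
  apply: filterS f0 => x /(gf c)/andP[g0 gx].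
  by rewrite !ger0_norm// (le_trans g0).
have g0 c : {ae mu, forall x, 0 <= g c x}.
  by apply: filterS f0 => x /(gf c)/andP[].
have g_eq0 : {ae mu, forall x, forall c, g c x = 0}.
  apply/ae_foralln => c.
  apply: (@bounded_potential_eq0 (g c) c.+1%:R c.+1%:R) => //.
    apply: filterS f0 => x fx; rewrite /g indicE.
    have [/set_mem[fc _]|_] := boolP (x \in A c); first by rewrite mulr1.
    by rewrite mulr0.
  case=> // N _; have N0 : 0 < N.+1%:R :> R by [].
  have := L1_integral_le SS N0 (gL c) fL.
  have gf' : {ae mu, forall x, g c x <= f x}.
    by apply: filterS f0 => x /(gf c)/andP[].
  move=> /(_ gf'); apply: filterS2 (g0 c) => x g0x le.
  have [/set_mem[_ Ax]|xA] := boolP (x \in A c).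
    by rewrite mulrC ler_wpM2r//; apply: le_trans le (Ax N I).
  by rewrite /g indicE (negbTE xA) mulr0 mul0r mulr0.
apply: filterS3 g_eq0 (potentialP SS fL f0) f0 => x gx [P0 P1 _] fx pfin.
have pE : potential mu S f x = (fine (potential mu S f x))%:E.
  by rewrite fineK// ge0_fin_numE.
set r := fine _ in pE.
(* An index for which [x] belongs to [A c]: [c+1] exceeds both [f x] and the potential. *)
pose c := Num.trunc (Num.max r (f x)).
have cmax := truncnS_gt (Num.max r (f x)).
have := gx c; rewrite /g indicE mem_set ?mulr1//.
split => /=; first by rewrite ltW// (le_lt_trans _ cmax)// le_max lexx orbT.
move=> N _ /=; rewrite ltW// (le_lt_trans _ cmax)// le_max -lee_fin -pE.
by rewrite P1.
Qed.

Lemma form_semigroup_recurrent : recurrent mu S.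
Proof.
move=> f fL f0.
(* Rational times suffice, because the Riemann sums of mesh [1 / (j+1)] evaluate the orbit only
   there; this keeps the exceptional null sets countable in number. *)
pose r (i q : nat) : R := i.+1%:R / q.+1%:R.
have r0 i q : 0 < r i q by rewrite divr_gt0.
have SrL i q : S (r i q) f \in L1 by rewrite (semigroupL SS).
have Sr0 i q : {ae mu, forall x, 0 <= S (r i q) f x} by apply: semigroup_ge0.
have fin0 : {ae mu, forall x, (potential mu S f x < +oo)%E ->
    forall i q, S (r i q) f x = 0}.
  have H : {ae mu, forall x, forall i q, (potential mu S f x < +oo)%E ->
      S (r i q) f x = 0}.
    apply/ae_foralln => i; apply/ae_foralln => q.
    have sh : {ae mu, forall x, forall N, L1_integral mu S (S (r i q) f)
      N.+1%:R x <=
        L1_integral mu S f (N.+1 + i.+1)%:R x}.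
      by apply/ae_foralln => N; apply: L1_integral_shift.
    have H1 := finite_potential_eq0 (SrL i q) (Sr0 i q).
    have H2 := potentialP SS (SrL i q) (Sr0 i q).
    apply: filterS3 (filterI H1 H2) sh (potentialP SS fL f0).
    move=> x [E [_ _ P2]] shx [_ P1 _] pfin; apply: E.
    apply: le_lt_trans pfin; apply: P2; case=> // N _.
    by apply: le_trans (P1 (N.+1 + i.+1)%N isT); rewrite lee_fin.
  by apply: filterS H => x H pfin i q; apply: H.
(* Measurable sets on which all the integrals are at most [m]; together they cover a.e. the set of
   finite potential. *)
pose Z (m : nat) : set T :=
  \bigcap_(N in setT) [set x | L1_integral mu S f N.+1%:R x <= m%:R].
have mZ m : measurable (Z m).
  apply: bigcapT_measurable => N; apply: measurable_sublevel.
  by apply: Lfun_measurable (L1_integralL SS _ fL).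
have Zfin : {ae mu, forall x, forall m, Z m x -> (potential mu S f x < +oo)%E}.
  apply: filterS (potentialP SS fL f0) => x [_ _ P2] m Zx.
  apply: (@le_lt_trans _ _ m%:R%:E); last by rewrite ltry.
  by apply: P2; case=> // N _; rewrite lee_fin; apply: Zx.
have I0 : {ae mu, forall x, forall m N, Z m x -> L1_integral mu S f N.+1%:R x =
  0}.
  apply/ae_foralln => m; apply/ae_foralln => N.
  have IL : L1_integral mu S f N.+1%:R \in L1 by rewrite L1_integralL.
  apply: (L1_cvg_eq0_on (mZ m) _ IL (L1_integral_mesh SS (ltn0Sn N) (ltn0Sn 0)
    fL)).
    by move=> j; rewrite (rsumL le11 SS)// invr_gt0 ltr0n.
  move=> j; apply: filterS2 Zfin fin0 => x Zx fx Zmx.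
  rewrite rsumE big1// => k _.
  move: (nat_of_ord k) => {}k; rewrite mul1n.
  by have := fx (Zx _ Zmx) k j; rewrite /r => ->; rewrite mulr0.
apply: filterS2 I0 (potentialP SS fL f0) => x I0 [P0 P1 P2].
have [pfin|pinf] := boolP (potential mu S f x < +oo)%E; last first.
  by right; apply/eqP; rewrite -leye_eq leNgt.
left; apply/eqP; rewrite eq_le P0 andbT; apply: P2; case=> // N _.
have pE : potential mu S f x = (fine (potential mu S f x))%:E.
  by rewrite fineK// ge0_fin_numE.
rewrite (I0 (Num.trunc (fine (potential mu S f x))).+1)// => n _ /=.
by rewrite ltW// (le_lt_trans _ (truncnS_gt _))// -lee_fin -pE P1.
Qed.

End form_recurrence.

(** * The closure of a form satisfying the sector condition *)

Section closed_form.
Context {dT : measure_display} {T : measurableType dT} {R : realType}.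
Variable mu : {measure set T -> \bar R}.
Variables (F : (T -> R) -> (T -> R) -> R) (C : set (T -> R)) (K : R).
Implicit Types (f g h u v : T -> R) (us vs : nat -> T -> R).
Hypothesis CB : forall f g, C f -> C g -> C (f \- g).
Hypothesis Cm : forall f, C f -> measurable_fun setT f.
Hypothesis FBl : forall f g h, C f -> C g -> C h -> F (f \- g) h = F f h - F g
  h.
Hypothesis FBr : forall f g h, C f -> C g -> C h -> F h (f \- g) = F h f - F h
  g.
Hypothesis K0 : 0 < K.
Hypothesis sector : forall f g, C f -> C g ->
  `|F f g| <= K * Num.sqrt (F f f) * Num.sqrt (F g g).
Hypothesis closable : form_closable mu F C.

Local Notation q f := (F f f).
Local Notation sq f := (Num.sqrt (F f f)).

(** [Num.sqrt] of a negative number is 0, so the sector condition with both arguments equal to [f]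
    excludes a negative value. *)
Lemma sector_ge0 f : C f -> 0 <= q f.
Proof.
move=> Cf; have [//|qf] := leP 0 (q f).
have := sector Cf Cf; rewrite (ler0_sqrtr (ltW qf)) mulr0 normr_le0 => /eqP E.
by rewrite E ltxx in qf.
Qed.

Lemma sqr_sqrt_form f : C f -> sq f ^+ 2 = q f.
Proof. by move=> Cf; rewrite sqr_sqrtr// sector_ge0. Qed.

(** A substitute for the triangle inequality: [F f f - F g g = F (f - g) f + F g (f - g)], both
    terms are bounded by the sector condition, and the common factor [sq f + sq g] is divided
    out. *)
Lemma sqrt_form_lipschitz f g : C f -> C g -> `|sq f - sq g| <= K * sq (f \- g).
Proof.
move=> Cf Cg; have Cfg := CB Cf Cg.
have E : q f - q g = F (f \- g) f + F g (f \- g).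
  by rewrite FBl// FBr//; ring.
have H1 : `|q f - q g| <= K * sq (f \- g) * (sq f + sq g).
  rewrite E; apply: (le_trans (ler_normD _ _)).
  rewrite mulrDr; apply: lerD; first exact: sector.
  by rewrite -mulrA [sq (f \- g) * _]mulrC mulrA; apply: sector.
have [sf sg] := (sqrtr_ge0 (q f), sqrtr_ge0 (q g)).
have [s0|s_gt0] := leP (sq f + sq g) 0.
  have -> : sq f = 0 by lra.
  have -> : sq g = 0 by lra.
  by rewrite subrr normr0 mulr_ge0 ?sqrtr_ge0// ltW.
rewrite -(ler_pM2r s_gt0); apply: le_trans H1.
rewrite -[X in _ * X <= _](gtr0_norm s_gt0) -normrM -subr_sqr.
by rewrite !sqr_sqrt_form.
Qed.

(** Each cross term is at most [K * sq f * sq g] in absolute value, and [2 a b <= a^2 + b^2]. *)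
Lemma form_distB f g : C f -> C g -> q (f \- g) <= (1 + K) * (q f + q g).
Proof.
move=> Cf Cg; have Cfg := CB Cf Cg.
rewrite FBl// !FBr//.
have := sector Cf Cg; have := sector Cg Cf; rewrite !ler_norml.
move=> /andP[H1 _] /andP[H2 _].
have : 0 <= K * (sq f - sq g) ^+ 2 by rewrite mulr_ge0 ?sqr_ge0// ltW.
rewrite sqrrB (sqr_sqrt_form Cf) (sqr_sqrt_form Cg).
move: (sq f) (sq g) (q f) (q g) H1 H2 => a b x y H1 H2; lra.
Qed.

Lemma form_cauchy_sqrt us : (forall n, C (us n)) -> form_cauchy F us ->
  forall e, 0 < e -> exists N, forall m n, (N <= m)%N -> (N <= n)%N ->
    sq (us m \- us n) < e.
Proof.
move=> usC cau e e0; have [N HN] := cau (e ^+ 2) (exprn_gt0 2 e0).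
exists N => m n Nm Nn; have Cmn := CB (usC m) (usC n).
rewrite -(ltr_pXn2r (n := 2))// ?nnegrE ?sqrtr_ge0 ?(ltW e0)//.
rewrite sqr_sqrt_form//; apply: le_lt_trans (HN m n Nm Nn).
exact: ler_norm.
Qed.

Lemma form_cauchy_cvg us : (forall n, C (us n)) -> form_cauchy F us ->
  cvgn (fun n => sq (us n)).
Proof.
move=> usC cau; apply: cauchy_cvg; apply: cauchy_exP => e e0.
have e'0 : 0 < e / K by rewrite divr_gt0.
have [N HN] := form_cauchy_sqrt usC cau e'0.
exists (sq (us N)); exists N => // n /= Nn; rewrite /ball/=.
apply: (le_lt_trans (sqrt_form_lipschitz (usC N) (usC n))).
by rewrite mulrC -ltr_pdivlMr// HN.
Qed.

(** The difference of two approximating sequences is Cauchy for the form and tends to 0 in L^2: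
    exactly the situation covered by closability. *)
Lemma form_approx_sub us vs u : u \in Lfun mu 2%:E -> form_approx mu F C us u ->
  form_approx mu F C vs u -> sq (us n \- vs n) @[n --> \oo] --> 0.
Proof.
move=> uL [usC uscau usu] [vsC vscau vsu]; have mu_ := Lfun_measurable uL.
have cau : form_cauchy F (fun n => us n \- vs n).
  move=> e e0.
  have e'0 : 0 < e / (4 * (1 + K)) by rewrite divr_gt0 ?mulr_gt0 ?addr_gt0.
  have [N1 H1] := uscau _ e'0; have [N2 H2] := vscau _ e'0.
  exists (maxn N1 N2) => m n; rewrite !geq_max => /andP[m1 m2] /andP[n1 n2].
  have Cu := CB (usC m) (usC n); have Cv := CB (vsC m) (vsC n).
  have -> : (us m \- vs m) \- (us n \- vs n) = (us m \- us n) \- (vs m \- vs n).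
    by apply/funext => x /=; ring.
  rewrite ger0_norm ?sector_ge0//; last exact: CB.
  apply: (le_lt_trans (form_distB Cu Cv)).
  rewrite mulrC -ltr_pdivlMr ?addr_gt0//.
  have := H1 m n m1 n1; have := H2 m n m2 n2.
  rewrite !ger0_norm ?sector_ge0// => h1 h2.
  have -> : e / (1 + K) = 4 * (e / (4 * (1 + K))).
    by field; rewrite gt_eqF// addr_gt0.
  by lra.
have c0 : Lp_cvg mu 2%:E (fun n => us n \- vs n) (cst 0).
  rewrite /Lp_cvg.
  (* Minkowski's inequality is taken in the extended reals, as elements of [C] are only assumed
     measurable. *)
  apply: (@squeeze_cvge _ _ _ _ (fun=> 0%E) _ (fun n => Lnorm mu 2%:E
      (EFin \o (us n \- u)%R) + Lnorm mu 2%:E (EFin \o (vs n \- u)%R))%E).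
  - apply: nearW => n; rewrite Lnorm_ge0/=.
    rewrite -[X in (_ <= _ + X)%E]oppe_Lnorm.
    rewrite [X in (X <= _)%E](_ : _ = Lnorm mu 2%:E
        (EFin \o ((us n \- u) \+ (fun x => - (vs n x - u x)))%R)); last first.
      by congr Lnorm; apply/funext => x /=; congr EFin; ring.
    apply: eminkowski; last by rewrite lee_fin ler1n.
      by apply: measurable_funB => //; apply: Cm.
    by apply: measurableT_comp => //; apply: measurable_funB => //; apply: Cm.
  - exact: cvg_cst.
  - by rewrite -[X in _ --> X]adde0; apply: cvgeD.
have CC n : C (us n \- vs n) by apply: CB.
have := closable CC cau c0 => c1.
rewrite -[X in _ --> X](sqrtr0 R).
by apply: continuous_cvg => //; exact: sqrt_continuous.
Qed.

Lemma form_approx_same_lim us vs u (l : R) : u \in Lfun mu 2%:E ->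
  form_approx mu F C us u ->
  form_approx mu F C vs u -> sq (us n) @[n --> \oo] --> l ->
  sq (vs n) @[n --> \oo] --> l.
Proof.
move=> uL usu vsu cu; have [usC _ _] := usu; have [vsC _ _] := vsu.
have c0 := form_approx_sub uL usu vsu.
have d0 : (sq (us n) - sq (vs n)) @[n --> \oo] --> 0.
  apply/norm_cvg0P; apply: (@cvg0_le _ _ (fun n => K * sq (us n \- vs n))).
    by move=> n; rewrite normr_ge0 sqrt_form_lipschitz.
  by rewrite -[X in _ --> X](mulr0 K); apply: cvgM => //; exact: cvg_cst.
have -> : (fun n => sq (vs n)) = (fun n => sq (us n) - (sq (us n) - sq (vs n))).
  by apply/funext => n; rewrite subKr.
by rewrite -[X in _ --> X]subr0; apply: cvgB.
Qed.

(** The value selected in [closure_form] may come from two different sequences [ws] and [vs]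
    approximating [u]. Since [F ws vs = F ws ws - F ws (ws - vs)] and the last term vanishes by the
    sector condition, it is the limit of the diagonal values along any single sequence. *)
Lemma form_approx_cvg us u : u \in Lfun mu 2%:E -> form_approx mu F C us u ->
  0 <= closure_form mu F C u u /\
  sq (us n) @[n --> \oo] --> Num.sqrt (closure_form mu F C u u).
Proof.
move=> uL usu; have [usC uscau _] := usu.
have : cvgn (fun n => sq (us n)) := form_cauchy_cvg usC uscau.
move=> /cvg_ex[l cl].
have ql ws : form_approx mu F C ws u -> q (ws n) @[n --> \oo] --> l ^+ 2.
  move=> wsu; have [wsC _ _] := wsu.
  have cw := form_approx_same_lim uL usu wsu cl.
  have -> : (fun n => q (ws n)) = (fun n => sq (ws n) * sq (ws n)).
    by apply/funext => n; rewrite -expr2 sqr_sqrt_form.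
  by rewrite expr2; apply: cvgM.
have l0 : 0 <= l.
  by apply: (ler_cvg_to (cvg_cst 0) cl); apply: nearW => n; exact: sqrtr_ge0.
suff -> : closure_form mu F C u u = l ^+ 2.
  by rewrite sqr_ge0 sqrtr_sqr ger0_norm.
rewrite /closure_form; case: xgetP => [r _ [ws [vs [wsu vsu cr]]]|H];
  last first.
  (* The default of [xget] is excluded: [us] paired with itself has the limit [l ^+ 2]. *)
  by exfalso; apply: (H (l ^+ 2)); exists us, us; split => //; apply: ql.
have [wsC _ _] := wsu; have [vsC _ _] := vsu.
apply: (cvg_unique _ cr); first exact: Rhausdorff.
have d0 : (F (ws n) (ws n \- vs n)) @[n --> \oo] --> 0.
  apply/norm_cvg0P.
  apply: (@cvg0_le _ _ (fun n => K * sq (ws n) * sq (ws n \- vs n))).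
    by move=> n; rewrite normr_ge0 sector//; apply: CB.
  rewrite -[X in _ --> X](mulr0 (K * l)).
  apply: cvgM; last exact: form_approx_sub uL wsu vsu.
  by apply: cvgM; [exact: cvg_cst|exact: form_approx_same_lim uL usu wsu cl].
apply: (@cvg_eqfun _ (fun n => q (ws n) - F (ws n) (ws n \- vs n))).
  by move=> n; rewrite FBr// subKr.
by rewrite -[X in _ --> X]subr0; apply: cvgB => //; apply: ql.
Qed.

Lemma closure_form_ge0 u : closure_dom mu F C u ->
  0 <= closure_form mu F C u u.
Proof. by move=> [uL [us usu]]; have [] := form_approx_cvg uL usu. Qed.

(** Either the selected value is a limit along approximating sequences, and the bound passes to the
    limit, or it is the default 0 and the bound is trivial. *)
Lemma closure_form_sector u v : closure_dom mu F C u -> closure_dom mu F C v ->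
  `|closure_form mu F C u v| <= K * Num.sqrt (closure_form mu F C u u) *
     Num.sqrt (closure_form mu F C v v).
Proof.
move=> [uL _] [vL _]; rewrite {1}/closure_form.
case: xgetP => [r _ [us [vs [usu vsv cr]]]|_].
  have [_ cu] := form_approx_cvg uL usu; have [_ cv] := form_approx_cvg vL vsv.
  have [usC _ _] := usu; have [vsC _ _] := vsv.
  have H : (K * sq (us n) * sq (vs n)) @[n --> \oo] -->
      K * Num.sqrt (closure_form mu F C u u) *
      Num.sqrt (closure_form mu F C v v).
    by apply: cvgM => //; apply: cvgM => //; exact: cvg_cst.
  apply: (ler_cvg_to (cvg_norm cr) H); apply: nearW => n; exact: sector.
by rewrite normr0 !mulr_ge0 ?sqrtr_ge0// ltW.
Qed.

End closed_form.

(** * Measures with a density on R^d *)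

Section Rd_measure.
Context {R : realType} {d : nat}.
Local Notation X := 'rV[R]_d.
Implicit Types (E K : set X) (f u v : X -> R).

Lemma open_measurable_rV (O : set X) : open O -> measurable O.
Proof. by move=> oO; apply: sub_sigma_algebra. Qed.

Lemma closed_measurable_rV (A : set X) : closed A -> measurable A.
Proof.
move=> cA; rewrite -(setCK A); apply: measurableC; apply: open_measurable_rV.
exact: closed_openC.
Qed.

Lemma continuous_measurable_rV f : continuous f -> measurable_fun setT f.
Proof.
move=> cf; apply: (measurability _ (RGenOpens.measurableE R)).
move=> _ [_ [a [b ->]] <-]; rewrite setTI; apply: open_measurable_rV.
by move/continuousP : cf; apply; exact: interval_open.
Qed.

(** Balls of radius [n] are intersected with [E] if it is closed, and with the points at distance at
    least [1 / (n+1)] from the complement if it is open. *)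
Lemma compact_exhaustion E : open E \/ closed E ->
  exists K : nat -> set X, (forall n, compact (K n) /\ K n `<=` E) /\
    E `<=` \bigcup_n K n.
Proof.
have cb n : closed [set x : X | `|x| <= n%:R].
  rewrite (_ : [set x | _] = (@Num.norm _ _) @^-1` [set t : R | t <= n%:R])//.
  by apply: closed_comp => [x _|]; [exact: norm_continuous|exact: closed_le].
have comp (A : set X) n : closed A -> compact (A `&` [set x : X | `|x| <=
  n%:R]).
  move=> cA; apply: bounded_closed_compact; last exact: closedI.
  exists n%:R; split; first exact: num_real.
  by move=> M nM x [_ /= xn]; rewrite (le_trans xn)// ltW.
move=> [oE|cE]; last first.
  exists (fun n => E `&` [set x : X | `|x| <= n%:R]); split.
    by move=> n; split; [exact: comp|move=> x []].
  move=> x Ex; exists (Num.trunc `|x|).+1 => //; split => //=.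
  by rewrite ltW// truncnS_gt.
pose F (n : nat) : set X := [set x | forall y, `|x - y| < n.+1%:R^-1 -> E y].
have cF n : closed (F n).
  rewrite (_ : F n = ~` \bigcup_(y in ~` E) ball y n.+1%:R^-1).
    apply: open_closedC; apply: bigcup_open => y _.
    by apply: ball_open; rewrite invr_gt0.
  apply/seteqP; split => [x Fx [y Ey]|x Hx y xy].
    by rewrite -ball_normE/= distrC => /Fx.
  apply: contrapT => Ey; apply: Hx; exists y => //.
  by rewrite -ball_normE/= distrC.
exists (fun n => F n `&` [set x : X | `|x| <= n%:R]); split.
  move=> n; split; first exact: comp.
  by move=> x [Fx _]; apply: Fx; rewrite subrr normr0 invr_gt0.
move=> x Ex.
have /nbhs_ballP[e /= e0 xe] : nbhs x E by apply: open_nbhs_nbhs.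
have [m _ /(_ m (leqnn _))/= me] := near_infty_natSinv_lt (PosNum e0).
pose n := maxn m (Num.trunc `|x|).+1.
exists n => //; split => /=.
  move=> y xy; apply: xe; rewrite -ball_normE/=; apply: (lt_le_trans xy).
  apply: le_trans (ltW me); rewrite lef_pV2 ?posrE// ler_nat ltnS.
  exact: leq_maxl.
rewrite ltW// (lt_le_trans (truncnS_gt `|x|))// ler_nat.
exact: leq_maxr.
Qed.

Variables (lam mu : {measure set X -> \bar R}) (phi : X -> R) (E : set X).
Hypothesis E_open_closed : open E \/ closed E.
Hypothesis phi_loc : Lp_loc lam 1 E phi.
Hypothesis mu_density : is_density mu lam E phi.

Lemma E_measurable : measurable E.
Proof.
by case: E_open_closed; [exact: open_measurable_rV|exact: closed_measurable_rV].
Qed.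

Lemma compact_measurable_rV K : compact K -> measurable K.
Proof.
by move=> cK; apply: closed_measurable_rV; apply: compact_closed.
Qed.

Lemma density_compact_lty K : compact K -> K `<=` E -> (mu K < +oo)%E.
Proof.
move=> cK KE; have mK := compact_measurable_rV cK.
have [mphi /(_ K cK KE) /integrableP[_ iK]] := phi_loc.
rewrite mu_density// setIidl//.
have mphiK : measurable_fun K (EFin \o phi).
  by apply/measurable_EFinP; apply: measurable_funS mphi => //;
    exact: E_measurable.
apply: (@le_lt_trans _ _ (\int[lam]_(x in K) `|(phi x)%:E|)%E).
  apply: le_trans (le_abse_integral lam mK mphiK).
  exact: lee_abs.
apply: le_lt_trans iK; apply: ge0_le_integral => //.
- exact: measurableT_comp.
- apply: measurableT_comp => //; apply/measurable_EFinP.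
  apply: measurable_funX; apply: measurableT_comp => //.
  exact/measurable_EFinP.
- by move=> x _ /=; rewrite expr1 normr_id.
Qed.

Lemma density_setC : mu (~` E) = 0%E.
Proof.
rewrite mu_density ?setICl ?integral_set0//.
by apply: measurableC; exact: E_measurable.
Qed.

Lemma ae_mem_E : {ae mu, forall x, E x}.
Proof.
exists (~` E); split; [|exact: density_setC|by move=> x].
by apply: measurableC; exact: E_measurable.
Qed.

(* [\sum_k 2^-(k+1) / (1 + mu (K k)) 1_(K k)] for compact sets [K k] covering
   [E]. *)
Lemma positive_integrable_weight : exists w : X -> R,
  [/\ w \in Lfun mu 1, {ae mu, forall x, 0 < w x} &
      {ae mu, forall x, w x <= 1}].
Proof.
have [K [KP Kcov]] := compact_exhaustion E_open_closed.
have mK n : measurable (K n) by apply: compact_measurable_rV; case: (KP n).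
have fK n : mu (K n) \is a fin_num.
  by rewrite ge0_fin_numE//; case: (KP n) => cK KE; exact: density_compact_lty.
(* Dividing by [1 + mu (K n)] bounds both the supremum and the integral of the [n]-th term by
   [2^-(n+1)], so the sum is at most 1 pointwise and in L^1. *)
pose c n : R := 1 / (2 ^ n.+1)%:R / (1 + fine (mu (K n))).
have m0 n : 0 <= fine (mu (K n)) by rewrite fine_ge0.
have m1 n : 0 < 1 + fine (mu (K n)) by rewrite ltr_wpDr.
have c0 n : 0 < c n by rewrite !divr_gt0// ltr0n expn_gt0.
have c1 n : c n <= 1 / (2 ^ n.+1)%:R.
  by rewrite ler_pdivrMr// ler_peMr ?lerDl// divr_ge0.
pose h n x : \bar R := (c n * \1_(K n) x)%:E.
have h0 n x : (0 <= h n x)%E by rewrite lee_fin mulr_ge0 ?(ltW (c0 n)).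
have mh n : measurable_fun setT (h n).
  by apply/measurable_EFinP; apply: measurable_funM.
pose W x : \bar R := (\sum_(0 <= n <oo) h n x)%E.
have W1 x : (W x <= 1)%E.
  apply: le_trans (epsilon_trick0 xpredT (@ler01 R)).
  apply: lee_nneseries => [n _ _|n _]; first exact: h0.
  rewrite lee_fin; apply: le_trans (c1 n); rewrite ler_piMr ?(ltW (c0 n))//.
have W0 x : (0 <= W x)%E by apply: nneseries_ge0.
have WE x : W x = (fine (W x))%:E.
  by rewrite fineK// ge0_fin_numE// (le_lt_trans (W1 x))// ltry.
have mW : measurable_fun setT W by apply: ge0_emeasurable_sum.
exists (fun x => fine (W x)); split.
- apply: L1_abs_fin; first exact: measurableT_comp.
  rewrite (_ : (\int[mu]_x `|fine (W x)|%:E)%E = (\int[mu]_x W x)%E);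
    last first.
    apply: eq_integral => x _; rewrite ger0_norm ?fine_ge0// fineK//.
  rewrite integral_nneseries//; apply: (@le_lt_trans _ _ 1%E);
    last by rewrite ltry.
  apply: le_trans (epsilon_trick0 xpredT (@ler01 R)).
  apply: lee_nneseries => [n _ _|n _]; first by apply: integral_ge0.
  rewrite (_ : (\int[mu]_x h n x = (c n)%:E * mu (K n))%E); last first.
    rewrite /h; under eq_integral do rewrite EFinM.
    rewrite ge0_integralZl ?lee_fin ?(ltW (c0 n))// ?integral_indic ?setIT//.
    by apply/measurable_EFinP; exact: measurable_indic.
  rewrite -(fineK (fK n)) -EFinM lee_fin /c mulrAC ler_pdivrMr//.
  by rewrite ler_wpM2l ?divr_ge0// lerDr.
- apply: filterS ae_mem_E => x /Kcov[n _ Knx].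
  rewrite fine_gt0//; apply/andP; split;
    last by rewrite (le_lt_trans (W1 x))// ltry.
  apply: (@lt_le_trans _ _ (h n x)).
    by rewrite lte_fin indicE mem_set// mulr1.
  apply: le_trans (nneseries_lim_ge n.+1 _) => [|k _ _]; last exact: h0.
  rewrite big_nat_recr//= leeDr// sume_ge0//.
- by apply: filterE => x; rewrite -lee_fin -WE.
Qed.

End Rd_measure.

(** * The form E^0 on test functions *)

Section test_functions.
Context {R : realType} {d : nat}.
Local Notation X := 'rV[R]_d.
Implicit Types (E K : set X) (f g h u v : X -> R).

Lemma foldr_partialB f g (s : seq 'I_d) : smooth f -> smooth g ->
  foldr partial (f \- g) s = foldr partial f s \- foldr partial g s.
Proof.
move=> sf sg; elim: s => [//|i s IH] /=; rewrite IH.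
apply/funext => x; rewrite /partial.
exact: (deriveB ((sf s).2 i x) ((sg s).2 i x)).
Qed.

Lemma smoothB f g : smooth f -> smooth g -> smooth (f \- g).
Proof.
move=> sf sg s; rewrite foldr_partialB//; split.
  by move=> x; apply: continuousB; [apply: (sf s).1|apply: (sg s).1].
by move=> i x; apply: derivableB; [exact: (sf s).2|exact: (sg s).2].
Qed.

Lemma partialB f g i x : smooth f -> smooth g ->
  partial i (f \- g) x = partial i f x - partial i g x.
Proof.
by move=> sf sg; have := foldr_partialB [:: i] sf sg => /= /(congr1 (@^~ x)).
Qed.

Lemma continuous_partial f i : smooth f -> continuous (partial i f).
Proof. by move=> sf; apply: (sf [:: i]).1. Qed.

Lemma test_funB E f g : test_fun E f -> test_fun E g -> test_fun E (f \- g).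
Proof.
move=> [sf cf fE] [sg cg gE].
have sub : closure [set x | (f \- g) x != 0] `<=`
    closure [set x | f x != 0] `|` closure [set x | g x != 0].
  rewrite -closureU; apply: closure_subset => x /= fg.
  have [fx|fx] := eqVneq (f x) 0; last by left.
  by right; apply: contra fg => /eqP gx; rewrite fx gx subrr.
split; first exact: smoothB.
- apply: subclosed_compact sub; first exact: closed_closure.
  exact: compactU.
- by move=> oE x /sub[/(fE oE)|/(gE oE)].
Qed.

Lemma partial_outside_support f i x : ~ closure [set x | f x != 0] x ->
  partial i f x = 0.
Proof.
move=> xS; rewrite /partial -[RHS](derive_cst (0 : R) x (delta_mx ord0 i)).
apply: near_eq_derive;
  have oS := closed_openC (@closed_closure _ [set x | f x != 0]).
have : nbhs x (~` closure [set x | f x != 0]) by apply: open_nbhs_nbhs.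
apply: filterS => y Sy; apply: contrapT => fy; apply: Sy.
by apply: subset_closure; apply/eqP.
Qed.

Lemma partial_bounded E f i : test_fun E f ->
  exists2 M : R, 0 <= M & forall x, `|partial i f x| <= M.
Proof.
move=> [sf cS _]; set S := closure _ in cS.
have cp : {within S, continuous (partial i f)}.
  by apply: continuous_subspaceT; exact: continuous_partial.
have [M [_ HM]] := compact_bounded (continuous_compact cp cS).
(* Boundedness on the compact support holds for every constant strictly above [M]; this one is also
   nonnegative. *)
exists (Num.max M 0 + 1); first by rewrite addr_ge0// le_max lexx orbT.
move=> x; have [Sx|Sx] := pselect (S x).
  apply: (HM (Num.max M 0 + 1)); last by exists x.
  by rewrite ltr_pwDr// le_max lexx.
by rewrite partial_outside_support// normr0 addr_ge0// le_max lexx orbT.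
Qed.

Variables (mu : {measure set X -> \bar R}) (E : set X) (A : X -> 'M[R]_d).
Hypothesis E_open_closed : open E \/ closed E.
Hypothesis A_loc : forall i j, Lp_loc mu 1 E (fun x => A x i j).

Let mE : measurable E. Proof. exact: E_measurable. Qed.

(** For [E] closed a test function is represented by an extension whose support may leave [E];
    intersecting with the closed set [E] keeps it compact. *)
Lemma test_support_compact f : test_fun E f ->
  compact (E `&` closure [set x | f x != 0]).
Proof.
move=> [_ cS SE]; case: E_open_closed => [oE|cE].
  by rewrite setIidr//; apply: SE.
by rewrite setIC; apply: compact_closedI.
Qed.

(** The derivatives are bounded and the integrand vanishes outside the compact part of the support
    of [f] in [E], where the coefficients are integrable. *)
Lemma preform_integrand_integrable f h i j : test_fun E f -> test_fun E h ->
  mu.-integrable E (EFin \o (fun x => A x i j * partial j f x * partial i h x)).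
Proof.
move=> tf th; have [sf _ _] := tf; have [sh _ _] := th.
have [M M0 fM] := partial_bounded j tf; have [N N0 hN] := partial_bounded i th.
have cK := test_support_compact tf.
set K := E `&` _ in cK.
have mK : measurable K by exact: compact_measurable_rV.
have [mA /(_ K cK (@subIsetl _ _ _)) /integrableP[mAK iA]] := A_loc i j.
have mp f' k : smooth f' -> measurable_fun E (partial k f').
  move=> sf'; apply: measurable_funTS; apply: continuous_measurable_rV.
  exact: continuous_partial.
pose I x : R := A x i j * partial j f x * partial i h x.
rewrite -[X in integrable _ _ (EFin \o X)]/I.
have mI : measurable_fun E (EFin \o I).
  apply/measurable_EFinP; apply: measurable_funM; last exact: mp.
  by apply: measurable_funM => //; exact: mp.
apply/integrableP; split => //.
have -> : (\int[mu]_(x in E) `|(EFin \o I) x| =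
    \int[mu]_(x in K) `|(EFin \o I) x|)%E.
  rewrite /K integral_mkcondr; apply: eq_integral => x _; rewrite patchE.
  case: ifPn => // /negP xS; rewrite /= /I partial_outside_support; last first.
    by move=> ?; apply: xS; apply/mem_set.
  by rewrite mulr0 mul0r normr0.
apply: (@le_lt_trans _ _ (\int[mu]_(x in K) ((M * N)%:E * `|(`|A x i j| ^+
  1)%:E|))%E).
  apply: ge0_le_integral => //.
  - by apply: measurableT_comp => //; apply: measurable_funS mI => //;
      exact: subIsetl.
  - by apply: emeasurable_funM => //; apply: measurableT_comp.
  - move=> x _; rewrite /= lee_fin expr1 normr_id /I !normrM.
    rewrite [leRHS]mulrC -mulrA ler_wpM2l//.
    exact: ler_pM.
rewrite ge0_integralZl// ?lee_fin ?mulr_ge0//; last exact: measurableT_comp.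
by rewrite lte_mul_pinfty// lee_fin mulr_ge0.
Qed.

Lemma preformE f h : preform mu E A f h = \int[mu]_(x in E) (\sum_(i < d)
  \sum_(j < d) A x i j * partial j f x * partial i h x).
Proof.
apply: eq_Rintegral => x _; apply: eq_bigr => i _; apply: eq_bigr => j _.
by rewrite !mxE.
Qed.

Lemma preform_sum_integrable f h : test_fun E f -> test_fun E h ->
  mu.-integrable E (EFin \o (fun x => \sum_(i < d) \sum_(j < d)
    A x i j * partial j f x * partial i h x)).
Proof.
move=> tf th.
rewrite (_ : _ \o _ = (fun x => \sum_(i < d) \sum_(j < d)
    (A x i j * partial j f x * partial i h x)%:E)%E); last first.
  apply/funext => x /=; rewrite -sumEFin; apply: eq_bigr => i _.
  by rewrite -sumEFin.
apply: integrable_sum => // i _; apply: integrable_sum => // j _.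
exact: preform_integrand_integrable.
Qed.

Lemma preformBl f g h : test_fun E f -> test_fun E g -> test_fun E h ->
  preform mu E A (f \- g) h = preform mu E A f h - preform mu E A g h.
Proof.
move=> tf tg th; have [sf _ _] := tf; have [sg _ _] := tg.
rewrite !preformE -RintegralB//; last 2 first.
- exact: preform_sum_integrable.
- exact: preform_sum_integrable.
apply: eq_Rintegral => x _; rewrite -sumrB; apply: eq_bigr => i _.
by rewrite -sumrB; apply: eq_bigr => j _; rewrite partialB//; ring.
Qed.

Lemma preformBr f g h : test_fun E f -> test_fun E g -> test_fun E h ->
  preform mu E A h (f \- g) = preform mu E A h f - preform mu E A h g.
Proof.
move=> tf tg th; have [sf _ _] := tf; have [sg _ _] := tg.
rewrite !preformE -RintegralB//; last 2 first.
- exact: preform_sum_integrable.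
- exact: preform_sum_integrable.
apply: eq_Rintegral => x _; rewrite -sumrB; apply: eq_bigr => i _.
by rewrite -sumrB; apply: eq_bigr => j _; rewrite partialB//; ring.
Qed.

Lemma test_fun_measurable f : test_fun E f -> measurable_fun setT f.
Proof.
by move=> [sf _ _]; apply: continuous_measurable_rV; apply: (sf [::]).1.
Qed.

Hypothesis closable : form_closable mu (preform mu E A) (test_fun E).

Lemma E0_ge0 u : strong_sector (preform mu E A) (test_fun E) ->
  dom_E0 mu E A u -> 0 <= E0 mu E A u u.
Proof.
move=> [K K0 sec] uD.
exact: (closure_form_ge0 (@test_funB E) test_fun_measurable preformBl preformBr
  K0 sec closable uD).
Qed.

Lemma closed_E0_sector : strong_sector (preform mu E A) (test_fun E) ->
  exists2 K : R, 0 < K & forall u v, dom_E0 mu E A u -> dom_E0 mu E A v ->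
    `|E0 mu E A u v| <= K * Num.sqrt (E0 mu E A u u) * Num.sqrt (E0 mu E A v v).
Proof.
move=> [K K0 sec]; exists K => // u v uD vD.
exact: (closure_form_sector (@test_funB E) test_fun_measurable preformBl
  preformBr K0 sec closable uD vD).
Qed.

End test_functions.

(** * Both conclusions, for [Lbar] and for the symmetric form *)

Unset Implicit Arguments.
Set Strict Implicit.

Theorem theorem18 (R : realType) (d : nat) (E : set 'rV[R]_d)
  (lam mu : {measure set 'rV[R]_d -> \bar R}) (phi : 'rV[R]_d -> R)
  (A : 'rV[R]_d -> 'M[R]_d) (B : 'rV[R]_d -> 'rV[R]_d)
  (GV : set 'rV[R]_d -> R -> ('rV[R]_d -> R) -> ('rV[R]_d -> R))
  (G T : R -> ('rV[R]_d -> R) -> ('rV[R]_d -> R))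
  (* dx, E, mu = phi dx *)
  (lebesgue_lam : is_lebesgue_measure lam)
  (E_open_closed : open E \/ (closed E /\ lam (closure E `\` interior E) = 0%E))
  (phi_loc : Lp_loc lam 1 E phi)
  (phi_gt0 : {ae lam, forall x, E x -> 0 < phi x})
  (mu_density : is_density mu lam E phi)
  (mu_full : full_support mu E)
  (* A and the form E^0 *)
  (A_loc : forall i j, Lp_loc mu 1 E (fun x => A x i j))
  (A_elliptic : locally_elliptic E A)
  (E0_closable : form_closable mu (preform mu E A) (test_fun E))
  (E0_sector : strong_sector (preform mu E A) (test_fun E))
  (* B *)
  (B_loc : forall i, Lp_loc mu 2 E (fun x => B x ord0 i))
  (B_div : divergence_free mu E B)
  (L0_dense : Lp_dense mu 1 (dom_L0_0b mu E A))
  (* the resolvents generated by the closures of the L^V *)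
  (LV_closable : forall V, rel_compact E V -> L1_closable mu (op_LV mu E A B V))
  (GV_resolvent : forall V, rel_compact E V -> subMarkov_resolvent mu 1 V (GV V))
  (GV_generator : forall V, rel_compact E V -> forall u h,
     L1_closure mu V (op_LV mu E A B V) u h <->
     resolvent_generator mu 1 V (GV V) u h)
  (* the limit resolvent, whose generator is Lbar, and its semigroup *)
  (G_limit : forall (a : R) f V_, 0 < a -> f \in Lfun mu 1 -> exhaustion E V_ ->
     {ae mu, forall x, GV (V_ n) a (fun y => f y * \1_(V_ n) y) x @[n --> \oo] --> G a f x})
  (G_resolvent : subMarkov_resolvent mu 1 setT G)
  (T_semigroup : subMarkov_semigroup mu 1 T)
  (T_generator : forall u h,
     resolvent_generator mu 1 setT G u h <-> semigroup_generator mu 1 T u h)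
  (* established properties of Lbar *)
  (Lbar_extends : forall u k h, dom_L0_0b mu E A u -> gen_L0 mu E A u k ->
     h \in Lfun mu 1 ->
     {ae mu, forall x, h x = k x + dotp (B x) (weak_grad mu E A u x)} ->
     resolvent_generator mu 1 setT G u h)
  (Lbar_dom : forall u h, resolvent_generator mu 1 setT G u h ->
     ae_bounded mu u -> dom_E0 mu E A u)
  (Lbar_form : forall u h v, resolvent_generator mu 1 setT G u h ->
     ae_bounded mu u -> dom_E0_loc mu E A v -> ae_bounded mu v ->
     E0 mu E A u v
       - (\int[mu]_(x in E) (dotp (B x) (weak_grad mu E A u x) * v x))
     = - \int[mu]_(x in E) (h x * v x))
  (Lbar_energy : forall u h, resolvent_generator mu 1 setT G u h ->
     ae_bounded mu u ->
     E0 mu E A u u <= - \int[mu]_(x in E) (h x * u x)) :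
  recurrent mu T ->
  (* Lchi n is Lbar (chi n) *)
  (exists chi Lchi : nat -> 'rV[R]_d -> R,
    [/\ forall n, resolvent_generator mu 1 setT G (chi n) (Lchi n),
        forall n, ae_bounded mu (chi n),
        forall n, unit_valued mu (chi n) &
        {ae mu, forall x, chi n x @[n --> \oo] --> (1 : R)}] /\
    [/\ (- \int[mu]_(x in E) (Lchi n x * chi n x)) @[n --> \oo] --> (0 : R),
        {ae mu, forall x, - Lchi n x @[n --> \oo] --> (0 : R)} &
        Lp_cvg mu 1 (fun n x => - Lchi n x) (cst 0)]) /\
  form_recurrent mu (sym_form (E0 mu E A)) (dom_E0 mu E A).
Proof.
move=> rec.
have E_oc : open E \/ closed E.
  by case: E_open_closed => [|[]]; [left|right].
have mE : measurable E by exact: E_measurable.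
have le11 : (1 : R) <= 1 by [].
have [w [wL w0 w1]] := positive_integrable_weight E_oc phi_loc mu_density.
have gen u h : resolvent_generator mu 1 setT G u h ->
    semigroup_generator mu 1 T u h by move/T_generator.
have [chi [Lchi [cgen cunit ccvg Lcvg Lnrm]]] :=
  recurrent_approximation G_resolvent T_semigroup gen rec wL w0 w1.
have cb n : ae_bounded mu (chi n).
  by exists 1; apply: filterS (cunit n) => x /andP[c0 c1]; rewrite ger0_norm.
have cL n : chi n \in Lfun mu 1 by case: (cgen n) => /Lp_on_setT.
have LL n : Lchi n \in Lfun mu 1 by case: (cgen n) => _ /Lp_on_setT.
have energy : (- \int[mu]_(x in E) (Lchi n x * chi n x)) @[n --> \oo] --> (0 :
  R).
  (* As [0 <= chi n <= 1], the integral is bounded by the L^1-norm of [Lchi n], which tends to 0. *)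
  apply/norm_cvg0P; apply: (@cvg0_le _ _ (fun n => nrm mu 1 (Lchi n))) => // n.
  rewrite normr_ge0 normrN /=.
  have mLc : measurable_fun setT (fun x => Lchi n x * chi n x).
    by apply: measurable_funM; apply: Lfun_measurable; [exact: LL|exact: cL].
  have le : {ae mu, forall x, `|Lchi n x * chi n x| <= `|Lchi n x|}.
    apply: filterS (cunit n) => x /andP[c0 c1].
    by rewrite normrM ler_piMr// ger0_norm.
  have LcL : (fun x => Lchi n x * chi n x) \in Lfun mu 1.
    exact: L1_dominated mLc (LL n) le.
  apply: le_trans (nrm1_le LcL (LL n) le).
  have iE : mu.-integrable E (EFin \o (fun x => Lchi n x * chi n x)).
    by apply: integrableS (L1_integrable LcL).
  apply: (le_trans (le_normr_Rintegral mE iE)).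
  rewrite -lee_fin -nrm1_fine// /Rintegral fineK; last first.
    rewrite ge0_fin_numE ?integral_ge0//.
    by have /integrableP[_] := iE.
  apply: ge0_subset_integral => //.
  by apply/measurable_EFinP; apply: measurableT_comp.
split.
  exists chi, Lchi; split; split => //.
  have NL n : - Lchi n \in Lfun mu 1 by apply: LfunN.
  have L0 : (0 : 'rV[R]_d -> R) \in Lfun mu 1 by apply: Lfun_cst0.
  apply/(Lp_cvgP le11 NL L0); apply: cvg_eqfun Lnrm => n.
  by rewrite subr0 nrmN.
move=> S [SS [P [SP PF SPE]]].
have [K K0 sec] := closed_E0_sector E_oc A_loc E0_closable E0_sector.
have cD n : dom_E0 mu E A (chi n) by apply: Lbar_dom (cgen n) (cb n).
have E0p u : dom_E0 mu E A u -> 0 <= E0 mu E A u u by exact: E0_ge0.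
have symE u : sym_form (E0 mu E A) u u = E0 mu E A u u.
  by rewrite /sym_form; field.
apply: (@form_semigroup_recurrent _ _ _ mu S P SS SP SPE
  (sym_form (E0 mu E A)) (dom_E0 mu E A) K _ _ _ _ chi) => //.
- by move=> u h /PF.
- by move=> u uD; rewrite symE; apply: E0p.
- exact: ltW.
(* The symmetric part averages two values with the same sector bound, so the constant [K] is
   kept. *)
- move=> u v uD vD; rewrite !symE /sym_form normrM ger0_norm ?invr_ge0//.
  rewrite ler_pdivrMl//; apply: (le_trans (ler_normD _ _)).
  have H1 := sec u v uD vD; have H2 := sec v u vD uD.
  apply: le_trans (lerD H1 H2) _; lra.
- by move=> n; case: (cD n).
(* The energy inequality for [Lbar] transfers the vanishing of [(- Lbar chi_n, chi_n)] to the
   symmetric form, which has the same diagonal as [E0]. *)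
- apply: (@cvg0_le _ _ (fun n => - \int[mu]_(x in E) (Lchi n x * chi n x))) =>
    // n.
  by rewrite symE E0p//= Lbar_energy.
Qed.
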